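(* Let $(\mathcal X_{\mathcal F},\mathcal A_{\mathcal F})$ be the Farey cluster ensemble. Then: i) $\mathcal X_{\mathcal F}(\mathbb R_{>0})$ is identified with the universal Teichmüller space $\mathcal X^+$. ii) $\mathcal A_{\mathcal F}(\mathbb R_{>0})$ is identified with the universal decorated Teichmüller space $\mathcal A^+$. iii) The cluster modular group $\Gamma$ of the Farey cluster ensemble is the Thompson group $\mathbb T$. It is isomorphic to the special cluster modular group $\widehat\Gamma$.
   Context: Farey seed. Consider the Farey triangulation of the hyperbolic plane: the ideal triangulation obtained from the ideal triangle with vertices $0,1,\infty$ by repeated reflections in the sides; its set of vertices is $\mathbb P^1(\mathbb Q)=\mathbb Q\cup\{\infty\}$. Let $I=I_{\mathcal F}$ be its (infinite) set of edges. For edges $E,F$ put $\varepsilon_{EF}=\sum_t\delta_{t,E,F}$, the sum over triangles $t$ having both $E\neq F$ as sides, with $\delta_{t,E,F}=+1$ (resp. $-1$) if $F$ goes right after (resp. right before) $E$ in the counterclockwise cyclic order of the sides of $t$. This is skew-symmetric with values in $\{0,\pm1\}$, and for fixed $E$ only finitely many $\varepsilon_{EF}$ are non-zero. All multipliers are $1$, and there are no frozen elements. Mutations: $\varepsilon'_{ij}=-\varepsilon_{ij}$ if $k\in\{i,j\}$; $\varepsilon'_{ij}=\varepsilon_{ij}$ if $k\notin\{i,j\}$ and $\varepsilon_{ik}\varepsilon_{kj}\le 0$; $\varepsilon'_{ij}=\varepsilon_{ij}+|\varepsilon_{ik}|\varepsilon_{kj}$ if $k\notin\{i,j\}$, $\varepsilon_{ik}\varepsilon_{kj}>0$.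 They act on coordinates by $$\mu_k^*X'_k=X_k^{-1},\quad \mu_k^*X'_i=X_i(1+X_k^{-\mathrm{sgn}(\varepsilon_{ik})})^{-\varepsilon_{ik}}\ (i\ne k),$$ $$A_k\,\mu_k^*A'_k=\prod_{\varepsilon_{kj}>0}A_j^{\varepsilon_{kj}}+\prod_{\varepsilon_{kj}<0}A_j^{-\varepsilon_{kj}},\quad \mu_k^*A'_i=A_i\ (i\neq k).$$ Seed isomorphisms (bijections of index sets preserving $\varepsilon$) act by relabelling. Cluster transformations are finite compositions of mutations and seed isomorphisms; seeds so related are equivalent. $\mathcal X_{\mathcal F}(\mathbb R_{>0})$ (resp. $\mathcal A_{\mathcal F}(\mathbb R_{>0})$) is the set obtained by identifying, via cluster transformations, the sets $\mathbb R_{>0}^{I}$ of positive values of the $\mathcal X$- (resp. $\mathcal A$-) coordinates for all seeds equivalent to the Farey seed. $\Gamma$ is the group of seed cluster transformations of the Farey seed to itself modulo the trivial ones (those inducing the identity on both the $\mathcal A$- and the $\mathcal X$-coordinates). $\widehat\Gamma$ is the group of seed cluster transformations of the Farey seed to itself modulo the special trivial ones, i.e. modulo the relations coming from compositions of isomorphisms and the transformations $(\sigma_{ij}\circ\mu_i)^{h+2}$, where $\sigma_{ij}$ interchanges the labels $i\ne j$, $\varepsilon_{ij}=-p\varepsilon_{ji}=-p$ and $h=2,3,4,6$ for $p=0,1,2,3$ (with $\mu_k\circ\mu_k$ equal to the identity). Universal Teichmüller spaces. $\mathcal X^+$ is the set of maps $\beta:\mathbb P^1(\mathbb Q)\to\mathbb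 P^1(\mathbb R)$ respecting the natural (strict) cyclic orders, modulo the action of $PGL_2(\mathbb R)$ (two such maps are equivalent if they differ by an element of $PGL_2(\mathbb R)$). Let $\mathbb S^1(\mathbb R)$ be the set of rays in $\mathbb R^2\setminus\{0\}$, $\mathbb S^1(\mathbb Q)$ the subset of rays with rational slope (including the vertical ones), and $s$ the antipodal involution. $\mathcal A^+$ is the set of maps $\alpha:\mathbb S^1(\mathbb Q)\to\mathbb R^2\setminus\{0\}$ with $\alpha(s(x))=-\alpha(x)$ such that the composition $\mathbb S^1(\mathbb Q)\to\mathbb R^2\setminus\{0\}\to\mathbb S^1(\mathbb R)$ respects the cyclic orders, modulo the action of $SL_2(\mathbb R)$. Identifications. In i) the class of $\beta$ corresponds to the point whose coordinate at an edge $E$ of the Farey triangulation is $r^+(\beta(v_1),\beta(v_2),\beta(v_3),\beta(v_4))$, where $v_1,\dots,v_4$ are the vertices, in clockwise order and with $v_1\notin E$, of the quadrilateral formed by the two triangles sharing $E$, and $r^+(x_1,x_2,x_3,x_4)=\frac{(x_1-x_2)(x_3-x_4)}{(x_2-x_3)(x_1-x_4)}$. In ii) the class of $\alpha$ corresponds to the point whose coordinate at $E$ is the absolute value of the area of the parallelogram generated by the vectors (well defined up to sign) that $\alpha$ assigns to the two endpoints of $E$. Thompson group. $\mathbb T$ is the group of all piecewise $PSL_2(\mathbb Z)$ automorphisms of $\mathbb P^1(\mathbb Q)$: bijections $g$ for which there is a decomposition of $\mathbb P^1(\mathbb Q)$ into a finite union of (closed) segments overlapping only at their ends, such that the restriction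 of $g$ to each segment is given by an element of $PSL_2(\mathbb Z)$. *)

(* Defs.v *)
From HB Require Import structures.
From mathcomp Require Import all_boot all_order all_algebra finmap.
From mathcomp Require Import boolp classical_sets functions fsbigop reals.
From mathcomp Require Import interval_inference.
From Stdlib Require Import Relation_Operators.
Set Implicit Arguments.
Unset Strict Implicit.
Unset Printing Implicit Defensive.
Import Order.TTheory GRing.Theory Num.Theory.
Local Open Scope ring_scope.
Local Open Scope classical_set_scope.
Local Open Scope quotient_scope.

Record seed (I : Type) := Seed {
  exch :> I -> I -> int;
  exch_skew : forall i j, exch i j = - exch j i
}.

Record relabeling (I : Type) := Relabeling {
  relab :> I -> I;
  unrelab : I -> I;
  relabK : cancel relab unrelab;
  unrelabK : cancel unrelab relab
}.

Definition relab_id (I : Type) : relabeling I :=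
  @Relabeling I id id (fun _ => erefl) (fun _ => erefl).

Definition relab_inv (I : Type) (s : relabeling I) : relabeling I :=
  Relabeling (unrelabK s) (relabK s).

Definition relab_comp (I : Type) (s t : relabeling I) : relabeling I :=
  Relabeling (can_comp (relabK s) (relabK t))
             (can_comp (unrelabK t) (unrelabK s)).

Lemma relab_ext (I : Type) (s t : relabeling I) :
  relab s =1 relab t -> unrelab s =1 unrelab t -> s = t.
Proof.
case: s t => [f g p q] [f' g' p' q'] /= /funext Ef /funext Eg.
case: _ / Ef p' q' => p' q'; case: _ / Eg p' q' => p' q'.
by congr Relabeling; apply: Prop_irrelevance.
Qed.

Lemma relab_compV (I : Type) (s : relabeling I) :
  relab_comp (relab_inv s) s = relab_id I.
Proof. by apply: relab_ext => x /=; rewrite relabK. Qed.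

Definition swap_fun (I : eqType) (i j x : I) :=
  if x == i then j else if x == j then i else x.

Lemma swap_funK (I : eqType) (i j : I) : involutive (swap_fun i j).
Proof.
move=> x; rewrite /swap_fun; case: (eqVneq x i) => [->|ni].
  by case: (eqVneq j i) => [->|]; rewrite ?eqxx.
case: (eqVneq x j) => [->|nj]; first by rewrite eqxx.
by rewrite (negPf ni) (negPf nj).
Qed.

Definition relab_swap (I : eqType) (i j : I) : relabeling I :=
  Relabeling (@swap_funK I i j) (@swap_funK I i j).

(* A cluster transformation is given by the word of its elementary steps,
   written as a composition: the rightmost letter is applied first.  [Iso s]
   is the seed isomorphism with underlying bijection [s]; its target is
   determined by its source (see [relabel]). *)
Inductive letter (I : Type) := Mut of I | Iso of relabeling I.
Arguments Mut {I} k.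
Arguments Iso {I} s.

HB.instance Definition _ (I : Type) := gen_eqMixin (letter I).
HB.instance Definition _ (I : Type) := gen_choiceMixin (letter I).

Notation word I := (seq (letter I)).

Section Seeds.
Variable I : choiceType.
Implicit Types (s : seed I) (w u v : word I) (k i j : I).

Lemma seed_ext s s' : (forall i j, s i j = s' i j) -> s = s'.
Proof.
case: s s' => [e p] [e' p'] /= H.
have E : e = e' by apply/funext => i; apply/funext => j.
by case: _ / E p' => p'; congr Seed; apply: Prop_irrelevance.
Qed.

Definition mutate_exch s k i j : int :=
  if (i == k) || (j == k) then - s i j
  else if s i k * s k j <= 0 then s i j
  else s i j + `|s i k| * s k j.

Lemma mutate_skew s k i j : mutate_exch s k i j = - mutate_exch s k j i.
Proof.
rewrite /mutate_exch orbC (exch_skew s i j).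
case: ifP => // _.
rewrite (exch_skew s i k) (exch_skew s k j) mulrNN (mulrC (s k i)).
case: ifP => //; rewrite opprD => /negbT; rewrite -ltNge => H.
congr (_ + _); rewrite normrN mulrN; congr (- _).
have [k0|k0|k0] := ltrgt0P (s k i).
- have j0 : 0 < s j k by rewrite pmulr_lgt0 in H.
  by rewrite gtr0_norm // mulrC.
- have j0 : s j k < 0 by rewrite nmulr_lgt0 in H.
  by rewrite !ltr0_norm // !mulNr mulrC.
- by rewrite k0 mulr0 ltxx in H.
Qed.

Definition mutate s k : seed I := Seed (mutate_skew s k).

Lemma mutate_exchl s k j : mutate_exch s k k j = - s k j.
Proof. by rewrite /mutate_exch eqxx. Qed.

Lemma mutate_exchr s k i : mutate_exch s k i k = - s i k.
Proof. by rewrite /mutate_exch eqxx orbT. Qed.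

Lemma mutateK s k : mutate (mutate s k) k = s.
Proof.
apply: seed_ext => i j; rewrite /= {1}/mutate_exch /=.
rewrite mutate_exchl mutate_exchr (mulrNN (s i k)) normrN mulrN.
rewrite /mutate_exch; case: ifP => [->|->]; first exact: opprK.
by case: ifP => [->|->] //; rewrite addrK.
Qed.

Lemma relabel_skew s (f : relabeling I) i j :
  s (unrelab f i) (unrelab f j) = - s (unrelab f j) (unrelab f i).
Proof. exact: exch_skew. Qed.

Definition relabel s f : seed I := Seed (relabel_skew s f).

Definition step s (l : letter I) : seed I :=
  match l with Mut k => mutate s k | Iso f => relabel s f end.

Definition run s w : seed I := foldr (fun l s' => step s' l) s w.

Definition linv (l : letter I) : letter I :=
  match l with Mut k => Mut k | Iso f => Iso (relab_inv f) end.

Definition winv w : word I := rev (map linv w).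

Lemma linvK : involutive linv.
Proof. by case=> // -[]. Qed.

Lemma winvK : involutive winv.
Proof.
by move=> w; rewrite /winv map_rev revK mapK //; exact: linvK.
Qed.

Lemma run_cat s u v : run s (u ++ v) = run (run s v) u.
Proof. by rewrite /run foldr_cat. Qed.

Lemma step_linv s l : step (step s l) (linv l) = s.
Proof.
case: l => [k|f] /=; first exact: mutateK.
by apply: seed_ext => i j /=; rewrite !relabK.
Qed.

Lemma run_winv s w : run (run s w) (winv w) = s.
Proof.
elim: w s => //= l w IH s.
by rewrite /winv /= rev_cons -cats1 run_cat /= step_linv IH.
Qed.

Section Action.
Variable R : realFieldType.
Implicit Types x : I -> R.

Definition stepX s (l : letter I) x : I -> R :=
  match l with
  | Mut k => fun i =>
      if i == k then (x k)^-1
      else x i * (1 + x k ^ (- sgz (s i k))) ^ (- s i k)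
  | Iso f => fun i => x (unrelab f i)
  end.

Definition stepA s (l : letter I) x : I -> R :=
  match l with
  | Mut k => fun i =>
      if i == k then
        (\big[*%R/1]_(j \in [set j | 0 < s k j]) x j ^ s k j +
         \big[*%R/1]_(j \in [set j | s k j < 0]) x j ^ (- s k j)) / x k
      else x i
  | Iso f => fun i => x (unrelab f i)
  end.

Fixpoint act (st : seed I -> letter I -> (I -> R) -> I -> R) s w x : I -> R :=
  if w is l :: w' then st (run s w') l (act st s w' x) else x.

Definition actX := act stepX.
Definition actA := act stepA.

Lemma act_cat st s u v x : act st s (u ++ v) x = act st (run s v) u (act st s v x).
Proof. by elim: u => //= l u ->; rewrite run_cat. Qed.

Lemma fsprod_gt0 (A : set I) (F : I -> R) :
  (forall i, 0 < F i) -> 0 < \big[*%R/1]_(i \in A) F i.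
Proof. by move=> F0; apply: (big_ind (fun y : R => 0 < y)) => // *; exact: mulr_gt0. Qed.

Definition pos_step (st : seed I -> letter I -> (I -> R) -> I -> R) :=
  forall s l x, (forall i, 0 < x i) -> forall i, 0 < st s l x i.

Definition inv_step (st : seed I -> letter I -> (I -> R) -> I -> R) :=
  forall s l x, (forall i, 0 < x i) -> st (step s l) (linv l) (st s l x) = x.

Lemma pos_stepX : pos_step stepX.
Proof.
move=> s [k|f] x x0 i //=; case: ifP => _; first by rewrite invr_gt0.
by rewrite mulr_gt0 // exprz_gt0 // addr_gt0 // exprz_gt0.
Qed.

Lemma pos_stepA : pos_step stepA.
Proof.
move=> s [k|f] x x0 i //=; case: ifP => _ //.
by rewrite divr_gt0 // addr_gt0 // fsprod_gt0 // => j; rewrite exprz_gt0.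
Qed.

Lemma exch_diag s i : s i i = 0.
Proof.
have /eqP := exch_skew s i i.
by rewrite -addr_eq0 -mulr2n mulrn_eq0 /= => /eqP.
Qed.

Lemma inv_stepX : inv_step stepX.
Proof.
move=> s [k|f] x x0; apply/funext => i /=; last by rewrite relabK.
rewrite !eqxx; case: eqP => [->|/eqP ik]; first by rewrite invrK.
rewrite /mutate_exch eqxx orbT sgzN !opprK -mulrA.
rewrite exprz_inv -expfzDr ?addNr ?mulr1 //.
by rewrite gt_eqF // addr_gt0 // exprz_gt0.
Qed.

Lemma inv_stepA : inv_step stepA.
Proof.
move=> s [k|f] x x0; apply/funext => i /=; last by rewrite relabK.
rewrite !eqxx; case: eqP => [->|//].
rewrite /mutate_exch eqxx /=.
set P := (X in (X + _) / x k); set N := (X in (_ + X) / x k).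
have E : forall (B : set I) (G G' : I -> R), (forall j, B j -> G j = G' j) ->
  \big[*%R/1]_(j \in B) G j = \big[*%R/1]_(j \in B) G' j.
  by move=> B G G' H; apply: eq_fsbigr => j; rewrite inE; exact: H.
have -> : [set j | 0 < - s k j] = [set j | s k j < 0].
  by apply/seteqP; split => j /=; rewrite oppr_gt0.
have -> : [set j | - s k j < 0] = [set j | 0 < s k j].
  by apply/seteqP; split => j /=; rewrite oppr_lt0.
rewrite (E _ _ (fun j => x j ^ (- s k j))); last first.
  by move=> j /=; case: eqP => // ->; rewrite exch_diag ltxx.
rewrite -/N (E _ _ (fun j => x j ^ s k j)); last first.
  by move=> j /=; rewrite opprK; case: eqP => // ->; rewrite exch_diag ltxx.
rewrite -/P addrC invf_div mulrC -mulrA mulVf ?mulr1 //.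
by rewrite gt_eqF // addr_gt0 // fsprod_gt0 // => j; rewrite exprz_gt0.
Qed.

Lemma act_gt0 st s w x : pos_step st ->
  (forall i, 0 < x i) -> forall i, 0 < act st s w x i.
Proof. by move=> H x0; elim: w => //= l w IH i; exact: H. Qed.

Lemma act_winv st s w x : pos_step st -> inv_step st -> (forall i, 0 < x i) ->
  act st (run s w) (winv w) (act st s w x) = x.
Proof.
move=> P N x0; elim: w => //= l w IH.
rewrite /winv /= rev_cons -cats1 act_cat /= step_linv N ?IH //.
exact: act_gt0.
Qed.

Lemma act_loopK st s w x : pos_step st -> inv_step st -> run s w = s ->
  (forall i, 0 < x i) -> act st s (winv w) (act st s w x) = x.
Proof.
by move=> P N E x0; have := act_winv s w P N x0; rewrite E.
Qed.

Lemma act_loopVK st s w x : pos_step st -> inv_step st -> run s w = s ->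
  (forall i, 0 < x i) -> act st s w (act st s (winv w) x) = x.
Proof.
move=> P N E x0; have E' : run s (winv w) = s by rewrite -{1}E run_winv.
by have := act_loopK P N E' x0; rewrite winvK.
Qed.

Definition posval (x : I -> {posnum R}) : I -> R := fun i => (x i)%:num.

Lemma posval_gt0 (y : I -> {posnum R}) i : 0 < posval y i.
Proof. by rewrite /posval. Qed.

Lemma posvalE x : (forall i, 0 < x i) -> exists y, x = posval y.
Proof.
by move=> x0; exists (fun i => PosNum (x0 i)); apply/funext.
Qed.

End Action.
End Seeds.

(* The seeds to be glued are indexed by the words [w], that is, by the seed
   [run s0 w] together with the cluster transformation from [s0] to it: two
   cluster transformations with isomorphic targets give two copies of
   R_{>0}^I, so that an automorphism of a seed acts on the space instead of
   being divided out. *)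
Section PositivePoints.
Variables (I : choiceType) (R : realFieldType).
Variable st : seed I -> letter I -> (I -> R) -> I -> R.
Variable s0 : seed I.

Definition chart_point := (word I * (I -> {posnum R}))%type.

Inductive glue_step : chart_point -> chart_point -> Prop :=
  GlueStep w l x y : posval y = st (run s0 w) l (posval x) ->
    glue_step (w, x) (l :: w, y).

Definition glue (p q : chart_point) : bool :=
  `[< clos_refl_sym_trans _ glue_step p q >].

Lemma glue_equiv : equiv_class_of glue.
Proof.
split.
- by move=> p; apply/asboolP; exact: rst_refl.
- by move=> p q; apply/asboolP/asboolP; exact: rst_sym.
- by move=> q p r /asboolP pq /asboolP qr; apply/asboolP; exact: rst_trans pq qr.
Qed.
Canonical glue_equiv_rel := EquivRelPack glue_equiv.

Definition positive_points := {eq_quot glue_equiv_rel}.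
End PositivePoints.

Definition Xspace (I : choiceType) (R : realFieldType) (s0 : seed I) :=
  positive_points (@stepX I R) s0.
Definition Aspace (I : choiceType) (R : realFieldType) (s0 : seed I) :=
  positive_points (@stepA I R) s0.

Section Loops.
Variables (I : choiceType) (s0 : seed I).

Definition loop := {w : word I | `[< run s0 w = s0 >]}.
Implicit Types u v w : loop.

Lemma loopP w : run s0 (val w) = s0.
Proof. exact/asboolP/(valP w). Qed.

Lemma loop_mul_subproof u v : `[< run s0 (val u ++ val v) = s0 >].
Proof. by apply/asboolP; rewrite run_cat !loopP. Qed.
Definition loop_mul u v : loop := Sub (val u ++ val v) (loop_mul_subproof u v).

Lemma loop_one_subproof : `[< run s0 [::] = s0 >].
Proof. exact/asboolP. Qed.
Definition loop_one : loop := Sub [::] loop_one_subproof.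

Lemma loop_inv_subproof u : `[< run s0 (winv (val u)) = s0 >].
Proof. by apply/asboolP; rewrite -{1}(loopP u) run_winv. Qed.
Definition loop_inv u : loop := Sub (winv (val u)) (loop_inv_subproof u).

Lemma loop_mulA : associative loop_mul.
Proof. by move=> u v w; apply: val_inj; rewrite /= catA. Qed.
Lemma loop_mul1 : left_id loop_one loop_mul.
Proof. by move=> u; exact: val_inj. Qed.
Lemma loop_1mul : right_id loop_one loop_mul.
Proof. by move=> u; apply: val_inj; rewrite /= cats0. Qed.
Lemma loop_invK : involutive loop_inv.
Proof. by move=> u; apply: val_inj; rewrite /= winvK. Qed.

Section Quotient.
Variable e : equiv_rel loop.
Hypothesis e_mul : forall u u' v v',
  e u u' -> e v v' -> e (loop_mul u v) (loop_mul u' v').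
Hypothesis e_inv : forall u, e (loop_mul (loop_inv u) u) loop_one.

Local Notation Q := {eq_quot e}.

Definition qmul (a b : Q) : Q := \pi_Q (loop_mul (repr a) (repr b)).
Definition qone : Q := \pi_Q loop_one.
Definition qinv (a : Q) : Q := \pi_Q (loop_inv (repr a)).

Lemma qmul_pi u v : qmul (\pi_Q u) (\pi_Q v) = \pi_Q (loop_mul u v).
Proof.
by apply/eqmodP; apply: e_mul; apply/eqmodP; rewrite reprK.
Qed.

Lemma qmulA : associative qmul.
Proof.
move=> a b c; rewrite -[a]reprK -[b]reprK -[c]reprK.
by rewrite (qmul_pi (repr b) (repr c)) (qmul_pi (repr a) (repr b)) !qmul_pi loop_mulA.
Qed.

Lemma qmul1 : left_id qone qmul.
Proof. by move=> a; rewrite -[a]reprK qmul_pi loop_mul1. Qed.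

Lemma q1mul : right_id qone qmul.
Proof. by move=> a; rewrite -[a]reprK qmul_pi loop_1mul. Qed.

Lemma qmulV : left_inverse qone qinv qmul.
Proof.
move=> a; rewrite -{2}[a]reprK qmul_pi; apply/eqmodP; exact: e_inv.
Qed.

Lemma qVmul : right_inverse qone qinv qmul.
Proof.
move=> a; rewrite -{1}[a]reprK qmul_pi; apply/eqmodP.
by rewrite -{1}[repr a]loop_invK; exact: e_inv.
Qed.
End Quotient.
End Loops.

Section Gamma.
Variables (I : choiceType) (R : realFieldType) (s0 : seed I).
Implicit Types u v w : loop s0.

Definition trivial w : Prop := forall x : I -> {posnum R},
  actX s0 (val w) (posval x) = posval x /\
  actA s0 (val w) (posval x) = posval x.

Definition gamma_rel u v : bool := `[< trivial (loop_mul u (loop_inv v)) >].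

Lemma gamma_relP u v : reflect (forall x : I -> {posnum R},
  actX s0 (val u) (posval x) = actX s0 (val v) (posval x) /\
  actA s0 (val u) (posval x) = actA s0 (val v) (posval x)) (gamma_rel u v).
Proof.
have K st (x : I -> R) : pos_step st -> inv_step st -> (forall i, 0 < x i) ->
    act st s0 (val (loop_mul u (loop_inv v))) (act st s0 (val v) x) =
    act st s0 (val u) x.
  move=> P N x0; rewrite act_cat (loopP (loop_inv v)).
  by rewrite act_loopK // loopP.
have K' st (x : I -> R) : pos_step st -> inv_step st -> (forall i, 0 < x i) ->
    act st s0 (val v) (act st s0 (val (loop_inv v)) x) = x.
  by move=> P N x0; rewrite act_loopVK // loopP.
have PX := @pos_stepX I R; have PA := @pos_stepA I R.
have NX := @inv_stepX I R; have NA := @inv_stepA I R.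
apply: (iffP (asboolP _)) => H x; have x0 := @posval_gt0 _ _ x.
  split.
    have [y Ey] := posvalE (@act_gt0 I R _ s0 (val v) _ PX x0).
    rewrite -[LHS](K _ _ PX NX x0) /actX Ey; exact: (H y).1.
  have [y Ey] := posvalE (@act_gt0 I R _ s0 (val v) _ PA x0).
  rewrite -[LHS](K _ _ PA NA x0) /actA Ey; exact: (H y).2.
split.
  have [y Ey] := posvalE (@act_gt0 I R _ s0 (val (loop_inv v)) _ PX x0).
  rewrite /actX act_cat (loopP (loop_inv v)) Ey.
  by rewrite -/(actX _ _ _) (H y).1 -Ey; exact: K'.
have [y Ey] := posvalE (@act_gt0 I R _ s0 (val (loop_inv v)) _ PA x0).
rewrite /actA act_cat (loopP (loop_inv v)) Ey.
by rewrite -/(actA _ _ _) (H y).2 -Ey; exact: K'.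
Qed.

Lemma gamma_equiv : equiv_class_of gamma_rel.
Proof.
split.
- by move=> u; apply/gamma_relP.
- move=> u v; apply/gamma_relP/gamma_relP => H x; have [a b] := H x; split=> //.
- move=> v u w /gamma_relP H1 /gamma_relP H2; apply/gamma_relP => x.
  by rewrite (H1 x).1 (H1 x).2 (H2 x).1 (H2 x).2.
Qed.
Canonical gamma_equiv_rel := EquivRelPack gamma_equiv.

Lemma gamma_mul u u' v v' : gamma_rel u u' -> gamma_rel v v' ->
  gamma_rel (loop_mul u v) (loop_mul u' v').
Proof.
move=> /gamma_relP Hu /gamma_relP Hv; apply/gamma_relP => x.
have x0 := @posval_gt0 _ _ x.
have [y Ey] := posvalE (@act_gt0 I R _ s0 (val v') _ (@pos_stepX I R) x0).
have [z Ez] := posvalE (@act_gt0 I R _ s0 (val v') _ (@pos_stepA I R) x0).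
rewrite /actX /actA !act_cat !loopP.
rewrite -!/(actX _ _ _) -!/(actA _ _ _) (Hv x).1 (Hv x).2.
rewrite /actX /actA Ey Ez; split; [exact: (Hu y).1 | exact: (Hu z).2].
Qed.

Lemma gamma_inv u : gamma_rel (loop_mul (loop_inv u) u) (loop_one s0).
Proof.
apply/gamma_relP => x; have x0 := @posval_gt0 _ _ x.
rewrite /actX /actA /= !act_cat loopP; split; apply: act_loopK;
  by [exact: pos_stepX | exact: inv_stepX | exact: pos_stepA |
      exact: inv_stepA | exact: loopP |].
Qed.

Definition modular_group := {eq_quot gamma_equiv_rel}.
HB.instance Definition _ := Choice.on modular_group.
HB.instance Definition _ := isGroup.Build modular_group
  (qmulA gamma_mul) (qmul1 gamma_mul) (q1mul gamma_mul)
  (qmulV gamma_mul gamma_inv) (qVmul gamma_mul gamma_inv).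
End Gamma.

Definition coxeter (p : nat) : nat := nth 0%N [:: 2; 3; 4; 6]%N p.

Section SpecialGamma.
Variable I : choiceType.

(* [special_eq s u v]: the cluster transformations [u] and [v] with source
   [s] agree modulo the special trivial ones. *)
Inductive special_eq : seed I -> word I -> word I -> Prop :=
| special_refl s u : special_eq s u u
| special_sym s u v : special_eq s u v -> special_eq s v u
| special_trans s u v w : special_eq s u v -> special_eq s v w ->
    special_eq s u w
| special_cat s u u' v v' : special_eq (run s v) u u' -> special_eq s v v' ->
    special_eq s (u ++ v) (u' ++ v')
| special_iso_id s : special_eq s [:: Iso (relab_id I)] [::]
| special_iso_comp s (f g : relabeling I) :
    special_eq s [:: Iso f; Iso g] [:: Iso (relab_comp f g)]
| special_iso_mut s (f : relabeling I) k :
    special_eq s [:: Iso f; Mut k] [:: Mut (f k); Iso f]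
| special_mut s k : special_eq s [:: Mut k; Mut k] [::]
| special_rank2 (s : seed I) (i j : I) (p : nat) : i != j -> (p <= 3)%N ->
    s i j = - p%:Z * s j i -> s i j = - p%:Z ->
    special_eq s
      (flatten (nseq (coxeter p + 2) [:: Iso (relab_swap i j); Mut i])) [::].

Variable s0 : seed I.
Implicit Types u v w : loop s0.

Definition special_rel u v : bool := `[< special_eq s0 (val u) (val v) >].

Lemma special_equiv : equiv_class_of special_rel.
Proof.
split.
- by move=> u; apply/asboolP; exact: special_refl.
- by move=> u v; apply/asboolP/asboolP; exact: special_sym.
- move=> v u w /asboolP uv /asboolP vw; apply/asboolP; exact: special_trans uv vw.
Qed.
Canonical special_equiv_rel := EquivRelPack special_equiv.

Lemma special_mul u u' v v' : special_rel u u' -> special_rel v v' ->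
  special_rel (loop_mul u v) (loop_mul u' v').
Proof.
move=> /asboolP Hu /asboolP Hv; apply/asboolP; apply: special_cat => //.
by rewrite loopP.
Qed.

Lemma special_winv s (w : word I) : special_eq s (winv w ++ w) [::].
Proof.
elim: w s => [|l w IH] s; first exact: special_refl.
have -> : winv (l :: w) ++ l :: w = winv w ++ ([:: linv l; l] ++ w).
  by rewrite /winv /= rev_cons -cats1 -catA.
apply: special_trans (IH s); apply: special_cat; first exact: special_refl.
rewrite -{2}[w]cat0s; apply: special_cat; last exact: special_refl.
case: l => [k|f] /=; first exact: special_mut.
apply: special_trans (special_iso_comp _ _ _) _.
by rewrite relab_compV; exact: special_iso_id.
Qed.

Lemma special_inv u : special_rel (loop_mul (loop_inv u) u) (loop_one s0).
Proof. by apply/asboolP; exact: special_winv. Qed.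

Definition special_modular_group := {eq_quot special_equiv_rel}.
HB.instance Definition _ := Choice.on special_modular_group.
HB.instance Definition _ := isGroup.Build special_modular_group
  (qmulA special_mul) (qmul1 special_mul) (q1mul special_mul)
  (qmulV special_mul special_inv) (qVmul special_mul special_inv).
End SpecialGamma.

(* [None] is the point at infinity, [Some x] the point [x : 1]. *)
Definition P1 (F : Type) := option F.

Section ProjectiveLine.
Variable F : realFieldType.
Implicit Types (x y z : P1 F) (u v w : 'cV[F]_2).

Definition hvec x : 'cV[F]_2 :=
  \col_i (if i == 0 then (if x is Some a then a else 1)
          else (if x is Some _ then 1 else 0)).

Definition proj v : P1 F := if v 1 0 == 0 then None else Some (v 0 0 / v 1 0).

Definition mobius (M : 'M[F]_2) x : P1 F := proj (M *m hvec x).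

Definition wedge u v : F := u 0 0 * v 1 0 - u 1 0 * v 0 0.

Definition P1_lt x y : bool :=
  match x, y with
  | Some a, Some b => a < b
  | Some _, None => true
  | None, _ => false
  end.

(* Counterclockwise order of the boundary of the upper half-plane: the
   increasing order on F, closed up by infinity. *)
Definition ccw x y z : bool :=
  [|| P1_lt x y && P1_lt y z, P1_lt y z && P1_lt z x | P1_lt z x && P1_lt x y].

Definition cross_ratio x1 x2 x3 x4 : F :=
  (wedge (hvec x1) (hvec x2) * wedge (hvec x3) (hvec x4)) /
  (wedge (hvec x2) (hvec x3) * wedge (hvec x1) (hvec x4)).

Definition nzvec := {v : 'cV[F]_2 | v != 0}.

Definition ray v : set 'cV[F]_2 := [set t *: v | t in [set t | 0 < t]].

Definition S1 := {A : set 'cV[F]_2 | exists2 v, v != 0 & A = ray v}.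

Definition ray_of (v : nzvec) : S1 :=
  exist _ (ray (val v)) (ex_intro2 _ _ (val v) (valP v) erefl).

Lemma antipode_subproof (A : S1) :
  exists2 v, v != 0 & [set - u | u in sval A] = ray v.
Proof.
case: A => A /= [v v0 ->]; exists (- v); first by rewrite oppr_eq0.
apply/seteqP; split=> w /=.
  by move=> [_ [t t0 <-] <-]; exists t => //; rewrite scalerN.
by move=> [t t0 <-]; exists (t *: v); [exists t | rewrite scalerN].
Qed.

Definition antipode (A : S1) : S1 := exist _ _ (antipode_subproof A).

(* The angles in ]0, 2 pi[ swept counterclockwise from each of three distinct
   rays to the next one add up to 2 pi if the rays are in counterclockwise
   order, and to 4 pi otherwise; the first case occurs exactly when at least
   two of these angles are in ]0, pi[. *)
Definition ccw_vec u v w : bool :=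
  [|| (0 < wedge u v) && (0 < wedge v w), (0 < wedge v w) && (0 < wedge w u)
    | (0 < wedge w u) && (0 < wedge u v)].

Definition ccw_ray (A B C : S1) : Prop :=
  exists u v w, [/\ sval A u, sval B v, sval C w & ccw_vec u v w].

Lemma hvec_neq0 x : hvec x != 0.
Proof.
apply/eqP => /matrixP H; case: x H => [a|] H.
  by have /eqP := H 1 0; rewrite !mxE /= oner_eq0.
by have /eqP := H 0 0; rewrite !mxE /= oner_eq0.
Qed.

Definition hray x : S1 := ray_of (Sub (hvec x) (hvec_neq0 x)).

Lemma hvec_proj v : v != 0 -> exists2 c, c != 0 & v = c *: hvec (proj v).
Proof.
move=> v0; rewrite /proj; case: (eqVneq (v 1 0) 0) => [E|N].
  exists (v 0 0).
    apply: contraNneq v0 => E0; apply/eqP/matrixP => i j.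
    rewrite !mxE (ord1 j); case: (unliftP 0 i) => [k ->|-> //].
    by rewrite (ord1 k) -E; congr (v _ _); apply: val_inj.
  apply/matrixP => i j; rewrite !mxE (ord1 j) mulrC.
  case: (unliftP 0 i) => [k ->|->]; last by rewrite mul1r.
  by rewrite (ord1 k) mul0r -E; congr (v _ _); apply: val_inj.
exists (v 1 0) => //; apply/matrixP => i j; rewrite !mxE (ord1 j).
case: (unliftP 0 i) => [k ->|->]; last by rewrite mulrC divfK.
by rewrite (ord1 k) mulr1; congr (v _ _); apply: val_inj.
Qed.

Lemma projZ c v : c != 0 -> proj (c *: v) = proj v.
Proof.
move=> c0; rewrite /proj !mxE mulf_eq0 (negPf c0) /=.
by case: eqP => // _; rewrite -mulf_div divff // mul1r.
Qed.

Lemma proj_hvec x : proj (hvec x) = x.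
Proof. by case: x => [a|]; rewrite /proj !mxE /= ?oner_eq0 ?eqxx ?divr1. Qed.

Lemma mobius1 x : mobius 1%:M x = x.
Proof. by rewrite /mobius mul1mx proj_hvec. Qed.

Lemma mobiusM (M N : 'M[F]_2) x : N \in unitmx ->
  mobius (M *m N) x = mobius M (mobius N x).
Proof.
move=> Nu; rewrite /mobius.
have /hvec_proj[c c0 E] : N *m hvec x != 0.
  apply: contraNneq (hvec_neq0 x) => E.
  by rewrite -(mulKmx Nu (hvec x)) E mulmx0.
by rewrite -mulmxA {1}E -scalemxAr projZ.
Qed.

End ProjectiveLine.

Notation P1Q := (P1 rat).

(* The reflection of the hyperbolic plane in the geodesic with ideal endpoints
   [a] and [b], acting on the ideal boundary: the inversion in the circle with
   diameter [a, b], or a Euclidean reflection if one endpoint is infinite. *)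
Definition inversion (m r2 : rat) (x : P1Q) : P1Q :=
  match x with
  | None => Some m
  | Some x => if x == m then None else Some (m + r2 / (x - m))
  end.

Definition reflection (a b : P1Q) : P1Q -> P1Q :=
  match a, b with
  | Some a, Some b => inversion ((a + b) / 2) (((b - a) / 2) ^+ 2)
  | Some a, None | None, Some a => omap (fun x => 2 * a - x)
  | None, None => id
  end.

Section Farey.
Local Open Scope fset_scope.

Inductive farey_triangle : {fset P1Q} -> Prop :=
| farey_base : farey_triangle [fset Some 0; Some 1; None]
| farey_reflect a b c : farey_triangle [fset a; b; c] ->
    farey_triangle [fset a; b; reflection a b c].

Definition side (t e : {fset P1Q}) : bool := (e `<=` t) && (#|` e| == 2).

Definition edge := {e : {fset P1Q} |
  `[< exists2 t, farey_triangle t & side t e >]}.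
HB.instance Definition _ := Choice.on edge.

Definition next_side (t : {fset P1Q}) (E F : edge) : Prop :=
  exists a b c, [/\ ccw a b c, t = [fset a; b; c],
    val E = [fset a; b] & val F = [fset b; c]].

Definition delta (t : {fset P1Q}) (E F : edge) : int :=
  if `[< next_side t E F >] then 1
  else if `[< next_side t F E >] then -1 else 0.

Definition common_triangles (E F : edge) : set {fset P1Q} :=
  [set t | [/\ farey_triangle t, E != F, side t (val E) & side t (val F)]]%classic.

Definition farey_exch (E F : edge) : int :=
  (\sum_(t \in common_triangles E F) delta t E F)%R.

Lemma ccw_distinct (a b c : P1Q) : ccw a b c -> [/\ a != b, b != c & c != a].
Proof.
have lt_neq (x y : P1Q) : P1_lt x y -> x != y.
  case: x y => [x|] [y|] //= xy; apply/eqP => -[E].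
  by rewrite E ltxx in xy.
have tr (x y z : P1Q) : P1_lt x y -> P1_lt y z -> P1_lt x z.
  by case: x y z => [x|] [y|] [z|] //=; exact: lt_trans.
case/or3P => /andP[h1 h2]; have h3 := tr _ _ _ h1 h2;
  have := (lt_neq _ _ h1, lt_neq _ _ h2, lt_neq _ _ h3) => -[[n1 n2] n3];
  split=> //; by rewrite eq_sym.
Qed.

Lemma ccw_asym (a b c : P1Q) : ccw a b c -> ccw c b a -> False.
Proof.
have as_ (x y : P1Q) : P1_lt x y -> P1_lt y x -> False.
  case: x y => [x|] [y|] //= xy yx.
  by have := lt_trans xy yx; rewrite ltxx.
by case/or3P => /andP[h1 h2] /or3P[] /andP[h3 h4];
  (exact: as_ h1 h3 || exact: as_ h1 h4 || exact: as_ h2 h3 || exact: as_ h2 h4).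
Qed.

Lemma next_side_asym t (E F : edge) : next_side t E F -> next_side t F E -> False.
Proof.
move=> [a [b [c [abc _ eE eF]]]] [a' [b' [c' [abc' _ Ha Hc]]]].
move: Ha Hc; rewrite eE eF => Ha Hc.
have [nab nbc nca] := ccw_distinct abc.
have [nab' nbc' nca'] := ccw_distinct abc'.
have b'F : b' \in [fset b; c] by rewrite Ha !inE eqxx orbT.
have b'E : b' \in [fset a; b] by rewrite Hc !inE eqxx.
have Eb : b' = b.
  move: b'F b'E; rewrite !inE => /orP[/eqP//|/eqP->].
  by rewrite (negPf nca) eq_sym (negPf nbc).
have a'F : a' \in [fset b; c] by rewrite Ha !inE eqxx.
have c'E : c' \in [fset a; b] by rewrite Hc !inE eqxx orbT.
have Ea : a' = c.
  by move: a'F; rewrite !inE -Eb (negPf nab') => /eqP.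
have Ec : c' = a.
  by move: c'E; rewrite !inE -Eb [c' == b']eq_sym (negPf nbc') orbF => /eqP.
by move: abc'; rewrite Ea Eb Ec => /(ccw_asym abc).
Qed.

Lemma farey_skew E F : farey_exch E F = (- farey_exch F E)%R.
Proof.
rewrite /farey_exch.
have -> : common_triangles F E = common_triangles E F.
  by apply/seteqP; split=> t [? ? ? ?]; split=> //; rewrite eq_sym.
rewrite -mulN1r mulr_fsumr; apply: eq_fsbigr => t _; rewrite /delta mulN1r.
case: asboolP => EF; case: asboolP => FE //.
by case: (next_side_asym EF FE).
Qed.

Definition farey_seed : seed edge := Seed farey_skew.

(* [v1, v2, v3, v4] are, in clockwise order and with [v1] not in [E], the
   vertices of the union of the two triangles that share the edge [E]. *)
Definition quadrilateral (E : edge) (v1 v2 v3 v4 : P1Q) : Prop :=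
  [/\ val E = [fset v2; v4],
      farey_triangle [fset v1; v2; v4], farey_triangle [fset v3; v2; v4],
      ccw v3 v2 v1 & ccw v4 v3 v1].

End Farey.

Section Teichmueller.
Variable R : realFieldType.

Definition Xplus_map :=
  {b : P1Q -> P1 R | forall x y z, ccw x y z -> ccw (b x) (b y) (b z)}.
HB.instance Definition _ := gen_eqMixin Xplus_map.
HB.instance Definition _ := gen_choiceMixin Xplus_map.

Definition PGL_rel (b b' : Xplus_map) : bool :=
  `[< exists2 g : 'M[R]_2, g \in unitmx & sval b' = mobius g \o sval b >].

Lemma PGL_equiv : equiv_class_of PGL_rel.
Proof.
split.
- move=> b; apply/asboolP; exists 1%:M; first exact: unitmx1.
  by apply/funext => x /=; rewrite mobius1.
- have sym b b' : PGL_rel b b' -> PGL_rel b' b.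
    move=> /asboolP[g gu E]; apply/asboolP; exists (invmx g).
      by rewrite unitmx_inv.
    apply/funext => x; rewrite E /= -mobiusM // mulVmx //.
    by rewrite mobius1.
  by move=> b b'; apply/idP/idP; exact: sym.
- move=> b' b b'' /asboolP[g gu E] /asboolP[h hu E']; apply/asboolP.
  exists (h *m g); first by rewrite unitmx_mul hu gu.
  by apply/funext => x; rewrite E' E /= mobiusM.
Qed.
Canonical PGL_equiv_rel := EquivRelPack PGL_equiv.

Definition Xplus := {eq_quot PGL_equiv_rel}.

(* S^1(Q) is taken to be the set of rays in Q^2 - {0}: a ray of rational slope
   in R^2 is determined by its rational points. *)
Definition Aplus_map :=
  {a : S1 rat -> nzvec R |
    (forall x, val (a (antipode x)) = - val (a x)) /\
    (forall x y z, ccw_ray x y z ->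
       ccw_ray (ray_of (a x)) (ray_of (a y)) (ray_of (a z)))}.
HB.instance Definition _ := gen_eqMixin Aplus_map.
HB.instance Definition _ := gen_choiceMixin Aplus_map.

Definition SL_rel (a a' : Aplus_map) : bool :=
  `[< exists2 g : 'M[R]_2, \det g = 1 &
      forall x, val (sval a' x) = g *m val (sval a x) >].

Lemma SL_equiv : equiv_class_of SL_rel.
Proof.
split.
- move=> a; apply/asboolP; exists 1%:M; first exact: det1.
  by move=> x; rewrite mul1mx.
- have sym a a' : SL_rel a a' -> SL_rel a' a.
    move=> /asboolP[g g1 E]; apply/asboolP; exists (invmx g).
      by rewrite det_inv g1 invr1.
    by move=> x; rewrite E mulKmx // unitmxE g1 unitr1.
  by move=> a a'; apply/idP/idP; exact: sym.
- move=> a' a a'' /asboolP[g g1 E] /asboolP[h h1 E']; apply/asboolP.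
  exists (h *m g); first by rewrite det_mulmx g1 h1 mulr1.
  by move=> x; rewrite E' E mulmxA.
Qed.
Canonical SL_equiv_rel := EquivRelPack SL_equiv.

Definition Aplus := {eq_quot SL_equiv_rel}.

Definition Xcoordinates (b : Xplus_map) (x : edge -> {posnum R}) : Prop :=
  forall E v1 v2 v3 v4, quadrilateral E v1 v2 v3 v4 ->
    (x E)%:num =
    cross_ratio (sval b v1) (sval b v2) (sval b v3) (sval b v4).

Definition Acoordinates (a : Aplus_map) (x : edge -> {posnum R}) : Prop :=
  forall E v w, val E = [fset v; w]%fset ->
    (x E)%:num =
    `|wedge (val (sval a (hray v))) (val (sval a (hray w)))|.

End Teichmueller.

Definition segment (a b : P1Q) : set P1Q :=
  [set x | [|| x == a, x == b | ccw a x b]].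

Definition thompson : set (P1Q -> P1Q) :=
  [set g | bijective g /\
    exists (n : nat) (a b : 'I_n -> P1Q) (M : 'I_n -> 'M[int]_2),
    [/\ forall i, a i != b i,
        \bigcup_i segment (a i) (b i) = setT,
        forall i j x, i != j ->
          segment (a i) (b i) x -> segment (a j) (b j) x ->
          (x == a i) || (x == b i),
        forall i, \det (M i) = 1 &
        forall i x, segment (a i) (b i) x ->
          g x = mobius (map_mx intr (M i)) x]].

(* Main.v *)
Require Import Defs.
From mathcomp Require Import all_boot all_order all_algebra finmap zify lra.
From mathcomp Require Import boolp classical_sets functions fsbigop cardinality.
From mathcomp Require Import reals interval_inference.
From Stdlib Require Import Relation_Operators.
Set Implicit Arguments.
Unset Strict Implicit.
Unset Printing Implicit Defensive.
Import Order.TTheory GRing.Theory Num.Theory.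
Local Open Scope ring_scope.
Local Open Scope classical_set_scope.
Local Open Scope quotient_scope.

(** The theorem rests on one dictionary: a cluster transformation of the Farey
    seed moves a labelled ideal triangulation with vertices in [P^1(Q)], and
    all its actions can be read off from what it does to the labels. The
    exchange matrix of a labelled triangulation [l] is [exch_of l]; for the
    Farey triangulation this is the Farey seed ([farey_exchE]), and matrix
    mutation at [k] is the flip of the edge [k] ([exch_flip]). Hence a word
    [w] has a final triangulation [track val w].

    Coordinates. Place a vector [V x] over each rational point [x] so that
    cyclic orders are respected. The lambda lengths [lam V a b] of the edges
    are A-coordinates, and Ptolemy's relation is the exchange relation, so a
    word carries the lengths of the edges to the lengths of the final labels
    ([coords_act]). The quotients of lengths around an edge are X-coordinates,
    which are monomials in A-coordinates ([Xmap_act]). Conversely all positive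
    lengths and all positive shears occur: the vectors are developed along the
    Stern-Brocot tree, each one being a positive combination of the vectors of
    its two parents with weights prescribed by the coordinates
    ([lengths_realized], [shears_realized]). Since every
    vertex is reached by reflecting triangles, and a coordinate determines the
    reflected vertex, the coordinates determine the vectors up to linear maps,
    and the points under them up to projective maps ([SL_coordinates],
    [PGL_coordinates]). As every chart is glued bijectively to the initial
    one ([chart_bijection]), this gives the two Teichmueller spaces.

    Modular groups. A loop acts trivially on coordinates iff it returns the
    labels to their places ([gamma_relE]): if it does, lengths are unchanged,
    and if it does not, suitable lengths detect it. The final triangulation of
    any word is the image of a relabelled Farey triangulation under a map that
    preserves the cyclic order and takes almost all edges to edges, because a
    flip of the Farey triangulation is its image under a piecewise modular
    quarter turn of a quadrilateral ([flip_farey]). Such maps are exactly the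
    elements of the Thompson group ([thompson_almost_modular],
    [almost_modular_thompson]). For a loop the relabelling is an automorphism
    of the exchange matrix, hence modular ([farey_aut]), so the loop determines
    an element of the Thompson group; every element arises because a
    triangulation can be flipped, within finitely many labels, until all these
    labels end at infinity, and likewise for its image ([word_of_map]).

    The same climb to infinity solves the word problem. Different flips towards
    infinity commute, and any other flip spans a square or a pentagon with one
    of them. So climbing is unique up to the square and pentagon relations
    ([climbs_unique], [climbs_move]), which are the rank two relations of the
    special modular group, and a loop that fixes all labels is trivial there
    ([track_special]). Thus both modular groups are the group of loops modulo
    equality of final labels. *)

(** * Orientation and the cyclic order *)

Section Wedge.
Variable F : realFieldType.
Implicit Types (u v w a b c d : 'cV[F]_2) (k : F).

Lemma wedgeC u v : wedge u v = - wedge v u.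
Proof. by rewrite /wedge; lra. Qed.

Lemma wedgevv u : wedge u u = 0.
Proof. by rewrite /wedge; lra. Qed.

Lemma wedgeDl u v w : wedge (u + v) w = wedge u w + wedge v w.
Proof. by rewrite /wedge !mxE; lra. Qed.

Lemma wedgeDr u v w : wedge u (v + w) = wedge u v + wedge u w.
Proof. by rewrite /wedge !mxE; lra. Qed.

Lemma wedgeZl k u v : wedge (k *: u) v = k * wedge u v.
Proof. by rewrite /wedge !mxE; lra. Qed.

Lemma wedgeZr k u v : wedge u (k *: v) = k * wedge u v.
Proof. by rewrite /wedge !mxE; lra. Qed.

Lemma wedgeNl u v : wedge (- u) v = - wedge u v.
Proof. by rewrite /wedge !mxE; lra. Qed.

Lemma wedgeNr u v : wedge u (- v) = - wedge u v.
Proof. by rewrite /wedge !mxE; lra. Qed.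

Lemma wedge_plucker a b c d :
  wedge a c * wedge b d = wedge a b * wedge c d + wedge a d * wedge b c.
Proof. by rewrite /wedge; lra. Qed.

Lemma det_mx2 (M : 'M[F]_2) : \det M = M 0 0 * M 1 1 - M 0 1 * M 1 0.
Proof.
rewrite (expand_det_row _ 0) !big_ord_recl big_ord0 addr0 /cofactor !det_mx11.
rewrite !mxE /= expr0 expr1 mul1r mulN1r mulrN.
have -> : lift 0 0 = 1 :> 'I_2 by apply: val_inj.
by have -> : lift 1 0 = 0 :> 'I_2 by apply: val_inj.
Qed.

Lemma wedge_mulmx (M : 'M[F]_2) u v :
  wedge (M *m u) (M *m v) = \det M * wedge u v.
Proof.
rewrite det_mx2 /wedge !mxE !big_ord_recl !big_ord0 /=.
have -> : lift 0 0 = 1 :> 'I_2 by apply: val_inj.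
by lra.
Qed.

(** Each vector occurs twice, so the sign of this product depends only on the
    three lines; it is the orientation of the triple of points of the
    projective line. *)
Definition orient u v w : F := wedge u v * wedge v w * wedge w u.

Lemma orient_rot u v w : orient u v w = orient v w u.
Proof. by rewrite /orient; lra. Qed.

Lemma orient_scale k1 k2 k3 u v w :
  orient (k1 *: u) (k2 *: v) (k3 *: w) = (k1 * k2 * k3) ^+ 2 * orient u v w.
Proof. by rewrite /orient !wedgeZl !wedgeZr; lra. Qed.

Lemma P1_ltE (x y : P1 F) : P1_lt x y = (wedge (hvec x) (hvec y) < 0).
Proof.
case: x y => [x|] [y|]; rewrite /wedge !mxE /= ?(mulr1, mulr0, mul1r, mul0r).
- by rewrite subr_lt0.
- by rewrite sub0r oppr_lt0 ltr01.
- by rewrite subr0 ltr10.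
- by rewrite subrr ltxx.
Qed.

Lemma ccw_orient (x y z : P1 F) :
  ccw x y z = (0 < orient (hvec x) (hvec y) (hvec z)).
Proof.
rewrite /ccw !P1_ltE /orient.
have tr (a b c : P1 F) : wedge (hvec a) (hvec b) < 0 ->
    wedge (hvec b) (hvec c) < 0 -> 0 < wedge (hvec c) (hvec a).
  rewrite (wedgeC (hvec c)) oppr_gt0 -!P1_ltE.
  by case: a b c => [a|] [b|] [c|] //; exact: lt_trans.
have trN : wedge (hvec x) (hvec y) > 0 -> wedge (hvec y) (hvec z) > 0 ->
    wedge (hvec z) (hvec x) < 0.
  by move: (tr z y x); rewrite !(wedgeC _ (hvec x)) !(wedgeC _ (hvec y)); lra.
move: trN (tr x y z) (tr y z x) (tr z x y) => {tr}.
set p := wedge _ _; set q := wedge _ (hvec z); set r := wedge _ (hvec x).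
move=> pqN pq qr rp; have pos3 (a b c : F) : a < 0 -> b < 0 -> 0 < c -> 0 < a * b * c.
  by move=> a0 b0 c0; rewrite pmulr_lgt0 // nmulr_lgt0.
apply/idP/idP.
  case/or3P=> /andP[h1 h2]; rewrite /orient.
  - exact: pos3 h1 h2 (pq h1 h2).
  - by have := pos3 _ _ _ h1 h2 (qr h1 h2); lra.
  - by have := pos3 _ _ _ h1 h2 (rp h1 h2); lra.
rewrite /orient; case: (ltrgt0P p) => p0; case: (ltrgt0P q) => q0;
  case: (ltrgt0P r) => r0 //=; rewrite ?(p0, q0, r0, mulr0, mul0r, ltxx) //.
- by have := pqN p0 q0; lra.
- by rewrite ltNge pmulr_rle0 ?mulr_gt0 // ltW.
- by rewrite ltNge mulrAC pmulr_rle0 ?mulr_gt0 // ltW.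
- by rewrite ltNge -mulrA mulrC pmulr_rle0 ?mulr_gt0 // ltW.
Qed.

(** The two orientations share the factor [wedge a c], which drops out as a
    square. *)
Lemma orient_ptolemy a b c d : 0 < orient a b c -> 0 < orient a c d ->
  0 < wedge a b * wedge c d * (wedge b c * wedge a d).
Proof.
move=> abc acd.
have : 0 < orient a b c * orient a c d by rewrite mulr_gt0.
rewrite /orient (wedgeC c a) (wedgeC d a).
set p := wedge a b; set q := wedge b c; set r := wedge a c.
set s := wedge c d; set t := wedge a d => H.
have r0 : 0 <= r ^+ 2 by exact: sqr_ge0.
rewrite ltNge; apply/negP => K; move: H; apply/negP; rewrite -leNgt.
have -> : p * q * - r * (r * s * - t) = r ^+ 2 * (p * s * (q * t)) by lra.
by rewrite mulr_ge0_le0.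
Qed.

(** The two products on the right of the Plucker relation have the same sign,
    so absolute values can be taken term by term. *)
Lemma ptolemy a b c d : 0 < orient a b c -> 0 < orient a c d ->
  `|wedge a c| * `|wedge b d| =
  `|wedge a b| * `|wedge c d| + `|wedge b c| * `|wedge a d|.
Proof.
move=> abc acd; have pq := orient_ptolemy abc acd.
rewrite -!normrM wedge_plucker [wedge a d * _]mulrC.
move: (wedge a b * _) (wedge b c * _) pq => p q pq.
case: (ltrgt0P p) => [p0|p0|p0]; last by rewrite p0 mul0r ltxx in pq.
- have q0 : 0 < q by rewrite pmulr_rgt0 in pq.
  by rewrite !gtr0_norm ?addr_gt0.
- have q0 : q < 0 by rewrite nmulr_rgt0 in pq.
  by rewrite !ltr0_norm ?opprD //; lra.
Qed.

Lemma wedge_eq0_proj (u v : 'cV[F]_2) : u != 0 -> v != 0 ->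
  wedge u v = 0 -> proj u = proj v.
Proof.
move=> /hvec_proj[c c0 ->] /hvec_proj[d d0 ->]; rewrite wedgeZl wedgeZr.
move/eqP; rewrite !mulf_eq0 (negPf c0) (negPf d0) /= !projZ // !proj_hvec.
move: (proj u) (proj v) => x y {u v c c0 d d0} /eqP.
case: x y => [x|] [y|] //; rewrite /wedge !mxE /= ?mulr1 ?mul1r.
- by move/eqP; rewrite subr_eq0 => /eqP->.
- by rewrite mulr0 sub0r => /eqP; rewrite oppr_eq0 oner_eq0.
- by rewrite mul0r subr0 => /eqP; rewrite oner_eq0.
Qed.

Lemma wedge_hvec_eq0 (x y : P1 F) : (wedge (hvec x) (hvec y) == 0) = (x == y).
Proof.
apply/eqP/eqP => [H|->]; last exact: wedgevv.
have := wedge_eq0_proj (hvec_neq0 x) (hvec_neq0 y) H.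
by rewrite !proj_hvec.
Qed.

End Wedge.

(** A strictly increasing map to the rationals, so that statements on the
    cyclic order become linear arithmetic. *)
Definition ordval (x : P1Q) : rat :=
  if x is Some q then (if 0 <= q then q / (1 + q) else q / (1 - q)) else 1.

Lemma ordval_lt x y : P1_lt x y = (ordval x < ordval y).
Proof.
have lt1 (q : rat) : ordval (Some q) < 1.
  by rewrite /=; case: (lerP 0 q) => q0; rewrite ltr_pdivrMr; lra.
have mono (p q : rat) : p < q -> ordval (Some p) < ordval (Some q).
  rewrite /=; case: (lerP 0 p) => p0; case: (lerP 0 q) => q0 pq; try lra.
  - have [a b] : 0 < 1 + p /\ 0 < 1 + q by lra.
    by rewrite ltr_pdivrMr // mulrAC ltr_pdivlMr //; lra.
  - have : p / (1 - p) < 0 by rewrite ltr_pdivrMr; lra.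
    have : 0 <= q / (1 + q) by rewrite divr_ge0 //; lra.
    by lra.
  - have [a b] : 0 < 1 - p /\ 0 < 1 - q by lra.
    by rewrite ltr_pdivrMr // mulrAC ltr_pdivlMr //; lra.
case: x y => [p|] [q|].
- rewrite [LHS]/=; case: (ltrgtP p q) => [pq|qp|->]; last by rewrite ltxx.
    by rewrite mono.
  by rewrite ltNge (ltW (mono _ _ qp)).
- by rewrite lt1.
- by rewrite ltNge (ltW (lt1 q)).
- by rewrite ltxx.
Qed.

Lemma ordval_eq (x y : P1Q) : (x == y) = (ordval x == ordval y).
Proof.
apply/eqP/eqP => [->//|E].
have lt_nE (u v : P1Q) : ordval u = ordval v -> P1_lt u v = false.
  by rewrite ordval_lt => ->; rewrite ltxx.
move: (lt_nE _ _ E) (lt_nE _ _ (esym E)); case: x y E => [p|] [q|] //= _.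
by case: (ltrgtP p q) => // ->.
Qed.

Lemma ccw_ordval x y z : ccw x y z =
  [|| (ordval x < ordval y) && (ordval y < ordval z),
      (ordval y < ordval z) && (ordval z < ordval x)
    | (ordval z < ordval x) && (ordval x < ordval y)].
Proof. by rewrite /ccw !ordval_lt. Qed.

(* Closes goals that follow from the axioms of a cyclic order. *)
Ltac cyc :=
  lazymatch goal with |- is_true _ => idtac | |- False => idtac end;
  repeat match goal with
  | H : is_true ?P |- _ => match P with context [ccw _ _ _] => revert H end
  | H : is_true (@eq_op _ ?x _) |- _ => let o := constr:(ordval x) in revert H
  | H : is_true (negb (@eq_op _ ?x _)) |- _ =>
      let o := constr:(ordval x) in revert H
  end; rewrite ?ccw_ordval ?ordval_eq;
  repeat match goal with |- context [ordval ?x] =>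
    let o := fresh "o" in set o := (ordval x); clearbody o end;
  clear; intros; lra.

Lemma ccw_rot (x y z : P1Q) : ccw x y z = ccw y z x.
Proof. by apply/idP/idP => H; cyc. Qed.

Lemma ccw_total (x y z : P1Q) : x != y -> y != z -> z != x ->
  ccw x y z || ccw x z y.
Proof. by move=> xy yz zx; cyc. Qed.

(** * Arithmetic of the Farey triangulation *)

Definition num (x : P1Q) : int := if x is Some q then numq q else 1.
Definition den (x : P1Q) : int := if x is Some q then denq q else 0.
Definition dt (x y : P1Q) : int := num x * den y - num y * den x.
(** Adjacency in the Farey graph; the adjacent pairs turn out to be the ends
    of the edges. *)
Definition adj (x y : P1Q) : bool := `|dt x y| == 1.
Definition ptz (p q : int) : P1Q :=
  if q == 0 then None else Some (p%:~R / q%:~R).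

Lemma dtC x y : dt x y = - dt y x.
Proof. by rewrite /dt; lia. Qed.

Lemma adjC x y : adj x y = adj y x.
Proof. by rewrite /adj dtC normrN. Qed.

Lemma den_ge0 x : 0 <= den x.
Proof. by case: x => [q|] //=; exact: ltW (denq_gt0 q). Qed.

Lemma num_den_neq0 x : (num x != 0) || (den x != 0).
Proof. by case: x => [q|] //=; rewrite denq_neq0 orbT. Qed.

Lemma coprime_nd x : coprimez (num x) (den x).
Proof.
case: x => [q|] /=; last by rewrite /coprimez gcdz0.
by rewrite coprimezE coprime_num_den.
Qed.

Lemma ptz_nd x : ptz (num x) (den x) = x.
Proof. by case: x => [q|] //=; rewrite /ptz (negPf (denq_neq0 q)) divq_num_den. Qed.

Lemma dt_eq0 x y : (dt x y == 0) = (x == y).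
Proof.
apply/eqP/eqP => [|->]; last by rewrite /dt subrr.
rewrite /dt => /eqP; rewrite subr_eq0 => /eqP.
case: x y => [p|] [q|] //=; rewrite ?(mulr0, mul0r, mul1r).
- move=> H; congr Some; rewrite -[p]divq_num_den -[q]divq_num_den.
  apply/eqP; rewrite eqr_div ?intr_eq0 ?denq_neq0 //.
  by rewrite -!intrM H.
- by move/eqP; rewrite eq_sym (negPf (denq_neq0 p)).
- by move/eqP; rewrite (negPf (denq_neq0 q)).
Qed.

Lemma adj_neq x y : adj x y -> x != y.
Proof. by move=> H; apply: contraTneq H => ->; rewrite /adj /dt subrr normr0. Qed.

Lemma adjP x y : adj x y -> dt x y = 1 \/ dt x y = -1.
Proof. by rewrite /adj => /eqP; lia. Qed.

Lemma adjPn x y : dt x y = 1 \/ dt x y = -1 -> adj x y.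
Proof. by rewrite /adj => H; apply/eqP; lia. Qed.

Lemma ptz_den p q : q != 0 -> coprimez p q ->
  exists2 e : int, e = 1 \/ e = -1 &
    num (ptz p q) = e * p /\ den (ptz p q) = e * q.
Proof.
move=> q0 cpq; rewrite /ptz (negPf q0) /=; exists (sgz q).
  by case: (sgzP q) q0 => //; [left | right].
rewrite coprimezE in cpq.
rewrite -[_ / _]/(p%:Q / q%:Q) coprimeq_num // coprimeq_den // (negPf q0).
by split=> //; rewrite -abszE; lia.
Qed.

(** A primitive integer vector is, up to sign, the vector of reduced
    numerator and denominator of the point that it represents. *)
Lemma ptz_sign p q : coprimez p q ->
  exists2 e : int, e = 1 \/ e = -1 &
    num (ptz p q) = e * p /\ den (ptz p q) = e * q.
Proof.
move=> cpq; case: (eqVneq q 0) => [q0|q0]; last exact: ptz_den.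
move: cpq; rewrite q0 /coprimez gcdz0 /ptz eqxx /= => /eqP p1.
by exists p; [lia | split; lia].
Qed.

Lemma coprime_det p q r t : p * t - q * r = 1 \/ p * t - q * r = -1 ->
  coprimez p q.
Proof.
move=> H; apply/coprimezP.
by case: H => H; [exists (t, - r) | exists (- t, r)] => /=; lia.
Qed.

Lemma ptz_adj p q x : p * den x - num x * q = 1 \/ p * den x - num x * q = -1 ->
  exists2 e : int, e = 1 \/ e = -1 &
    num (ptz p q) = e * p /\ den (ptz p q) = e * q.
Proof.
move=> H; apply: ptz_sign; apply: (@coprime_det _ _ (num x) (den x)).
by rewrite [q * _]mulrC.
Qed.

Lemma ccw_dt x y z : ccw x y z = (0 < dt x y * dt y z * dt z x).
Proof.
pose sc (x : P1Q) : rat := if x is Some q then (denq q)%:~R else 1.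
pose zv (x : P1Q) : 'cV[rat]_2 := \col_i (if i == 0 then (num x)%:~R else (den x)%:~R).
have sc0 u : 0 < sc u by case: u => [q|] //=; rewrite ltr0z denq_gt0.
have zvE u : zv u = sc u *: hvec u.
  apply/matrixP => i j; rewrite !mxE; case: ifP => _; case: u => [q|] //=;
    by rewrite ?(mulr1, mulr0) // mulrC numqE.
have wE u v : wedge (zv u) (zv v) = (dt u v)%:~R.
  by rewrite /wedge !mxE /= -!intrM -intrB; congr (_%:~R); rewrite /dt; lia.
rewrite ccw_orient -(ltr0z rat) !intrM -!wE !zvE.
rewrite -/(orient (sc x *: hvec x) (sc y *: hvec y) (sc z *: hvec z)) orient_scale.
have k0 : 0 < sc x * sc y * sc z by rewrite !mulr_gt0.
by rewrite [in RHS]pmulr_rgt0 // exprn_gt0.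
Qed.

(** Cramer's rule, coordinate by coordinate. *)
Lemma dt_cramer_num a b c :
  dt a b * num c = dt c b * num a + dt a c * num b.
Proof. by rewrite /dt; lia. Qed.

Lemma dt_cramer_den a b c :
  dt a b * den c = dt c b * den a + dt a c * den b.
Proof. by rewrite /dt; lia. Qed.

(** The third vertex of the Farey triangle to the left of the edge from [a]
    to [b]. *)
Definition apex (a b : P1Q) : P1Q :=
  ptz (num a + dt a b * num b) (den a + dt a b * den b).

Lemma apex_sign a b : adj a b -> exists2 e : int, e = 1 \/ e = -1 &
  num (apex a b) = e * (num a + dt a b * num b) /\
  den (apex a b) = e * (den a + dt a b * den b).
Proof.
move=> /adjP ab; apply: (@ptz_adj _ _ b).
by move: ab; rewrite /dt; lia.
Qed.

Lemma apex_spec a b : adj a b ->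
  [/\ ccw a b (apex a b), adj b (apex a b) & adj (apex a b) a].
Proof.
move=> ab; have [e e1 [En Ed]] := apex_sign ab; have D := adjP ab.
have E1 : dt b (apex a b) = e * dt b a.
  by rewrite {1}/dt En Ed /dt; lia.
have E2 : dt (apex a b) a = - e * (dt a b * dt a b).
  by rewrite {1}/dt En Ed /dt; lia.
rewrite ccw_dt; rewrite (dtC b a) in E1.
by split; [rewrite E1 E2 | apply: adjPn; rewrite ?E1 | apply: adjPn; rewrite ?E2];
  case: D => ->; case: e1 => ->; lia.
Qed.

(** In the basis [a, b] a common neighbour of [a] and [b] has coordinates
    [1] or [-1], and its side fixes their relative sign. *)
Lemma apex_uniq a b c : adj a b -> ccw a b c -> adj b c -> adj c a ->
  c = apex a b.
Proof.
move=> ab abc bc ca; have [e e1 [En Ed]] := apex_sign ab.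
apply/eqP; rewrite -dt_eq0; apply/eqP.
have K : dt c (apex a b) = e * (dt c a + dt a b * dt c b).
  by rewrite {1}/dt En Ed /dt; lia.
rewrite K; move: abc; rewrite ccw_dt (dtC c b).
by case: (adjP ab) => ->; case: (adjP bc) => ->; case: (adjP ca) => ->;
  case: e1 => ->; lia.
Qed.

(** If the edges crossed, the Plucker relation would write a product of two
    units as a sum of two nonzero integers of the same sign. *)
Lemma adj_nocross a b c d : adj a b -> adj c d ->
  ccw a c b -> ccw b d a -> False.
Proof.
move=> ab cd; rewrite !ccw_dt => acb bda.
have K : dt a b * dt c d = dt c b * dt a d - dt d b * dt a c.
  by rewrite /dt; lia.
move: acb bda; rewrite (dtC b d) (dtC d a) (dtC b a) => H1 H2.
have : (dt c b * dt a d) * (dt d b * dt a c) < 0.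
  by case: (adjP ab) H1 H2 => ->; nia.
move: K; set X := dt c b * _; set Y := dt d b * _.
by case: (adjP ab) => ->; case: (adjP cd) => ->; nia.
Qed.

(** The neighbours [b + k x] of [x] are consecutively adjacent; writing
    [y = n b + m x], the division of [m] by [n] finds the two of them that
    separate [x] from [y]. *)
Lemma adj_maximal x y : x != y -> ~~ adj x y ->
  exists a b, [/\ adj a b, ccw a x b & ccw b y a].
Proof.
wlog n0 : x y / 0 < dt x y => [IH|] xy nxy.
  case: (ltrgt0P (dt x y)) => [n0|n0|/eqP]; first exact: IH.
    have [|||a [b [ab ayb bxa]]] := IH y x; last by exists b, a; rewrite adjC.
    - by rewrite dtC; lia.
    - by rewrite eq_sym.
    - by rewrite adjC.
  by rewrite dt_eq0 (negPf xy).
have [[u v] /= uv] := coprimezP _ _ (coprime_nd x).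
pose n := dt x y; pose m0 := num y * u + den y * v.
(* [(- v, u)] is a vector at determinant 1 from [x]. *)
pose k := (m0 %/ n)%Z; pose r := (m0 %% n)%Z.
have mE : m0 = k * n + r by exact: divz_eq.
have r0 : 0 <= r by rewrite modz_ge0 // gt_eqF.
have rn : r < n by exact: ltz_pmod.
have Ey1 : num y = - v * n + m0 * num x.
  by rewrite -[LHS]mulr1 -[X in _ * X = _]uv /n /m0 /dt; lia.
have Ey2 : den y = u * n + m0 * den x.
  by rewrite -[LHS]mulr1 -[X in _ * X = _]uv /n /m0 /dt; lia.
have rN0 : r != 0.
  apply/negP => /eqP rE; move: nxy; rewrite /adj -/n => /negP; apply.
  have [[s t] /= st] := coprimezP _ _ (coprime_nd y).
  have : n * (s * (k * num x - v) + t * (k * den x + u)) = 1.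
    by rewrite -st Ey1 Ey2 mE rE; lia.
  move/(congr1 (fun z => `|z|%N)); rewrite abszM => /eqP.
  by rewrite muln_eq1 => /andP[/eqP n1 _]; lia.
have H1 : (k * num x - v) * den x - num x * (k * den x + u) = -1.
  by rewrite -[X in _ = - X]uv; lia.
have [e e1 [En Ed]] := ptz_adj (or_intror H1).
set a := ptz _ _ in En Ed.
have H2 : ((k + 1) * num x - v) * den x - num x * ((k + 1) * den x + u) = -1.
  by rewrite -[X in _ = - X]uv; lia.
have [f f1 [Fn Fd]] := ptz_adj (or_intror H2).
set b := ptz _ _ in Fn Fd.
have Dax : dt a x = - e by rewrite /dt En Ed; nia.
have Dbx : dt b x = - f by rewrite /dt Fn Fd; nia.
have Dab : dt a b = - (e * f).
  by rewrite /dt En Ed Fn Fd -[RHS]mulr1 -[X in _ = _ * X]uv; lia.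
have Day : dt a y = e * (- r).
  by rewrite /dt En Ed Ey1 Ey2 mE -[RHS]mulr1 -[X in _ = _ * X]uv; lia.
have Dby : dt b y = f * (n - r).
  by rewrite /dt Fn Fd Ey1 Ey2 mE -[RHS]mulr1 -[X in _ = _ * X]uv; lia.
have ab : adj a b.
  by apply: adjPn; rewrite Dab; case: e1 => ->; case: f1 => ->; [right|left|left|right].
have r1 : 0 < r by rewrite lt_def rN0.
exists b, a; split; first by rewrite adjC.
all: rewrite ccw_dt ?(dtC x) ?(dtC y) ?(dtC b a) ?Dax ?Dbx ?Dab ?Day ?Dby.
all: by clearbody n r; clear - e1 f1 r1 rn; case: e1 => ->; case: f1 => ->; nia.
Qed.

(** A chord is crossed by finitely many edges: the vertices of such an edge
    have bounded determinants with both ends of the chord. *)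
Lemma cross_bound a b x y : adj a b -> ccw a x b -> ccw b y a ->
  `|dt a x| <= `|dt x y| /\ `|dt a y| <= `|dt x y|.
Proof.
move=> ab; rewrite !ccw_dt => H1 H2.
have K : dt a b * dt x y = dt x b * dt a y - dt y b * dt a x.
  by rewrite /dt; lia.
have P : (dt x b * dt a y) * (dt y b * dt a x) < 0.
  move: H1 H2; rewrite (dtC b a) (dtC y a) (dtC b y).
  by case: (adjP ab) => ->; nia.
have {}K : `|dt x b * dt a y - dt y b * dt a x| = `|dt x y|.
  by rewrite -K; case: (adjP ab) => ->; lia.
rewrite -K; move: (dt x b) (dt a y) (dt y b) (dt a x) P => p q r s P.
have pq : p * q != 0 by apply: contraTneq P => ->; rewrite mul0r ltxx.
have rs : r * s != 0 by apply: contraTneq P => ->; rewrite mulr0 ltxx.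
have -> : `|p * q - r * s| = `|p| * `|q| + `|r| * `|s|.
  rewrite -!normrM; move: (p * q) (r * s) P => X Y P.
  by case: (ltrgt0P X) => X0; nia.
move: pq rs; rewrite !mulf_eq0 !negb_or => /andP[p0 q0] /andP[r0 s0].
have : 1 <= `|p| by lia.
have : 1 <= `|r| by lia.
by split; nia.
Qed.

Lemma finite_intbox (N : int) : finite_set [set z : int | `|z| <= N].
Proof.
apply: (@sub_finite_set _ _
  ((fun k : nat => k%:Z) @` `I_(`|N|.+1) `|` (fun k : nat => - k%:Z) @` `I_(`|N|.+1))).
  move=> z /= zN; case: (lerP 0 z) => z0; [left | right]; exists `|z|%N => /=; lia.
by rewrite finite_setU; split; apply: finite_image; exact: finite_II.
Qed.

(** By Cramer's rule, the two determinants bound the coordinates. *)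
Lemma finite_dt_box x y (N : int) : x != y ->
  finite_set [set a | `|dt a x| <= N /\ `|dt a y| <= N].
Proof.
move=> xy.
pose B : set int := [set z | `|z| <= N * (`|num x| + `|num y| + `|den x| + `|den y|)].
apply: (@sub_finite_set _ _ ((fun z : int * int => ptz z.1 z.2) @` (B `*` B))).
  move=> a [ax ay]; exists (num a, den a); last by rewrite ptz_nd.
  have := dt_cramer_num x y a; have := dt_cramer_den x y a.
  have : dt x y != 0 by rewrite dt_eq0.
  rewrite (dtC x a) /B; move: (dt x y) (dt a x) (dt a y) ax ay => n p q.
  move: (num a) (den a) (num x) (num y) (den x) (den y) => a1 a2 x1 y1 x2 y2.
  move=> pN qN n0 E1 E2.
  have bd (z u v : int) : n * z = q * u + - p * v -> `|z| <= N * (`|u| + `|v|).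
    move=> E; have : `|n * z| <= `|q| * `|u| + `|p| * `|v|.
      by rewrite E; apply: (le_trans (ler_normD _ _)); rewrite !normrM normrN.
    have : `|z| <= `|n * z| by rewrite normrM; nia.
    by nia.
  have N0 : 0 <= N by lia.
  by split => /=; [have := bd _ _ _ E1 | have := bd _ _ _ E2]; nia.
by apply: finite_image; apply: finite_setX; exact: finite_intbox.
Qed.

(** ** Action of the modular group *)

Definition mobz (M : 'M[int]_2) (x : P1Q) : P1Q := mobius (map_mx intr M) x.

Lemma det_mx2Z (M : 'M[int]_2) : \det M = M 0 0 * M 1 1 - M 0 1 * M 1 0.
Proof.
rewrite (expand_det_row _ 0) !big_ord_recl big_ord0 addr0 /cofactor !det_mx11.
rewrite !mxE /= expr0 expr1 mul1r mulN1r mulrN.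
have -> : lift 0 0 = 1 :> 'I_2 by apply: val_inj.
by have -> : lift 1 0 = 0 :> 'I_2 by apply: val_inj.
Qed.

Lemma mobzE M x :
  mobz M x = ptz (M 0 0 * num x + M 0 1 * den x) (M 1 0 * num x + M 1 1 * den x).
Proof.
pose s : rat := if x is Some q then (denq q)%:~R else 1.
have s0 : s != 0 by rewrite /s; case: (x) => // q; rewrite intr_eq0 denq_neq0.
rewrite /mobz /mobius -(projZ _ s0) scalemxAr.
have -> : s *: hvec x = \col_i (if i == 0 then (num x)%:~R else (den x)%:~R).
  apply/matrixP => i j; rewrite !mxE /s {s s0}; case: ifP => _; case: x => [q|] //=;
    by rewrite ?(mulr1, mulr0) // mulrC numqE.
rewrite /proj !mxE !big_ord_recl !big_ord0 !mxE /=.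
have -> : lift 0 0 = 1 :> 'I_2 by apply: val_inj.
by rewrite !addr0 -!intrM -!intrD intr_eq0 /ptz.
Qed.

Lemma mobz_sign (M : 'M[int]_2) : \det M = 1 ->
  exists s : P1Q -> int, forall x, (s x = 1 \/ s x = -1) /\
    (num (mobz M x) = s x * (M 0 0 * num x + M 0 1 * den x) /\
     den (mobz M x) = s x * (M 1 0 * num x + M 1 1 * den x)).
Proof.
rewrite det_mx2Z => D.
suff H x : exists e : int, (e = 1 \/ e = -1) /\
    (num (mobz M x) = e * (M 0 0 * num x + M 0 1 * den x) /\
     den (mobz M x) = e * (M 1 0 * num x + M 1 1 * den x)).
  by have [s Hs] := choice H; exists s.
rewrite mobzE; have [[u v] /= uv] := coprimezP _ _ (coprime_nd x).
have [|e e1 E] := @ptz_sign (M 0 0 * num x + M 0 1 * den x)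
  (M 1 0 * num x + M 1 1 * den x); last by exists e.
apply/coprimezP; exists (u * M 1 1 - v * M 1 0, v * M 0 0 - u * M 0 1) => /=.
rewrite -[RHS]mulr1 -[X in _ = X * _]D -[X in _ = _ * X]uv.
by move: (M 0 0) (M 0 1) (M 1 0) (M 1 1); lia.
Qed.

Lemma mobz_dt M : \det M = 1 -> exists s : P1Q -> int,
  (forall x, s x = 1 \/ s x = -1) /\
  forall x y, dt (mobz M x) (mobz M y) = s x * s y * dt x y.
Proof.
move=> D; have [s Hs] := mobz_sign D; exists s; split=> [x|x y]; first by case: (Hs x).
have [_ [Ex Ex']] := Hs x; have [_ [Ey Ey']] := Hs y.
rewrite /dt Ex Ex' Ey Ey'; rewrite det_mx2Z in D.
rewrite -[RHS]mulr1 -[X in _ = _ * X]D.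
by move: (M 0 0) (M 0 1) (M 1 0) (M 1 1); lia.
Qed.

Lemma mobz_adj M x y : \det M = 1 -> adj (mobz M x) (mobz M y) = adj x y.
Proof.
move=> D; have [s [s1 E]] := mobz_dt D.
by rewrite /adj E !normrM; case: (s1 x) => ->; case: (s1 y) => ->; rewrite ?normrN !normr1 !mul1r.
Qed.

Lemma mobz_ccw M x y z : \det M = 1 ->
  ccw (mobz M x) (mobz M y) (mobz M z) = ccw x y z.
Proof.
move=> D; have [s [s1 E]] := mobz_dt D.
rewrite !ccw_dt !E; congr (0 < _).
by case: (s1 x) => ->; case: (s1 y) => ->; case: (s1 z) => ->; lia.
Qed.

Lemma mobzM M N x : \det N = 1 -> mobz (M *m N) x = mobz M (mobz N x).
Proof.
move=> D; rewrite /mobz map_mxM mobiusM //.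
by rewrite unitmxE det_map_mx D rmorph1 unitr1.
Qed.

Lemma mobz1 x : mobz 1%:M x = x.
Proof. by rewrite /mobz map_mx1 mobius1. Qed.

Lemma mobzK M : \det M = 1 -> cancel (mobz M) (mobz (\adj M)).
Proof. by move=> D x; rewrite -mobzM // mul_adj_mx D mobz1. Qed.

Lemma det_adj (M : 'M[int]_2) : \det M = 1 -> \det (\adj M) = 1.
Proof.
move=> D; have := congr1 (fun A : 'M[int]_2 => \det A) (mul_mx_adj M).
by rewrite det_mulmx D mul1r det1.
Qed.

Lemma mobzVK M : \det M = 1 -> cancel (mobz (\adj M)) (mobz M).
Proof. by move=> D x; rewrite -mobzM ?det_adj // mul_mx_adj D mobz1. Qed.

Definition mx2z (a b c d : int) : 'M[int]_2 :=
  \matrix_(i, j) if i == 0 then (if j == 0 then a else b) else (if j == 0 then c else d).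

Lemma mx2zE a b c d : (mx2z a b c d 0 0 = a) * (mx2z a b c d 0 1 = b) *
  (mx2z a b c d 1 0 = c) * (mx2z a b c d 1 1 = d).
Proof. by rewrite !mxE. Qed.

Lemma det_mx2z a b c d : \det (mx2z a b c d) = a * d - b * c.
Proof. by rewrite det_mx2Z !mx2zE. Qed.

(** The vectors over the ends of an oriented edge, one of them negated if
    necessary, are the columns of a matrix of determinant [1]. *)
Lemma mobz_edge a b a' b' : adj a b -> adj a' b' ->
  exists M, [/\ \det M = 1, mobz M a = a' & mobz M b = b'].
Proof.
move=> ab ab'; pose e := dt a b; pose f := dt a' b'.
have e2 : e * e = 1 by rewrite /e; case: (adjP ab) => ->.
have f2 : f * f = 1 by rewrite /f; case: (adjP ab') => ->.
(* [M = (a', e f b') (a, b)^-1] *)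
pose M := mx2z (e * num a' * den b - f * num b' * den a)
  (f * num b' * num a - e * num a' * num b)
  (e * den a' * den b - f * den b' * den a)
  (f * den b' * num a - e * den a' * num b).
have MA p q : (M 0 0 * p + M 0 1 * q = e * num a' * (p * den b - num b * q) +
                f * num b' * (num a * q - p * den a)) /\
  (M 1 0 * p + M 1 1 * q = e * den a' * (p * den b - num b * q) +
                f * den b' * (num a * q - p * den a)).
  by rewrite !mx2zE; split; lia.
exists M; split.
- rewrite det_mx2z; transitivity (e * f * (dt a b * dt a' b')).
    by rewrite ![in RHS]/dt; clearbody e f; lia.
  by rewrite -/e -/f mulrACA e2 f2.
- rewrite mobzE (MA _ _).1 (MA _ _).2 -/(dt a b) -/e.
  have -> : num a * den a - num a * den a = 0 by lia.
  by rewrite !mulr0 !addr0 mulrAC e2 mul1r mulrAC e2 mul1r ptz_nd.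
- rewrite mobzE (MA _ _).1 (MA _ _).2 -/(dt a b) -/e.
  have -> : num b * den b - num b * den b = 0 by lia.
  rewrite !mulr0 !add0r mulrC [f * den b' * e]mulrC.
  have [g g1 ->] : exists2 g : int, g = 1 \/ g = -1 & e = g * f.
    exists (e * f); last by rewrite -mulrA f2 mulr1.
    by rewrite /e /f; case: (adjP ab) => ->; case: (adjP ab') => ->; [left|right|right|left].
  have gf z : g * f * (f * z) = g * z by rewrite mulrA -[g * f * f]mulrA f2 mulr1.
  rewrite !gf; case: g1 => ->; rewrite ?mul1r ?ptz_nd //.
  rewrite -[RHS]ptz_nd /ptz !mulN1r oppr_eq0; case: ifP => // _.
  by rewrite !intrN invrN mulrNN.
Qed.

(** ** Triangles and edges *)

(** The inversion in the circle of diameter [a, b] exchanges the two points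
    whose homogeneous coordinates are the sum and the difference of vectors
    over [a] and [b]. *)
Lemma inversion_pair (a b Q T : rat) : a != b -> Q != 0 -> T != 0 ->
  let pr X Y : P1Q := if Y == 0 then None else Some (X / Y) in
  inversion ((a + b) / 2) (((b - a) / 2) ^+ 2) (pr (a * Q + b * T) (Q + T)) =
  pr (a * Q - b * T) (Q - T).
Proof.
move=> hab Q0 T0 /=.
have x_m v : Q + v != 0 ->
    (a * Q + b * v) / (Q + v) - (a + b) / 2 = (a - b) / 2 * (Q - v) / (Q + v).
  by move=> u0; apply: (mulIf u0); rewrite mulrBl !divfK //; lra.
case: eqP => [E|/eqP u0].
  have -> : T = - Q by lra.
  have Q2 : Q + Q != 0 by apply: contraNneq Q0 => h; apply/eqP; lra.
  rewrite opprK (negPf Q2) /=; congr Some.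
  by apply: (mulIf Q2); rewrite divfK //; lra.
have x_m1 := x_m _ u0; case: eqP => [v0|/eqP v0].
  rewrite /inversion; suff -> : (a * Q + b * T) / (Q + T) = (a + b) / 2 by rewrite eqxx.
  by apply/eqP; rewrite -subr_eq0 x_m1 v0 mulr0 mul0r.
have x_m2 := x_m _ v0; rewrite mulrN opprK in x_m2.
have nz : (a - b) / 2 != 0 by rewrite mulf_neq0 // subr_eq0.
have nz2 : (a - b) / 2 * (Q - T) / (Q + T) != 0.
  exact: mulf_neq0 (mulf_neq0 nz v0) (invr_neq0 u0).
rewrite /inversion -subr_eq0 x_m1 (negPf nz2); congr Some.
apply/eqP; rewrite addrC eq_sym -subr_eq x_m2; apply/eqP.
apply: (mulIf nz2); rewrite divfK //.
have -> : ((b - a) / 2) ^+ 2 = (a - b) / 2 * ((a - b) / 2) by lra.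
move: ((a - b) / 2) (Q + T) (Q - T) u0 v0 => c u v u0 v0.
transitivity (c * c * ((u / u) * (v / v))); first by lra.
by rewrite !divff // !mulr1.
Qed.

(** The reflection in the side [(a, b)] exchanges the two points [a + s b] and
    [a - s b] that complete [a] and [b] to a triangle. *)
Lemma reflection_ptz a b (s : int) : s = 1 \/ s = -1 -> adj a b ->
  reflection a b (ptz (num a + s * num b) (den a + s * den b)) =
  ptz (num a - s * num b) (den a - s * den b).
Proof.
move=> s1 ab; have := adjP ab; move: (adj_neq ab).
case: a b {ab} => [a|] [b|] //=; rewrite /dt /=.
- move=> neab _; have hab : a != b by apply: contraNneq neab => ->.
  rewrite /ptz -!(intr_eq0 rat) !intrD !intrN !intrM !numqE.
  rewrite [in RHS]mulrCA [in LHS](mulrCA s%:~R).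
  rewrite inversion_pair ?mulf_neq0 ?intr_eq0 ?denq_neq0 //.
  by case: s1 => ->.
- rewrite !(mulr0, mul1r, mulr1) sub0r => _ D.
  have dn1 : denq a = 1 by have := denq_gt0 a; lia.
  rewrite ?oppr0 ?addr0 dn1 /ptz /= !divr1 intrD intrB numqE dn1 mulr1.
  by congr Some; lra.
- rewrite !(mul0r, mulr0, mul1r, mulr1) subr0 !add0r => _ D.
  have dn1 : denq b = 1 by have := denq_gt0 b; lia.
  rewrite dn1 /ptz !mulr1 oppr_eq0.
  have -> : (s == 0) = false by apply/negbTE; case: s1 => ->.
  rewrite /= intrN intrD intrB intrM numqE dn1 mulr1.
  by case: s1 => ->; congr Some; lra.
Qed.

Lemma reflectionC a b x : reflection a b x = reflection b a x.
Proof.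
case: a b => [a|] [b|] //=; rewrite (addrC b a).
by have -> : ((a - b) / 2) ^+ 2 = ((b - a) / 2) ^+ 2 by lra.
Qed.

Lemma common_neighbour a b c : adj a b -> adj b c -> adj c a ->
  exists2 s : int, s = 1 \/ s = -1 &
    c = ptz (num a + s * num b) (den a + s * den b).
Proof.
move=> ab bc ca; exists (dt b c * dt c a).
  by case: (adjP bc) => ->; case: (adjP ca) => ->; [left|right|right|left].
set s := dt b c * dt c a.
have [e e1 [En Ed]] : exists2 e : int, e = 1 \/ e = -1 &
  num (ptz (num a + s * num b) (den a + s * den b)) = e * (num a + s * num b) /\
  den (ptz (num a + s * num b) (den a + s * den b)) = e * (den a + s * den b).
  apply: (@ptz_adj _ _ b); have := adjP ab; rewrite /dt; lia.
apply/eqP; rewrite -dt_eq0 /dt En Ed.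
have -> : num c * (e * (den a + s * den b)) - e * (num a + s * num b) * den c =
    e * (dt c a - s * dt b c) by rewrite /dt; lia.
rewrite /s; apply/eqP.
by case: (adjP bc) => ->; case: (adjP ca) => ->; lia.
Qed.

(** By [reflection_ptz], because [a + s b] and [a - s b] lie on different
    sides of the edge. *)
Lemma reflection_spec a b c : adj a b -> adj b c -> adj c a ->
  [/\ adj b (reflection a b c), adj (reflection a b c) a &
      ccw a b (reflection a b c) = ~~ ccw a b c].
Proof.
move=> ab bc ca; have [s s1 E] := common_neighbour ab bc ca.
have sp (t : int) : t = 1 \/ t = -1 ->
    exists2 e : int, e = 1 \/ e = -1 &
    let d := ptz (num a + t * num b) (den a + t * den b) in
    dt b d = - e * dt a b /\ dt d a = - e * t * dt a b.
  move=> t1; have [e e1 [En Ed]] : exists2 e : int, e = 1 \/ e = -1 &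
    num (ptz (num a + t * num b) (den a + t * den b)) = e * (num a + t * num b) /\
    den (ptz (num a + t * num b) (den a + t * den b)) = e * (den a + t * den b).
    by apply: (@ptz_adj _ _ b); have := adjP ab; rewrite /dt; lia.
  by exists e => //=; rewrite /dt En Ed; split; lia.
rewrite {}E (reflection_ptz s1 ab) -!mulNr.
have s1' : - s = 1 \/ - s = -1 by lia.
have [e e1 /= [E1 E2]] := sp _ s1; have [f f1 /= [F1 F2]] := sp _ s1'.
rewrite !ccw_dt /adj E1 E2 F1 F2.
by case: (adjP ab) => ->; case: e1 => ->; case: f1 => ->; case: s1 => ->.
Qed.

Section FsetLemmas.
Local Open Scope fset_scope.

Lemma fset2_eq (a b c d : P1Q) : [fset a; b] = [fset c; d] ->
  (a = c /\ b = d) \/ (a = d /\ b = c).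
Proof.
move=> E.
have : a \in [fset c; d] by rewrite -E !inE eqxx.
have : b \in [fset c; d] by rewrite -E !inE eqxx orbT.
have : c \in [fset a; b] by rewrite E !inE eqxx.
have : d \in [fset a; b] by rewrite E !inE eqxx orbT.
rewrite !inE => /orP[]/eqP? /orP[]/eqP? /orP[]/eqP? /orP[]/eqP?; subst; by auto.
Qed.

Lemma fset2C (a b : P1Q) : [fset a; b] = [fset b; a].
Proof. exact: fsetUC. Qed.

Lemma fset3_rot (a b c : P1Q) : [fset a; b; c] = [fset b; c; a].
Proof. by rewrite -fsetUA fsetUC. Qed.

Lemma fset3_swap (a b c : P1Q) : [fset a; b; c] = [fset b; a; c].
Proof. by rewrite (fset2C a). Qed.

Lemma fset3_swap23 (a b c : P1Q) : [fset a; b; c] = [fset a; c; b].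
Proof. by rewrite fset3_swap fset3_rot. Qed.

Lemma mem_fset3 (x a b c : P1Q) :
  (x \in [fset a; b; c]) = [|| x == a, x == b | x == c].
Proof. by rewrite !inE -orbA. Qed.

Lemma card_fset3 (a b c : P1Q) : #|` [fset a; b; c]| = 3 ->
  [/\ a != b, b != c & c != a].
Proof.
have le2 (x y : P1Q) : #|` [fset x; y]| = 3 -> False by rewrite cardfs2; case: eqP.
move=> H; split; apply/eqP => E; subst; apply: le2 (_ : #|` [fset _; _]| = 3) => //.
- by rewrite fsetUid in H; exact: H.
- by rewrite -fsetUA fsetUid in H; exact: H.
- by rewrite fsetUC fsetUA fsetUid in H; exact: H.
Qed.

Lemma card_fset2 (e : {fset P1Q}) : #|` e| == 2 ->
  exists x y, x != y /\ e = [fset x; y].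
Proof.
move=> e2; have /fset0Pn[x xe] : e != fset0 by rewrite -cardfs_gt0 (eqP e2).
have : #|` e `\ x| == 1%N by move: e2; rewrite (cardfsD1 x) xe.
move=> /cardfs1P[y yE]; exists x, y; split; last by rewrite -yE fsetD1K.
have : y \in e `\ x by rewrite yE inE.
by rewrite !inE eq_sym => /andP[].
Qed.

(** By [reflection_spec], reflections preserve pairwise adjacency. *)
Lemma farey_adj t : farey_triangle t ->
  #|` t| = 3 /\ forall x y, x \in t -> y \in t -> x != y -> adj x y.
Proof.
have mk a b c : adj a b -> adj b c -> adj c a -> #|` [fset a; b; c]| = 3 /\
    forall x y, x \in [fset a; b; c] -> y \in [fset a; b; c] -> x != y -> adj x y.
  move=> ab bc ca; split.
    rewrite fsetUC cardfsU1 !inE negb_or cardfs2 (adj_neq ab) adj_neq //.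
    by rewrite eq_sym adj_neq.
  move=> x y; rewrite !mem_fset3 => /or3P[] /eqP-> /or3P[] /eqP->;
    by rewrite ?eqxx // => _; rewrite // adjC.
elim=> [|a b c _ [c3 H]]; first by apply: mk; vm_compute.
have [nab nbc nca] := card_fset3 c3.
have ab : adj a b by apply: H => //; rewrite mem_fset3 eqxx ?orbT.
have bc : adj b c by apply: H => //; rewrite mem_fset3 eqxx ?orbT.
have ca : adj c a by apply: H => //; rewrite mem_fset3 eqxx ?orbT.
by have [? ? _] := reflection_spec ab bc ca; apply: mk.
Qed.

End FsetLemmas.

(** The Euclidean algorithm: unless the two vectors form the standard basis,
    one of them dominates the other, and the triangle is the reflection of
    the one that is spanned by the smaller vector and the difference. *)
Lemma farey_ptz_ge0 n (p q r t : int) : 0 <= p -> 0 <= q -> 0 <= r -> 0 <= t ->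
  p * t - q * r = 1 -> p + q + r + t <= n%:Z ->
  farey_triangle [fset ptz p q; ptz r t; ptz (p + r) (q + t)]%fset.
Proof.
have nd p' q' : 0 <= p' -> 0 <= q' -> coprimez p' q' ->
    num (ptz p' q') = p' /\ den (ptz p' q') = q'.
  move=> p0 q0 c; have [e e1 [En Ed]] := ptz_sign c.
  have d0 := den_ge0 (ptz p' q').
  case: e1 En Ed => ->; rewrite ?mul1r // ?mulN1r => En Ed.
  have q1 : q' = 0 by lia.
  by move: En; rewrite q1 /ptz /=; split; lia.
elim: n p q r t => [|n IH] p q r t p0 q0 r0 t0 D le; first by nia.
have cu : coprimez p q by apply: (@coprime_det _ _ r t); left.
have cv : coprimez r t by apply: (@coprime_det _ _ p q); right; lia.
have [un ud] := nd _ _ p0 q0 cu; have [vn vd] := nd _ _ r0 t0 cv.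
have uv : adj (ptz p q) (ptz r t) by apply: adjPn; rewrite /dt un ud vn vd; lia.
case: (boolP ((r <= p) && (t <= q))) => [/andP[rp tq]|nu].
  have H : farey_triangle [fset ptz (p - r) (q - t); ptz r t; ptz p q]%fset.
    have := IH (p - r) (q - t) r t; rewrite !subrK; apply; try lia.
    by have : 0 < r + t by [nia]; lia.
  rewrite fset3_rot fset3_swap in H; have := farey_reflect H.
  have := reflection_ptz (or_intror (erefl (-1))) uv.
  by rewrite !mulN1r !opprK un ud vn vd => ->.
case: (boolP ((p <= r) && (q <= t))) => [/andP[pr qt]|nv].
  have H : farey_triangle [fset ptz p q; ptz (r - p) (t - q); ptz r t]%fset.
    have := IH p q (r - p) (t - q); rewrite !subrKC; apply; try lia.
    case: (eqVneq p 0) => [p1|]; last by lia.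
    case: (eqVneq q 0) => [q1|]; last by lia.
    by move: D; rewrite p1 q1; lia.
  rewrite fset3_swap23 in H.
  have := farey_reflect H.
  have := reflection_ptz (or_intror (erefl (-1))) (etrans (adjC _ _) uv).
  rewrite !mulN1r !opprK un ud vn vd reflectionC => ->.
  by rewrite (addrC r) (addrC t).
have [-> -> -> ->] : [/\ p = 1, q = 0, r = 0 & t = 1].
  have : r < p /\ q < t by nia.
  by case=> rp qt; split; nia.
have -> : ptz (1 + 0) (0 + 1) = Some 1 by rewrite addr0 add0r /ptz /= divr1.
have -> : ptz 0 1 = Some 0 by rewrite /ptz /= mul0r.
rewrite fset3_rot; exact: farey_base.
Qed.

Definition negP1 : P1Q -> P1Q := omap -%R.

Lemma negP1K : involutive negP1.
Proof. by case=> [x|] //=; rewrite opprK. Qed.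

Lemma negP1_dt x y : adj (negP1 x) (negP1 y) = adj x y.
Proof.
rewrite /adj /dt.
by case: x y => [x|] [y|] //=; rewrite ?numqN ?denqN; apply/eqP/eqP; lia.
Qed.

Lemma farey_neg a b c : farey_triangle [fset a; b; c]%fset ->
  farey_triangle [fset negP1 a; negP1 b; negP1 c]%fset.
Proof.
have im x y z : (negP1 @` [fset x; y; z] = [fset negP1 x; negP1 y; negP1 z])%fset.
  by rewrite !imfsetU !imfset_fset1.
rewrite -im; move: [fset a; b; c]%fset => t; elim=> [|x y z _]; rewrite !im.
  have := farey_reflect (_ : farey_triangle [fset Some 0; None; Some 1]%fset).
  rewrite /= mulr0 sub0r oppr0 fset3_swap23; apply.
  by rewrite fset3_swap23; exact: farey_base.
move/farey_reflect; congr (farey_triangle [fset _; _; _]%fset).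
case: x y z => [x|] [y|] [z|] //=.
- have -> : (- z == (- x - y) / 2) = (z == (x + y) / 2) by apply/eqP/eqP; lra.
  case: eqP => //= _; congr Some.
  have -> : ((- y - - x) / 2) ^+ 2 = ((y - x) / 2) ^+ 2 by lra.
  have -> : - z - (- x - y) / 2 = - (z - (x + y) / 2) by lra.
  by rewrite invrN mulrN; lra.
- by congr Some; lra.
- by congr Some; lra.
- by congr Some; lra.
Qed.

Lemma farey_sum_ge0 a b : 0 <= num a -> 0 <= num b -> adj a b ->
  farey_triangle [fset a; b; ptz (num a + num b) (den a + den b)]%fset.
Proof.
move=> a0 b0 /adjP ab.
wlog : a b a0 b0 ab / dt a b = 1 => [IH|{}ab].
  case: (ab) => D; first exact: IH.
  rewrite fset3_swap (addrC (num a)) (addrC (den a)).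
  by apply: IH => //; rewrite dtC; lia.
have := @farey_ptz_ge0 (absz (num a + den a + num b + den b)%R) _ _ _ _
  a0 (den_ge0 a) b0 (den_ge0 b).
rewrite !ptz_nd; apply; have := den_ge0 a; have := den_ge0 b; last by lia.
by move: ab; rewrite /dt => <- _ _; lia.
Qed.

(** In a nonnegative triple one of the three vectors is the sum of the other
    two, so the triple is reached from the basic triangle by the Euclidean
    algorithm. *)
Lemma farey_triangle_ge0 a b c : 0 <= num a -> 0 <= num b -> 0 <= num c ->
  adj a b -> adj b c -> adj c a -> farey_triangle [fset a; b; c]%fset.
Proof.
move=> a0 b0 c0 ab bc ca.
have N := dt_cramer_num a b c; have D := dt_cramer_den a b c.
have [da db dc] : [/\ 0 <= den a, 0 <= den b & 0 <= den c] by rewrite !den_ge0.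
have nza := num_den_neq0 a; have nzb := num_den_neq0 b; have nzc := num_den_neq0 c.
have : (num c = num a + num b /\ den c = den a + den b) \/
       (num a = num b + num c /\ den a = den b + den c) \/
       (num b = num c + num a /\ den b = den c + den a).
  move: N D; rewrite (dtC c b) (dtC a c).
  by case: (adjP ab) => ->; case: (adjP bc) => ->; case: (adjP ca) => ->; lia.
case=> [[En Ed]|[[En Ed]|[En Ed]]].
- by rewrite -(ptz_nd c) En Ed; exact: farey_sum_ge0.
- by rewrite fset3_rot -(ptz_nd a) En Ed; exact: farey_sum_ge0.
- by rewrite -fset3_rot -(ptz_nd b) En Ed; exact: farey_sum_ge0.
Qed.

(** Zero and infinity form an edge, so no edge joins a positive number to a
    negative one; the change of sign reduces to the nonnegative case. *)
Lemma farey_triangleI a b c : adj a b -> adj b c -> adj c a ->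
  farey_triangle [fset a; b; c]%fset.
Proof.
move=> ab bc ca.
have opp x y : adj x y -> x != None -> y != None -> 0 < num x -> num y < 0 -> False.
  case: x y => [x|] [y|] // /adjP; rewrite /dt /= => H _ _ x0 y0.
  by have := denq_gt0 x; have := denq_gt0 y; nia.
have sgn x y z : adj x y -> adj x z -> x != None -> 0 < num x ->
    0 <= num y /\ 0 <= num z.
  move=> xy xz xN x0; split.
    case: (eqVneq y None) => [->//|yN]; rewrite leNgt; apply/negP; exact: opp xN yN x0.
  case: (eqVneq z None) => [->//|zN]; rewrite leNgt; apply/negP; exact: opp xN zN x0.
have pos x y z : adj x y -> adj y z -> adj z x -> x != None -> 0 < num x ->
    farey_triangle [fset x; y; z]%fset.
  move=> xy yz zx xN x0; have [y0 z0] := sgn _ _ _ xy (etrans (adjC _ _) zx) xN x0.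
  by apply: farey_triangle_ge0 => //; exact: ltW.
case: (boolP ((a != None) && (0 < num a))) => [/andP[aN a0]|aN]; first exact: pos.
case: (boolP ((b != None) && (0 < num b))) => [/andP[bN b0]|bN].
  by rewrite fset3_rot; exact: pos.
case: (boolP ((c != None) && (0 < num c))) => [/andP[cN c0]|cN].
  by rewrite -fset3_rot; exact: pos.
rewrite -(negP1K a) -(negP1K b) -(negP1K c); apply: farey_neg.
have neg0 u : ~~ ((u != None) && (0 < num u)) -> 0 <= num (negP1 u).
  by case: u => [u|] //=; rewrite numqN; lia.
by apply: farey_triangle_ge0; rewrite ?neg0 ?negP1_dt.
Qed.

Lemma farey_triangleE a b c : farey_triangle [fset a; b; c]%fset <->
  [/\ adj a b, adj b c & adj c a].
Proof.
split=> [/farey_adj[c3 H]|[ab bc ca]]; last exact: farey_triangleI.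
have [nab nbc nca] := card_fset3 c3.
by split; apply: H; rewrite ?mem_fset3 ?eqxx ?orbT.
Qed.

Lemma farey_triangleP t : farey_triangle t ->
  exists a b c, [/\ t = [fset a; b; c]%fset, adj a b, adj b c & adj c a].
Proof.
case=> [|a b c H]; last first.
  by exists a, b, (reflection a b c); have /farey_triangleE[] := farey_reflect H.
by exists (Some 0), (Some 1), None; have /farey_triangleE[] := farey_base.
Qed.

Lemma edgeP (E : edge) : exists a b, val E = [fset a; b]%fset /\ adj a b.
Proof.
case: E => e /= /asboolP[t /farey_triangleP[a [b [c [-> ab bc ca]]]]].
rewrite /side => /andP[/fsubsetP sub].
move/card_fset2 => [x [y [xy eE]]]; rewrite eE in sub *.
exists x, y; split=> //.
have : x \in [fset a; b; c]%fset by apply: sub; rewrite !inE eqxx.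
have : y \in [fset a; b; c]%fset by apply: sub; rewrite !inE eqxx orbT.
move: xy; rewrite !mem_fset3 => xy /or3P[] /eqP yE /or3P[] /eqP xE; subst;
  by rewrite ?eqxx // in xy *; rewrite // adjC.
Qed.

Lemma side_fset2 t a b : a != b -> side t [fset a; b]%fset = (a \in t) && (b \in t).
Proof.
move=> ab; rewrite /side cardfs2 ab andbT.
by rewrite fsubUset !fsub1set.
Qed.

Lemma edge_ex a b : adj a b -> exists E : edge, val E = [fset a; b]%fset.
Proof.
move=> ab; have [_ bc ca] := apex_spec ab.
have H : `[< exists2 t, farey_triangle t & side t [fset a; b]%fset >].
  apply/asboolP; exists [fset a; b; apex a b]%fset; first exact: farey_triangleI.
  by rewrite side_fset2 ?adj_neq // !mem_fset3 !eqxx ?orbT.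
by exists (exist (fun e => is_true `[< exists2 t, farey_triangle t & side t e >]) _ H).
Qed.

(** * Labelled triangulations *)

Definition inC (l : edge -> {fset P1Q}) (a b : P1Q) : Prop :=
  exists i, l i = [fset a; b]%fset.

(** A labelled ideal triangulation with vertex set [P1Q].  The last field says
    that the set of chords is maximal, which fails for instance if the
    triangles accumulate along a chord. *)
Record triangulation (l : edge -> {fset P1Q}) : Prop := Triangulation {
  tri_inj : injective l;
  tri_chord : forall i, exists a b, a != b /\ l i = [fset a; b]%fset;
  tri_nocross : forall a b c d, inC l a b -> inC l c d ->
    ccw a c b -> ccw b d a -> False;
  tri_apex : forall a b, inC l a b ->
    exists c, [/\ ccw a b c, inC l b c & inC l c a];
  tri_maximal : forall x y, x != y -> ~ inC l x y ->
    exists a b, [/\ inC l a b, ccw a x b & ccw b y a] }.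

Lemma inC_sym l a b : inC l a b -> inC l b a.
Proof. by case=> i E; exists i; rewrite E fset2C. Qed.

Lemma inC_val a b : inC val a b <-> adj a b.
Proof.
split=> [[E EE]|/edge_ex[E EE]]; last by exists E.
have [c [d [Ecd cd]]] := edgeP E; move: cd; rewrite EE in Ecd.
by case: (fset2_eq Ecd) => -[-> ->] //; rewrite adjC.
Qed.

Lemma triangulation_farey : triangulation val.
Proof.
split.
- exact: val_inj.
- by move=> E; have [a [b [-> ab]]] := edgeP E; exists a, b; rewrite adj_neq.
- by move=> a b c d /inC_val ab /inC_val cd; exact: adj_nocross.
- move=> a b /inC_val ab; exists (apex a b).
  by have [? ? ?] := apex_spec ab; split=> //; exact/inC_val.
- move=> x y xy nxy; have [|a [b [ab ? ?]]] := adj_maximal xy.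
    by apply/negP => /inC_val.
  by exists a, b; split=> //; exact/inC_val.
Qed.

Definition cyclic_bij (g : P1Q -> P1Q) : Prop :=
  bijective g /\ forall x y z, ccw x y z -> ccw (g x) (g y) (g z).

Lemma cyclic_bij_ccw g : cyclic_bij g ->
  forall x y z, ccw (g x) (g y) (g z) = ccw x y z.
Proof.
move=> [gb gc] x y z; apply/idP/idP; last exact: gc.
have gi := bij_inj gb; move=> H; have [n1 n2 n3] := ccw_distinct H.
rewrite !(inj_eq gi) in n1 n2 n3.
by case/orP: (ccw_total n1 n2 n3) => // /gc H'; exfalso; cyc.
Qed.

Lemma cyclic_bij_inv g h : cyclic_bij g -> cancel g h -> cancel h g -> cyclic_bij h.
Proof.
move=> gb gh hg; split; first by exists g.
by move=> x y z H; rewrite -(cyclic_bij_ccw gb) !hg.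
Qed.

Lemma cyclic_bij_id : cyclic_bij id.
Proof. by split=> //; exists id. Qed.

Lemma cyclic_bij_comp g h : cyclic_bij g -> cyclic_bij h -> cyclic_bij (g \o h).
Proof.
move=> [gb gc] [hb hc]; split; first exact: bij_comp.
by move=> x y z /hc; exact: gc.
Qed.

Definition img (g : P1Q -> P1Q) (e : {fset P1Q}) : {fset P1Q} := (g @` e)%fset.

Lemma img2 g a b : img g [fset a; b]%fset = [fset g a; g b]%fset.
Proof. exact: imfset_fset2. Qed.

Lemma img_comp g h e : img (g \o h) e = img g (img h e).
Proof. exact: imfset_comp. Qed.

Lemma img_id e : img id e = e.
Proof. exact: imfset_id. Qed.

Lemma imgK g h : cancel g h -> cancel (img g) (img h).
Proof.
move=> gh e; rewrite -img_comp -[RHS]img_id; by apply: eq_imfset => // x; exact: gh.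
Qed.

Lemma inC_img g l (f : edge -> edge) (fi : edge -> edge) a b :
  cancel fi f -> injective g ->
  inC (fun i => img g (l (f i))) (g a) (g b) <-> inC l a b.
Proof.
move=> fK gi; split=> [[i]|[i E]]; last by exists (fi i); rewrite fK E img2.
rewrite -img2 => E; exists (f i); apply/fsetP => x.
have := congr1 (fun e : {fset P1Q} => g x \in e) E.
by rewrite !(mem_imfset _ _ gi).
Qed.

Lemma triangulation_img g l f : cyclic_bij g -> bijective f ->
  triangulation l -> triangulation (fun i => img g (l (f i))).
Proof.
move=> gb [fi fiK fK] T; have [[h gK hK] _] := gb.
have gi := can_inj gK; have gc := cyclic_bij_ccw gb.
have I a b : inC (fun i => img g (l (f i))) a b <-> inC l (h a) (h b).
  by rewrite -{1}(hK a) -{1}(hK b); exact: inC_img fK gi.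
have hc x y z : ccw x y z = ccw (h x) (h y) (h z) by rewrite -[RHS]gc !hK.
split.
- move=> i j /(can_inj (imgK gK)) /(tri_inj T); exact: (can_inj fiK).
- move=> i; have [a [b [ab ->]]] := tri_chord T (f i).
  by exists (g a), (g b); rewrite img2 (inj_eq gi).
- by move=> a b c d /I ab /I cd; rewrite (hc a) (hc b); exact: tri_nocross T _ _ _ _ ab cd.
- move=> a b /I ab; have [c [abc bc ca]] := tri_apex T ab.
  by exists (g c); rewrite hc gK; split=> //; apply/I; rewrite gK.
- move=> x y xy nxy; have [||a [b [ab H1 H2]]] := @tri_maximal _ T (h x) (h y).
  + by rewrite (can_eq hK).
  + by move=> /I.
  by exists (g a), (g b); rewrite (hc _ x) (hc _ y) !gK; split=> //; apply/I; rewrite !gK.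
Qed.

(** ** Flips *)

(** The two triangles at the edge [k] form the quadrilateral [a, b, c, d], in
    counterclockwise order, and [k] is its diagonal from [a] to [c]. *)
Definition quad l (k : edge) (a b c d : P1Q) : Prop :=
  [/\ l k = [fset a; c]%fset, ccw a b c, ccw c d a &
      [/\ inC l a b, inC l b c, inC l c d & inC l d a]].

(** The diagonal that [l k] is exchanged for in a flip. *)
Definition diag l (k : edge) : {fset P1Q} :=
  xget fset0 [set e | exists a b c d, quad l k a b c d /\ e = [fset b; d]%fset].

Definition flip l (k : edge) : edge -> {fset P1Q} :=
  fun i => if i == k then diag l k else l i.

(** Requiring the third side [(c, a)] to be a chord makes [a, b, c] a
    triangle, because triangles are determined by their sides. *)
Definition succ l (i j : edge) : Prop :=
  exists a b c, [/\ ccw a b c, l i = [fset a; b]%fset, l j = [fset b; c]%fset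
                  & inC l c a].

Definition exch_of l (i j : edge) : int :=
  (`[< succ l i j >] : nat)%:Z - (`[< succ l j i >] : nat)%:Z.

Lemma quad_rot l k a b c d : quad l k a b c d -> quad l k c d a b.
Proof. by case=> E H1 H2 [? ? ? ?]; split=> //; rewrite fset2C. Qed.

(** Two triangles on the same side of a chord with different third vertices
    have crossing sides. *)
Lemma apex_inC_uniq l (T : triangulation l) a b c c' : inC l a b ->
  ccw a b c -> inC l b c -> inC l c a ->
  ccw a b c' -> inC l b c' -> inC l c' a -> c = c'.
Proof.
move=> ab abc bc ca abc' bc' ca'; apply/eqP; apply: contraT => cc'.
have [H|H] : ccw b c c' \/ ccw b c' c by apply/orP; cyc.
- by exfalso; apply: (tri_nocross T ca (inC_sym bc')); cyc.
- by exfalso; apply: (tri_nocross T ca' (inC_sym bc)); cyc.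
Qed.

Lemma quad_ex l (T : triangulation l) k : exists a b c d, quad l k a b c d.
Proof.
have [a [c [ac E]]] := tri_chord T k.
have [|d [H1 H2 H3]] := @tri_apex _ T a c; first by exists k.
have [|b [H1' H2' H3']] := @tri_apex _ T c a; first by exists k; rewrite fset2C.
by exists a, b, c, d; split=> //; cyc.
Qed.

Lemma quad_uniq l (T : triangulation l) k a b c d a' b' c' d' :
  quad l k a b c d -> quad l k a' b' c' d' ->
  [/\ a = a', b = b', c = c' & d = d'] \/ [/\ a = c', b = d', c = a' & d = b'].
Proof.
move=> [E H1 H2 [ab bc cd da]] [E' H1' H2' [ab' bc' cd' da']].
have ac : inC l a c by exists k.
rewrite E in E'; case: (fset2_eq E') => -[? ?]; subst a' c'; [left | right].
  split=> //; [apply: (apex_inC_uniq T (inC_sym ac)) | apply: (apex_inC_uniq T ac)] => //; cyc.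
split=> //; [apply: (apex_inC_uniq T (inC_sym ac)) | apply: (apex_inC_uniq T ac)] => //; cyc.
Qed.

Lemma diagE l (T : triangulation l) k a b c d : quad l k a b c d -> diag l k = [fset b; d]%fset.
Proof.
move=> q; rewrite /diag; case: xgetP => [e _ [a' [b' [c' [d' [q' ->]]]]]|/(_ [fset b; d]%fset)].
  by case: (quad_uniq T q q') => -[_ -> _ ->] //; rewrite fset2C.
by case; exists a, b, c, d.
Qed.

Lemma flipE l (T : triangulation l) k a b c d : quad l k a b c d -> flip l k k = [fset b; d]%fset.
Proof. by move=> q; rewrite /flip eqxx (diagE T q). Qed.

Lemma flip_neq l k i : i != k -> flip l k i = l i.
Proof. by rewrite /flip => /negbTE->. Qed.

Lemma succ_asym l i j : succ l i j -> succ l j i -> False.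
Proof.
move=> [a [b [c [abc Ei Ej _]]]] [a' [b' [c' [abc' Ej' Ei' _]]]].
rewrite Ei in Ei'; rewrite Ej in Ej'.
by case: (fset2_eq Ei') => -[e1 e2]; case: (fset2_eq Ej') => -[e3 e4]; subst; cyc.
Qed.

Lemma succ_neq l i j : succ l i j -> i != j.
Proof. by move=> H; apply/eqP => E; subst; exact: (succ_asym H H). Qed.

Definition quad_sides l k a b c d (p q r s : edge) : Prop :=
  [/\ quad l k a b c d, l p = [fset a; b]%fset, l q = [fset b; c]%fset,
      l r = [fset c; d]%fset & l s = [fset d; a]%fset].

Lemma quad_sides_ex l k a b c d : quad l k a b c d ->
  exists p q r s, quad_sides l k a b c d p q r s.
Proof.
by move=> Q; have [_ _ _ [[p ?] [q ?] [r ?] [s ?]]] := Q; exists p, q, r, s.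
Qed.

Lemma quad_apexb l (T : triangulation l) k a b c d y : quad l k a b c d ->
  ccw a y c -> inC l a y -> inC l y c -> y = b.
Proof.
move=> [Ek abc cda [ab bc cd da]] ayc ay yc.
have ca : inC l c a by exists k; rewrite fset2C.
by apply: (apex_inC_uniq T ca) => //; cyc.
Qed.

Lemma quad_apexd l (T : triangulation l) k a b c d y : quad l k a b c d ->
  ccw c y a -> inC l c y -> inC l y a -> y = d.
Proof. by move=> /quad_rot; exact: quad_apexb. Qed.

Lemma quad_apex_diag l (T : triangulation l) k a b c d y : quad l k a b c d ->
  ccw d y b -> inC l d y -> inC l y b -> y = a.
Proof.
move=> [Ek abc cda [ab bc cd da]] dyb dy yb; apply/eqP; apply: contraT => ya.
have [H|H] : ccw a y b \/ ccw d y a by apply/orP; cyc.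
- by exfalso; apply: (tri_nocross T ab (inC_sym dy)); cyc.
- by exfalso; apply: (tri_nocross T da yb); cyc.
Qed.

(** The second diagonal would cross the first one. *)
Lemma quad_no_diag l (T : triangulation l) k a b c d : quad l k a b c d ->
  inC l b d -> False.
Proof.
move=> [Ek abc cda _] bd; have ac : inC l a c by exists k.
exact: (tri_nocross T ac bd).
Qed.

Lemma quad_succl l (T : triangulation l) k a b c d p q r s j :
  quad_sides l k a b c d p q r s -> succ l k j <-> j = p \/ j = r.
Proof.
move=> [Q Ep Eq Er Es]; have [Ek abc cda [ab bc cd da]] := Q; split.
  move=> [x [y [z [xyz Ek' Ej zx]]]]; have yz : inC l y z by exists j.
  rewrite Ek in Ek'; case: (fset2_eq Ek') => -[e1 e2]; subst x y; [right | left];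
    apply: (tri_inj T); rewrite Ej ?Er ?Ep.
    by rewrite (quad_apexd T Q _ yz zx) //; cyc.
  by rewrite (quad_apexb T Q _ yz zx) //; cyc.
case=> ->; [exists c, a, b | exists a, c, d].
  by split=> //; [cyc | rewrite fset2C].
by split=> //; cyc.
Qed.

Lemma quad_succr l (T : triangulation l) k a b c d p q r s j :
  quad_sides l k a b c d p q r s -> succ l j k <-> j = q \/ j = s.
Proof.
move=> [Q Ep Eq Er Es]; have [Ek abc cda [ab bc cd da]] := Q; split.
  move=> [x [y [z [xyz Ej Ek' zx]]]]; have xy : inC l x y by exists j.
  rewrite Ek in Ek'; case: (fset2_eq Ek') => -[e1 e2]; subst y z; [right | left];
    apply: (tri_inj T); rewrite Ej ?Es ?Eq.
    by rewrite (quad_apexd T Q _ zx xy) //; cyc.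
  by rewrite (quad_apexb T Q _ zx xy) //; cyc.
case=> ->; [exists b, c, a | exists d, a, c].
  by split=> //; [cyc | rewrite fset2C].
by split=> //; cyc.
Qed.

Lemma quad_sides_neq l k a b c d p q r s : quad_sides l k a b c d p q r s ->
  [/\ p != k, q != k, r != k & s != k] /\
  [/\ p != q, p != r, p != s & [/\ q != r, q != s & r != s]].
Proof.
move=> [[Ek abc cda _] Ep Eq Er Es].
have D (i j : edge) : l i <> l j -> i != j.
  by move=> H; apply/eqP => E; rewrite E in H.
by do !split; apply: D; rewrite ?Ep ?Eq ?Er ?Es ?Ek => /fset2_eq[] [e1 e2];
  subst; cyc.
Qed.

(** The angle between two other edges is affected only if the third side of
    its triangle is the old or the new diagonal. *)
Lemma succ_flip l (T : triangulation l) k a b c d p q r s i j :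
  quad_sides l k a b c d p q r s -> i != k -> j != k ->
  succ (flip l k) i j <->
  (succ l i j /\ ~ (i = p /\ j = q \/ i = r /\ j = s)) \/
  (i = q /\ j = r \/ i = s /\ j = p).
Proof.
move=> [Q Ep Eq Er Es] ik jk; have [Ek abc cda [ab bc cd da]] := Q.
have flk := flipE T Q.
have fl m : m != k -> flip l k m = l m by exact: flip_neq.
split.
  move=> [x [y [z [xyz]]]]; rewrite !fl // => Ei Ej [m].
  have xy : inC l x y by exists i.
  have yz : inC l y z by exists j.
  case: (eqVneq m k) => [->|mk].
    rewrite flk => /fset2_eq[] [e1 e2]; subst x z; right.
      right; have yE : y = a by apply: (quad_apex_diag T Q).
      by split; apply: (tri_inj T); rewrite ?Ei ?Ej ?Es ?Ep yE.
    left; have yE : y = c by apply: (quad_apex_diag T (quad_rot Q)).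
    by split; apply: (tri_inj T); rewrite ?Ei ?Ej ?Eq ?Er yE.
  rewrite fl // => Em; left; split.
    by exists x, y, z; split=> //; exists m.
  move=> H; move: mk; apply/negP; rewrite negbK; apply/eqP.
  apply: (tri_inj T); rewrite Em Ek.
  case: H => -[e1 e2]; subst i j; move: Ei Ej;
    rewrite ?Ep ?Eq ?Er ?Es => /fset2_eq[] [e1 e2] /fset2_eq[] [e3 e4]; subst;
    first [exfalso; cyc | by rewrite fset2C | by []].
case=> [[[x [y [z [xyz Ei Ej [m Em]]]]] H]|].
  have xy : inC l x y by exists i.
  have yz : inC l y z by exists j.
  exists x, y, z; rewrite !fl //; split=> //.
  case: (eqVneq m k) => [E|mk]; last by exists m; rewrite fl.
  case: H; move: Em; rewrite E Ek => /fset2_eq[] [e1 e2]; subst x z.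
    right; have yE : y = d by apply: (quad_apexd T Q) => //; cyc.
    by split; apply: (tri_inj T); rewrite ?Ei ?Ej ?Er ?Es yE.
  left; have yE : y = b by apply: (quad_apexb T Q) => //; cyc.
  by split; apply: (tri_inj T); rewrite ?Ei ?Ej ?Ep ?Eq yE.
case=> -[e1 e2]; subst i j; [exists b, c, d | exists d, a, b];
  (split; [cyc | by rewrite fl | by rewrite fl | exists k; rewrite flk //]).
by rewrite fset2C.
Qed.

Lemma quad_sides_flip l (T : triangulation l) k a b c d p q r s :
  quad_sides l k a b c d p q r s ->
  quad_sides (flip l k) k b c d a q r s p.
Proof.
move=> QS; have [[pk qk rk sk] _] := quad_sides_neq QS.
have [Q Ep Eq Er Es] := QS; have [Ek abc cda [ab bc cd da]] := Q.
have fl m : m != k -> flip l k m = l m by exact: flip_neq.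
split; rewrite ?fl //; split; [exact: (flipE T Q) | cyc | cyc |].
by split; [exists q | exists r | exists s | exists p]; rewrite fl.
Qed.

(** Matrix mutation changes an entry [s i j] when one of [i], [j] precedes
    [k] and the other one follows it, that is, for two sides of the
    quadrilateral around [k]; by [succ_flip] these are the entries that the
    flip changes. *)
Lemma exch_flip (s : seed edge) l k :
  triangulation l -> triangulation (flip l k) ->
  (forall i j, s i j = exch_of l i j) ->
  forall i j, mutate s k i j = exch_of (flip l k) i j.
Proof.
move=> T T' sE i j.
have [a [b [c [d Q]]]] := quad_ex T k.
have [p [q [r [t QS]]]] := quad_sides_ex Q.
have QS' := quad_sides_flip T QS.
have oreq (x y z : edge) : `[< x = y \/ x = z >] = (x == y) || (x == z).
  by apply/asboolP/orP => -[] h; [left | right | left | right]; apply/eqP.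
have sl m : `[< succ l k m >] = (m == p) || (m == r).
  by rewrite (asbool_equiv_eq (quad_succl T m QS)) oreq.
have sr m : `[< succ l m k >] = (m == q) || (m == t).
  by rewrite (asbool_equiv_eq (quad_succr T m QS)) oreq.
have sl' m : `[< succ (flip l k) k m >] = (m == q) || (m == t).
  by rewrite (asbool_equiv_eq (quad_succl T' m QS')) oreq.
have sr' m : `[< succ (flip l k) m k >] = (m == r) || (m == p).
  by rewrite (asbool_equiv_eq (quad_succr T' m QS')) oreq.
rewrite /= /mutate_exch !sE /exch_of.
have [ik|ik] := eqVneq i k; first by rewrite ik sl sr sl' sr' /=; lia.
have [jk|jk] := eqVneq j k; first by rewrite jk sl sr sl' sr' /=; lia.
rewrite /= !sl !sr.
have sf x y : x != k -> y != k -> `[< succ (flip l k) x y >] =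
    `[< succ l x y >] && ~~ ((x == p) && (y == q) || (x == r) && (y == t)) ||
    ((x == q) && (y == r) || (x == t) && (y == p)).
  move=> xk yk; apply/asboolP/idP.
    move/(succ_flip T QS xk yk) => [[/asboolP-> H]|H]; apply/orP; [left|right].
      apply/negP => /orP[]/andP[/eqP ? /eqP ?]; apply: H; by [left | right].
    by case: H => -[-> ->]; rewrite !eqxx ?orbT.
  move=> H; apply/(succ_flip T QS xk yk); case/orP: H => [/andP[/asboolP H1 H2]|H2].
    left; split=> // H; move: H2; case: H => -[-> ->]; by rewrite !eqxx ?orbT.
  by right; case/orP: H2 => /andP[/eqP-> /eqP->]; [left | right].
rewrite !sf //; have [_ [pq pr pt [qr qt rt]]] := quad_sides_neq QS.
have [_ Ep Eq Er Et] := QS; have [Ek abc cda [ab bc cd da]] := Q.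
have S1 : `[< succ l p q >] = true.
  by apply/asboolP; exists a, b, c; split=> //; exists k; rewrite fset2C.
have S2 : `[< succ l r t >] = true.
  by apply/asboolP; exists c, d, a; split=> //; exists k.
have as_ x y : `[< succ l x y >] = true -> `[< succ l y x >] = false.
  by move=> /asboolP H; apply/asboolP => H'; exact: succ_asym H H'.
have nd x y u v w : l x = [fset u; v]%fset -> l y = [fset v; w]%fset ->
    ccw u v w -> (inC l w u -> False) ->
    `[< succ l x y >] = false /\ `[< succ l y x >] = false.
  move=> Ex Ey uvw N; split; apply/asboolP => -[u' [v' [w' [H Ex' Ey' wu]]]];
    rewrite ?Ex ?Ey in Ex' Ey'; case: (fset2_eq Ex') => -[e1 e2];
    case: (fset2_eq Ey') => -[e3 e4]; subst;
    by [exact: N | exact: N (inC_sym wu) | cyc].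
have bd : inC l b d -> False := quad_no_diag T Q.
have [S3 S4] := nd _ _ _ _ _ Eq Er ltac:(cyc) (fun h => bd (inC_sym h)).
have [S5 S6] := nd _ _ _ _ _ Et Ep ltac:(cyc) bd.
have S7 := as_ _ _ S1; have S8 := as_ _ _ S2.
have [qp rp tp] : [/\ q != p, r != p & t != p] by rewrite ![_ == p]eq_sym.
have [rq tq tr] : [/\ r != q, t != q & t != r].
  by rewrite ![_ == q]eq_sym [t == r]eq_sym.
have neqs := (negPf pq, negPf pr, negPf pt, negPf qr, negPf qt, negPf rt,
  negPf qp, negPf rp, negPf tp, negPf rq, negPf tq, negPf tr).
case: (eqVneq i p) => [->|ip]; [|case: (eqVneq i q) => [->|iq];
  [|case: (eqVneq i r) => [->|ir]; [|case: (eqVneq i t) => [->|it]]]];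
(case: (eqVneq j p) => [->|jp]; [|case: (eqVneq j q) => [->|jq];
  [|case: (eqVneq j r) => [->|jr]; [|case: (eqVneq j t) => [->|jt]]]]);
rewrite ?eqxx ?neqs ?S1 ?S2 ?S3 ?S4 ?S5 ?S6 ?S7 ?S8 /= ?andbF ?andbT ?orbF ?orbT //=;
case: `[< _ >] => //=; case: `[< _ >] => //=.
Qed.

Lemma next_side_succ t (E F : edge) : farey_triangle t -> next_side t E F ->
  succ val E F.
Proof.
move=> ft [a [b [c [abc tE EE EF]]]]; exists a, b, c; split=> //.
by apply/inC_val; move: ft; rewrite tE farey_triangleE => -[].
Qed.

Lemma succ_next_side (E F : edge) : succ val E F -> exists t,
  [/\ farey_triangle t, next_side t E F, E != F & common_triangles E F = [set t]].
Proof.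
move=> H; have EF := succ_neq H; case: H => a [b [c [abc EE FE /inC_val ca]]].
have ab : adj a b by apply/inC_val; exists E.
have bc : adj b c by apply/inC_val; exists F.
have ft : farey_triangle [fset a; b; c]%fset by apply: farey_triangleI.
exists [fset a; b; c]%fset; split=> //; first by exists a, b, c.
apply/seteqP; split=> [t [ft' _]|t ->] /=.
  rewrite EE FE !side_fset2 ?adj_neq // => /andP[at_ bt] /andP[_ ct].
  apply/esym/eqP; rewrite eqEfcard (farey_adj ft').1 (farey_adj ft).1 leqnn andbT.
  by apply/fsubsetP => x; rewrite mem_fset3 => /or3P[]/eqP->.
split=> //; rewrite ?EE ?FE side_fset2 ?adj_neq // !mem_fset3 !eqxx ?orbT //.
Qed.

(** Two different edges are sides of at most one common triangle, so the sum
    that defines the exchange matrix has at most one term. *)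
Lemma farey_exchE (E F : edge) : farey_seed E F = exch_of val E F.
Proof.
rewrite /= /farey_exch /exch_of.
case: (asboolP (succ val E F)) => [H|N1].
  have [t [ft nt EF ->]] := succ_next_side H; rewrite fsbig_set1 /delta.
  case: asboolP => // _; case: asboolP => // H'.
  by case: (succ_asym H H').
case: (asboolP (succ val F E)) => [H|N2].
  have [t [ft nt EF]] := succ_next_side H.
  have -> : common_triangles F E = common_triangles E F.
    by apply/seteqP; split=> u [? ? ? ?]; split=> //; rewrite eq_sym.
  move=> ->; rewrite fsbig_set1 /delta.
  case: asboolP => [/(next_side_succ ft)//|_].
  by case: asboolP.
rewrite fsbig1 // => t [ft _ _ _]; rewrite /delta.
case: asboolP => [/(next_side_succ ft)//|_].
by case: asboolP => [/(next_side_succ ft)//|_].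
Qed.

(** ** Naturality under order-preserving bijections *)

Lemma quad_img g l f k a b c d : cyclic_bij g -> bijective f ->
  quad l (f k) a b c d ->
  quad (fun i => img g (l (f i))) k (g a) (g b) (g c) (g d).
Proof.
move=> gb [fi fiK fK] [E H1 H2 [ab bc cd da]].
have gc := cyclic_bij_ccw gb; have gi := bij_inj gb.1.
have I x y : inC l x y -> inC (fun i => img g (l (f i))) (g x) (g y).
  by move=> ?; apply/(inC_img _ _ _ fK gi).
by split; rewrite ?gc // ?E ?img2 //; split; exact: I.
Qed.

Lemma flip_img g l f k : cyclic_bij g -> bijective f -> triangulation l ->
  flip (fun i => img g (l (f i))) k = fun i => img g (flip l (f k) (f i)).
Proof.
move=> gb fb T; have T' := triangulation_img gb fb T.
apply/funext => i; rewrite /flip (inj_eq (bij_inj fb)); case: eqP => // _.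
have [a [b [c [d Q]]]] := quad_ex T (f k).
by rewrite (diagE T Q) (diagE T' (quad_img gb fb Q)) img2.
Qed.

Lemma succ_img g l f i j : cyclic_bij g -> bijective f ->
  succ (fun i => img g (l (f i))) i j <-> succ l (f i) (f j).
Proof.
move=> gb [fi fiK fK]; have gc := cyclic_bij_ccw gb.
have gi := bij_inj gb.1; have [h gK hK] := gb.1; split.
  move=> [a [b [c [abc Ei Ej ca]]]]; exists (h a), (h b), (h c).
  rewrite -gc !hK; split=> //.
  - by apply: (can_inj (imgK gK)); rewrite Ei img2 !hK.
  - by apply: (can_inj (imgK gK)); rewrite Ej img2 !hK.
  - by apply/(inC_img _ _ _ fK gi); rewrite !hK.
move=> [a [b [c [abc Ei Ej ca]]]]; exists (g a), (g b), (g c).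
rewrite gc Ei Ej !img2; split=> //.
exact/(inC_img _ _ _ fK gi).
Qed.

Lemma exch_of_img g l f i j : cyclic_bij g -> bijective f ->
  exch_of (fun i => img g (l (f i))) i j = exch_of l (f i) (f j).
Proof.
move=> gb fb; rewrite /exch_of.
by do 2 rewrite (asbool_equiv_eq (succ_img _ _ _ gb fb)).
Qed.

(** * Piecewise modular maps *)

Lemma finite_edges (S : set P1Q) : finite_set S ->
  finite_set [set E : edge | forall x, x \in val E -> S x].
Proof.
move=> fS; pose f (z : P1Q * P1Q) : {fset P1Q} := [fset z.1; z.2]%fset.
apply: (@sub_finite_set _ _ (val @^-1` (f @` (S `*` S)))).
  move=> E /=; have [a [b [-> _]]] := edgeP E => H; exists (a, b) => //=.
  by split; apply: H; rewrite !inE eqxx ?orbT.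
apply: finite_preimage; first by move=> ? ? _ _; exact: val_inj.
by apply: finite_image; exact: finite_setX.
Qed.

Definition separates (E : edge) (x y : P1Q) : Prop :=
  exists a b, [/\ val E = [fset a; b]%fset, ccw a x b & ccw b y a].

Lemma separates_sym E x y : separates E x y -> separates E y x.
Proof. by move=> [a [b [EE ? ?]]]; exists b, a; rewrite fset2C. Qed.

Lemma finite_separates x y : finite_set [set E | separates E x y].
Proof.
have [->|xy] := eqVneq x y.
  suff -> : [set E | separates E y y] = set0 by exact: finite_set0.
  by apply/seteqP; split=> // E [a [b [_ H1 H2]]]; exfalso; cyc.
apply: sub_finite_set (finite_edges (finite_dt_box `|dt x y| xy)).
move=> E [a [b [EE axb bya]]] u.
have ab : adj a b by apply/inC_val; exists E.
rewrite EE !inE => /orP[]/eqP->; first exact: cross_bound ab axb bya.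
have [H1 H2] := cross_bound (etrans (adjC _ _) ab) bya axb.
by rewrite /= (dtC x y) normrN.
Qed.

Lemma between (x y : P1Q) : x != y -> exists z, ccw x z y.
Proof.
move=> xy; case: (boolP (adj y x)) => [yx|nyx].
  by exists (apex y x); have [? _ _] := apex_spec yx; cyc.
have [|a [b [ab H1 H2]]] := @adj_maximal x y xy; first by rewrite adjC.
by exists b; cyc.
Qed.

Definition dev (g : P1Q -> P1Q) : set edge :=
  [set E | ~ exists F : edge, img g (val E) = val F].

Lemma devP g E a b : val E = [fset a; b]%fset -> ~ dev g E <-> adj (g a) (g b).
Proof.
move=> EE; rewrite /dev /= EE img2; split.
  move=> /contrapT[F FE]; apply/inC_val; by exists F.
by move=> /inC_val[F FE]; apply; exists F.
Qed.

(** Membership in the Thompson group, in the form used for labelled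
    triangulations: all but finitely many edges go to edges. *)
Definition almost_modular (g : P1Q -> P1Q) : Prop := exists h,
  [/\ cancel g h, cancel h g, cyclic_bij g, finite_set (dev g) &
      finite_set (dev h)].

Lemma almost_modular_inv g h : almost_modular g -> cancel g h -> cancel h g ->
  almost_modular h.
Proof.
move=> [h' [gh' h'g gb fg fh']] gh hg; exists g; split=> //.
  exact: cyclic_bij_inv gb gh hg.
by have -> : h = h' by apply/funext => x; rewrite -{1}(h'g x) gh.
Qed.

Lemma finite_dev_comp g h h' : cancel h' h -> cancel h h' ->
  finite_set (dev g) -> finite_set (dev h) -> finite_set (dev (g \o h)).
Proof.
move=> h'h hh' fg fh.
pose c (F : edge) : edge := xget F [set E : edge | img h (val E) = val F].
apply: (@sub_finite_set _ _ (dev h `|` c @` dev g)); last first.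
  by rewrite finite_setU; split=> //; exact: finite_image.
move=> E nE; case: (pselect (dev h E)) => [|/contrapT[F FE]]; [by left | right].
exists F.
  by move=> [G GE]; apply: nE; exists G; rewrite img_comp FE.
rewrite /c; case: xgetP => [E' _ /= E'E|/(_ E)//].
by apply/val_inj/(can_inj (imgK hh')); rewrite E'E FE.
Qed.

Lemma almost_modular_comp g h : almost_modular g -> almost_modular h ->
  almost_modular (g \o h).
Proof.
move=> [g' [gg' g'g gb fg fg']] [h' [hh' h'h hb fh fh']].
exists (h' \o g'); split.
- exact: can_comp.
- exact: can_comp.
- exact: cyclic_bij_comp.
- exact: finite_dev_comp h'h hh' fg fh.
- exact: finite_dev_comp gg' g'g fh' fg'.
Qed.

Lemma mobz_cyclic M : \det M = 1 -> cyclic_bij (mobz M).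
Proof.
move=> D; split; first by exists (mobz (\adj M)); [exact: mobzK | exact: mobzVK].
by move=> x y z; rewrite mobz_ccw.
Qed.

Lemma dev_mobz M : \det M = 1 -> dev (mobz M) = set0.
Proof.
move=> D; apply/seteqP; split=> // E; have [a [b [EE ab]]] := edgeP E.
by have [_] := devP (mobz M) EE; rewrite mobz_adj // => /(_ ab).
Qed.

Lemma almost_modular_mobz M : \det M = 1 -> almost_modular (mobz M).
Proof.
move=> D; exists (mobz (\adj M)); split.
- exact: mobzK.
- exact: mobzVK.
- exact: mobz_cyclic.
- by rewrite dev_mobz.
- by rewrite dev_mobz ?det_adj.
Qed.

Lemma almost_modular_id : almost_modular id.
Proof.
have -> : id = mobz 1%:M by apply/funext => x; rewrite mobz1.
by apply: almost_modular_mobz; rewrite det1.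
Qed.

(** ** Piecewise modular maps preserve the cyclic order and almost all edges *)

Lemma count_lt (T : eqType) (P Q : pred T) s c : subpred P Q ->
  c \in s -> Q c -> ~~ P c -> (count P s < count Q s)%N.
Proof.
move=> PQ + Qc nPc; elim: s => // x s IH; rewrite inE => /orP[/eqP<-|cs] /=.
  by rewrite (negPf nPc) Qc add0n add1n ltnS sub_count.
rewrite -addnS leq_add ?IH //.
by case: (boolP (P x)) => // /PQ ->.
Qed.

(** If no break point lies strictly between [x] and [y], both belong to one
    segment, on which the map is modular; in general the arc from [x] to [y]
    is cut at a break point. *)
Lemma thompson_cyclic g : thompson g -> cyclic_bij g.
Proof.
move=> [gb [n [a [b [M [nab cov _ D gM]]]]]]; split=> // p x y.
pose bs := [seq a i | i <- enum 'I_n] ++ [seq b i | i <- enum 'I_n].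
have [m] := ubnP (count (fun c => ccw x c y) bs).
elim: m x y => // m IH x y le pxy.
case: (boolP (has (fun c => ccw x c y) bs)) => [/hasP[c cbs xcy]|nh].
  have lt u v : (forall z, ccw u z v -> ccw x z y) -> ~~ ccw u c v ->
      (count (fun z => ccw u z v) bs < m)%N.
    by move=> sub nc; exact: leq_trans (count_lt sub cbs xcy nc) le.
  have H1 : ccw (g p) (g x) (g c).
    apply: IH; last by cyc.
    by apply: lt; [move=> z H; cyc | apply/negP => H; cyc].
  have H2 : ccw (g p) (g c) (g y).
    apply: IH; last by cyc.
    by apply: lt; [move=> z H; cyc | apply/negP => H; cyc].
  by cyc.
have {le m IH} [z xzy] : exists z, ccw x z y.
  by apply: between; apply/negP => H; cyc.
have [i _ zi] : (\bigcup_i segment (a i) (b i)) z by rewrite cov.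
have na : ~~ ccw x (a i) y.
  by apply: (hasPn nh); rewrite mem_cat map_f ?mem_enum.
have nb : ~~ ccw x (b i) y.
  by apply: (hasPn nh); rewrite mem_cat orbC map_f ?mem_enum.
have ab := nab i.
have {}zi : ccw (a i) z (b i).
  case/or3P: zi => // /eqP E; exfalso; move: na nb xzy; rewrite E => na nb xzy.
    by rewrite xzy in na.
  by rewrite xzy in nb.
have sx u : (u == x) || (u == y) || ccw x u y -> segment (a i) (b i) u.
  by move=> H; rewrite /segment /mkset; cyc.
have Mi u := gM i u; pose q := mobz (\adj (M i)) (g p).
have Mq : mobz (M i) q = g p by rewrite mobzVK.
have nq : ~~ ((q == x) || (q == y) || ccw x q y).
  apply/negP => H; have := Mi _ (sx _ H); rewrite -/(mobz _ _) Mq.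
  by move/(bij_inj gb) => E; move: H; rewrite E => H; cyc.
have qxy : ccw q x y by cyc.
rewrite -(mobz_ccw _ _ _ (D i)) Mq in qxy.
have -> : g x = mobz (M i) x by apply/Mi/sx; rewrite eqxx.
by have -> : g y = mobz (M i) y by apply/Mi/sx; rewrite eqxx orbT.
Qed.

(** An edge with both ends in one segment goes to an edge. An end of any
    other edge is an end of a segment, or it lies inside a segment whose
    chord the edge crosses; this leaves finitely many ends. *)
Lemma thompson_dev g : thompson g -> finite_set (dev g).
Proof.
move=> [gb [n [a [b [M [nab cov _ D gM]]]]]].
pose B i := [set u | `|dt u (a i)| <= `|dt (a i) (b i)| /\
                     `|dt u (b i)| <= `|dt (a i) (b i)|].
pose S := \bigcup_(i in [set: 'I_n]) ([set a i; b i] `|` B i).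
have fS : finite_set S.
  apply: bigcup_finite => // i _; rewrite finite_setU; split=> //.
  exact: finite_dt_box (nab i).
apply: sub_finite_set (finite_edges fS) => E nE x xE.
have [u EE ux] : exists2 u, val E = [fset x; u]%fset & adj x u.
  have [c [d [EE cd]]] := edgeP E; move: xE; rewrite EE !inE => /orP[]/eqP->.
    by exists d.
  by exists c; rewrite 1?fset2C // adjC.
have [i _ xi] : (\bigcup_i segment (a i) (b i)) x by rewrite cov.
exists i => //; case/or3P: xi => [/eqP->|/eqP->|axb]; [by left; left|by left; right|right].
have ab := nab i; have xu := adj_neq ux.
have nu : ~~ [|| u == a i, u == b i | ccw (a i) u (b i)].
  apply/negP => ui; have [_ H] := devP g EE; apply: H nE.
  rewrite (gM i u ui) (gM i x _); first by rewrite -!/(mobz _ _) mobz_adj.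
  by rewrite /segment /mkset axb !orbT.
have bua : ccw (b i) u (a i).
  by cyc.
have [||H1 H2] := @cross_bound x u (b i) (a i) ux; [by cyc | by cyc |].
by rewrite (dtC (b i)) normrN in H1 H2; split.
Qed.

Lemma thompson_inv g h : thompson g -> cancel g h -> cancel h g -> thompson h.
Proof.
move=> tg gh hg; have gb := thompson_cyclic tg; have gc := cyclic_bij_ccw gb.
case: tg => _ [n [a [b [M [nab cov ov D gM]]]]].
have gi := can_inj gh.
have seg i y : segment (g (a i)) (g (b i)) y = segment (a i) (b i) (h y).
  by rewrite /segment /mkset -{1 2 3}(hg y) !(inj_eq gi) gc.
split; first by exists g.
exists n, (g \o a), (g \o b), (fun i => \adj (M i)); split=> [i|||i|i x].
- by rewrite /= (inj_eq gi).
- apply/seteqP; split=> // y _.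
  have [i _ yi] : (\bigcup_i segment (a i) (b i)) (h y) by rewrite cov.
  by exists i => //; rewrite seg.
- move=> i j x ij; rewrite !seg => xi xj; have := ov _ _ _ ij xi xj.
  by rewrite /= => /orP[]/eqP<-; rewrite hg eqxx ?orbT.
- exact: det_adj.
- rewrite seg => /gM E; rewrite -{2}(hg x) E.
  by rewrite -!/(mobz _ _) mobzK.
Qed.

Lemma thompson_almost_modular g : thompson g -> almost_modular g.
Proof.
move=> tg; have [[h gh hg] _] := tg; exists h; split=> //.
- exact: thompson_cyclic.
- exact: thompson_dev.
- by apply/thompson_dev/(thompson_inv tg).
Qed.

(** ** Almost modular maps are piecewise modular *)

(** Both maps preserve adjacency and orientation on the arc, so they agree at
    the apex of its chord. This cuts the arc into two, and the one that
    contains [x] has smaller determinants with [x]. *)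
Lemma arc_mobz g M a b : cyclic_bij g -> \det M = 1 -> adj a b ->
  g a = mobz M a -> g b = mobz M b ->
  (forall x y, adj x y -> segment a b x -> segment a b y -> adj (g x) (g y)) ->
  forall x, segment a b x -> g x = mobz M x.
Proof.
move=> gb D + + + + x; have gc := cyclic_bij_ccw gb.
have [n] := ubnP (absz (`|dt a x| + `|dt x b|)%R).
elim: n a b => // n IH a b le ab ga gb' H.
case/or3P=> [/eqP->//|/eqP->//|axb].
have ba : adj b a by rewrite adjC.
have [bac ac cb] := apex_spec ba; set c := apex b a in bac ac cb.
have acb : ccw a c b by cyc.
have sa : segment a b a by rewrite /segment /mkset eqxx.
have sb : segment a b b by rewrite /segment /mkset eqxx orbT.
have sc : segment a b c by rewrite /segment /mkset acb !orbT.
have gcE : g c = mobz M c.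
  have gba : adj (g b) (g a) by exact: H.
  rewrite (@apex_uniq (g b) (g a) (g c)) ?gc //; try exact: H.
  by rewrite ga gb'; apply/esym/apex_uniq; rewrite ?mobz_adj ?mobz_ccw.
have [e e1 [cn cd]] := apex_sign ba.
have Exc : dt x c = e * (dt x b + dt b a * dt x a) by rewrite {1}/dt cn cd /dt; lia.
have Eca : dt c a = e * dt b a by rewrite {1}/dt cn cd /dt; lia.
have Ecb : dt b c = e * (dt b a * dt b a) by rewrite {1}/dt cn cd /dt; lia.
have eD := adjP ba.
case: (eqVneq x c) => [->//|xc].
have [axc|cxb] : ccw a x c \/ ccw c x b by apply/orP; cyc.
- have sub u : segment a c u -> segment a b u by rewrite /segment /mkset => h; cyc.
  apply: (IH a c) => //; rewrite 1?adjC //.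
  + move: le axb axc; rewrite !ccw_dt Eca Exc (dtC x a).
    by case: e1 => ->; case: eD => ->; nia.
  + by move=> u v uv /sub au /sub av; exact: H.
  + by rewrite /segment /mkset axc !orbT.
- have sub u : segment c b u -> segment a b u by rewrite /segment /mkset => h; cyc.
  apply: (IH c b) => //.
  + move: le axb cxb; rewrite !ccw_dt (dtC c x) Exc Ecb (dtC x a) .
    by case: e1 => ->; case: eD => ->; nia.
  + by move=> u v uv /sub au /sub av; exact: H.
  + by rewrite /segment /mkset cxb !orbT.
Qed.

Lemma ccw_first (s : seq P1Q) (x : P1Q) : has (predC1 x) s ->
  exists b, [/\ b \in s, b != x &
    forall c, c \in s -> c != x -> c != b -> ccw x b c].
Proof.
elim: s => //= y s IH; case: (boolP (has (predC1 x) s)) => [/IH[b [bs bx H]] _|ns].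
  case: (boolP ((y != x) && ccw x y b)) => [/andP[yx xyb]|nxyb].
    exists y; rewrite inE eqxx; split=> // c; rewrite inE => /orP[/eqP->|cs cx cy].
      by rewrite eqxx.
    case: (eqVneq c b) => [->//|cb]; have := H c cs cx cb => xbc; cyc.
  exists b; rewrite inE bs orbT; split=> // c; rewrite inE => /orP[/eqP->|]; last exact: H.
  by move=> yx yb; rewrite yx /= in nxyb; cyc.
rewrite orbF => yx; exists y; rewrite inE eqxx; split=> // c.
rewrite inE => /orP[/eqP->|cs cx]; first by rewrite eqxx.
by move/hasPn: ns => /(_ c cs) /=; rewrite cx.
Qed.

Lemma ccw_last (s : seq P1Q) (x : P1Q) : has (predC1 x) s ->
  exists b, [/\ b \in s, b != x &
    forall c, c \in s -> c != x -> c != b -> ccw x c b].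
Proof.
elim: s => //= y s IH; case: (boolP (has (predC1 x) s)) => [/IH[b [bs bx H]] _|ns].
  case: (boolP ((y != x) && ccw x b y)) => [/andP[yx xyb]|nxyb].
    exists y; rewrite inE eqxx; split=> // c; rewrite inE => /orP[/eqP->|cs cx cy].
      by rewrite eqxx.
    case: (eqVneq c b) => [->//|cb]; have := H c cs cx cb => xbc; cyc.
  exists b; rewrite inE bs orbT; split=> // c; rewrite inE => /orP[/eqP->|]; last exact: H.
  by move=> yx yb; rewrite yx /= in nxyb; cyc.
rewrite orbF => yx; exists y; rewrite inE eqxx; split=> // c.
rewrite inE => /orP[/eqP->|cs cx]; first by rewrite eqxx.
by move/hasPn: ns => /(_ c cs) /=; rewrite cx.
Qed.

(** The vertices of the convex hull of [V]: those of [V], and those of the edges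
    that separate two points of [V]. *)
Definition hull (V : set P1Q) : set P1Q :=
  V `|` [set x | exists E u v, [/\ V u, V v, separates E u v & x \in val E]].

Lemma finite_ends (A : set edge) : finite_set A ->
  finite_set [set x | exists2 E, A E & x \in val E].
Proof.
move=> fA; have -> : [set x | exists2 E, A E & x \in val E] =
    \bigcup_(E in A) [set x | x \in val E].
  by apply/seteqP; split=> x [E AE xE]; exists E.
by apply: bigcup_finite => // E _; exact: finite_fset.
Qed.

Lemma finite_hull V : finite_set V -> finite_set (hull V).
Proof.
move=> fV; rewrite finite_setU; split=> //.
pose A := \bigcup_(z in V `*` V) [set E | separates E z.1 z.2].
apply: sub_finite_set (@finite_ends A _).
  by move=> x [E [u [v [Vu Vv H xE]]]]; exists E => //; exists (u, v).
apply: bigcup_finite; first exact: finite_setX.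
by move=> z _; exact: finite_separates.
Qed.

Lemma hull_side V c d a : adj c d -> ccw c a d -> hull V a ->
  exists2 v, V v & ccw c v d.
Proof.
move=> cd cad [Va|[E [u [v [Vu Vv H aE]]]]]; first by exists a.
wlog [a' [EE aua ava]] : u v Vu Vv H / exists a',
    [/\ val E = [fset a; a']%fset, ccw a u a' & ccw a' v a] => [IH|].
  have [e [f [EE euf fve]]] := H; move: aE; rewrite EE !inE => /orP[]/eqP aE.
    by apply: (IH u v) => //; exists f; rewrite aE.
  apply: (IH v u) => //; first exact: separates_sym.
  by exists e; rewrite aE fset2C.
have aa : adj a a' by apply/inC_val; exists E.
have ncr : ~~ ccw d a' c.
  by apply/negP => dac; apply: (adj_nocross cd aa); cyc.
have neq := adj_neq aa.
have [cud|cvd] : ccw c u d \/ ccw c v d by apply/orP; cyc.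
- by exists u.
- by exists v.
Qed.

(** Consecutive vertices of the hull are adjacent: otherwise an edge would
    separate them, hence two points of [V], and its ends would be vertices. *)
Lemma hull_adj V a b : hull V a -> hull V b -> a != b ->
  (forall c, hull V c -> ~~ ccw a c b) -> adj a b.
Proof.
move=> Ha Hb ab H; apply/negP => /negP nab.
have [c [d [cd cad dbc]]] := adj_maximal ab nab.
have [v Vv cvd] := hull_side cd cad Ha.
have [w Vw dwc] := hull_side (etrans (adjC _ _) cd) dbc Hb.
have [E EE] := edge_ex cd.
have : hull V d.
  right; exists E, v, w; split=> //; first by exists c, d.
  by rewrite EE !inE eqxx orbT.
by move/H => nd; cyc.
Qed.

(** Take for [V] the ends of the edges that do not go to edges, together with
    the apexes over pairs of these ends, and cut the circle at the vertices
    of the hull of [V]. Consecutive vertices are adjacent, and the arc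
    between them contains no bad edge: such an edge would join its ends, and
    then its apex inside the arc would be a vertex of the hull. So [arc_mobz]
    applies to each arc. *)
Lemma almost_modular_thompson g : almost_modular g -> thompson g.
Proof.
move=> [g' [gg' g'g gb fg _]]; have gc := cyclic_bij_ccw gb; split; first exact: gb.1.
pose V0 := [set x | exists2 E, dev g E & x \in val E].
have fV0 : finite_set V0 by exact: finite_ends.
pose V := V0 `|` (fun z : P1Q * P1Q => apex z.1 z.2) @` (V0 `*` V0) `|` [set None; Some 0].
have fV : finite_set V.
  by rewrite !finite_setU; do !split=> //; apply: finite_image; exact: finite_setX.
have /finite_fsetP[X XE] := finite_hull fV.
pose s : seq P1Q := X.
have sE x : x \in s <-> hull V x by rewrite XE.
have [sN s0] : None \in s /\ Some 0 \in s by split; apply/sE; left; right; [left|right].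
have hs x : has (predC1 x) s.
  apply/hasP; case: (eqVneq x None) => [->|xN]; first by exists (Some 0).
  by exists None => //=; rewrite eq_sym.
have /choice[nx nxP] : forall a, exists b, [/\ b \in s, b != a &
    forall c, c \in s -> ~~ ccw a c b].
  move=> a; have [b [bs ba H]] := ccw_first (hs a); exists b; split=> // c cs.
  apply/negP => acb; have [n1 n2 _] := ccw_distinct acb.
  by rewrite eq_sym in n1; have := H c cs n1 n2 => abc; cyc.
pose n := size s; pose a (i : 'I_n) := nth None s i; pose b i := nx (a i).
have as_ i : a i \in s by exact: mem_nth.
have aex x : x \in s -> exists i, a i = x.
  by move=> xs; exists (Ordinal (etrans (index_mem x s) xs)); exact: nth_index.
have clean i x y : adj x y -> segment (a i) (b i) x -> segment (a i) (b i) y ->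
    adj (g x) (g y).
  move=> xy xi yi; have [E EE] := edge_ex xy.
  apply/(devP g EE) => dE; have [bs ba nb] := nxP (a i).
  have V0x u : u \in val E -> V0 u by move=> ?; exists E.
  have Vend u : u \in val E -> segment (a i) (b i) u -> (u == a i) || (u == b i).
    move=> /V0x Vu; have us : u \in s by apply/sE; left; left; left.
    by rewrite /segment /mkset orbA => /orP[//|aub]; have := nb u us; rewrite aub.
  have ap u v : V0 u -> V0 v -> apex u v \in s.
    by move=> ? ?; apply/sE; left; left; right; exists (u, v).
  have xE : x \in val E by rewrite EE !inE eqxx.
  have yE : y \in val E by rewrite EE !inE eqxx orbT.
  have abE : adj (b i) (a i) /\ (V0 (a i) /\ V0 (b i)).
    have [Vx Vy] := (V0x _ xE, V0x _ yE); have nxy := adj_neq xy.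
    move: (Vend x xE xi) (Vend y yE yi) xy Vx Vy nxy.
    by move=> /orP[]/eqP-> /orP[]/eqP-> xy Vx Vy; rewrite ?eqxx // => _; rewrite // adjC.
  case: abE => ba' [Va Vb]; have [H _ _] := apex_spec ba'.
  have := nb _ (ap _ _ Vb Va); rewrite -/(b i) => h; cyc.
have adjab i : adj (a i) (b i).
  have [bs ba nb] := nxP (a i); apply: (@hull_adj V).
  - exact/sE.
  - exact/sE.
  - by rewrite eq_sym.
  - by move=> c /sE; exact: nb.
have sega i : segment (a i) (b i) (a i) by rewrite /segment /mkset eqxx.
have segb i : segment (a i) (b i) (b i) by rewrite /segment /mkset eqxx orbT.
have /choice[M MP] : forall i, exists M, [/\ \det M = 1,
    mobz M (a i) = g (a i) & mobz M (b i) = g (b i)].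
  by move=> i; apply: mobz_edge => //; exact: clean.
exists n, a, b, M; split=> [i|||i|i x].
- exact: adj_neq.
- apply/seteqP; split=> // x _; case: (boolP (x \in s)) => [/aex[i <-]|xs]; first by exists i.
  have [c [cs cx H]] := ccw_last (hs x); have [i ai] := aex c cs; exists i => //.
  have [bs ba nb] := nxP (a i); rewrite -/(b i) in bs ba nb.
  have bx : b i != x by apply: contraNneq xs => <-.
  by have := H _ bs bx; rewrite -ai => /(_ ba) xba; rewrite /segment /mkset; cyc.
- move=> i j x ij xi xj; apply: contraT => nx_.
  have [bs ba nb] := nxP (a i); have [bs' ba' nb'] := nxP (a j).
  rewrite -/(b i) -/(b j) in bs ba nb bs' ba' nb'.
  have axb : ccw (a i) x (b i) by case/or3P: xi => // E; rewrite E ?orbT in nx_.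
  have xs : x \notin s by apply: contraL axb; exact: nb.
  have axb' : ccw (a j) x (b j).
    move: xj; rewrite /segment /mkset => /or3P[/eqP E|/eqP E|//]; move: xs; rewrite E.
      by rewrite as_.
    by rewrite bs'.
  have aij : a i != a j by rewrite nth_uniq ?fset_uniq.
  have h1 := nb _ (as_ j); have h2 := nb' _ (as_ i).
  by exfalso; cyc.
- by case: (MP i).
- by have [D Ea Eb] := MP i; apply: arc_mobz => //; exact: clean.
Qed.

(** ** A flip of the Farey triangulation is again a Farey triangulation *)

Section QuarterTurn.
Local Notation z0 := (Some 0 : P1Q).
Local Notation z1 := (Some 1 : P1Q).
Local Notation zi := (None : P1Q).
Local Notation zm := (Some (-1) : P1Q).

Definition rot1 : P1Q -> P1Q := mobz (mx2z 0 1 (-1) 1).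
Definition rot2 : P1Q -> P1Q := mobz (mx2z 1 0 (-1) 1).
Definition rot3 : P1Q -> P1Q := mobz (mx2z (-1) (-1) 1 0).
Definition rot4 : P1Q -> P1Q := mobz (mx2z 1 1 0 1).

Definition inarc (a b x : P1Q) : bool := [|| x == a, x == b | ccw a x b].

(** The piecewise modular map that rotates the quadrilateral [0, 1, oo, -1] by
    one step; it takes the flip of the edge [(0, oo)] to the Farey
    triangulation. *)
Definition quarter_turn (x : P1Q) : P1Q :=
  if inarc z0 z1 x then rot1 x else if inarc z1 zi x then rot2 x
  else if inarc zi zm x then rot3 x else rot4 x.

Lemma rot_val :
  [/\ rot1 z0 = z1, rot1 z1 = zi, rot2 z1 = zi & rot2 zi = zm] /\
  [/\ rot3 zi = zm, rot3 zm = z0, rot4 zm = z0 & rot4 z0 = z1].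
Proof.
by split; split; rewrite /rot1 /rot2 /rot3 /rot4 mobzE !mx2zE /ptz /= ?divr1 //;
  congr Some; apply/eqP.
Qed.

Lemma ccw_z : [/\ ccw z0 z1 zi, ccw z1 zi zm, ccw zi zm z0 & ccw zm z0 z1].
Proof. by []. Qed.

Lemma rotK x : rot4 (rot3 (rot2 (rot1 x))) = x.
Proof.
rewrite /rot1 /rot2 /rot3 /rot4 -!mobzM ?det_mx2z //.
rewrite (_ : _ *m _ = 1%:M) ?mobz1 //; apply/matrixP => i j.
rewrite !mxE !big_ord_recl !big_ord0 !mxE !big_ord_recl !big_ord0 !mxE.
rewrite !big_ord_recl !big_ord0 !mxE /=.
by case: i => [[|[|//]] ?]; case: j => [[|[|//]] ?].
Qed.

Lemma det_rot : [/\ \det (mx2z 0 1 (-1) 1) = 1, \det (mx2z 1 0 (-1) 1) = 1,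
  \det (mx2z (-1) (-1) 1 0) = 1 & \det (mx2z 1 1 0 1) = 1].
Proof. by rewrite !det_mx2z. Qed.

Lemma inarc_meet x :
  [/\ inarc z0 z1 x -> inarc z1 zi x -> x = z1,
      inarc z1 zi x -> inarc zi zm x -> x = zi,
      inarc zi zm x -> inarc zm z0 x -> x = zm &
  [/\ inarc zm z0 x -> inarc z0 z1 x -> x = z0,
      inarc z0 z1 x -> inarc zi zm x -> False &
      inarc z1 zi x -> inarc zm z0 x -> False]].
Proof.
have [c1 c2 c3 c4] := ccw_z.
have meet a b c d : ccw a b c -> ccw c d a -> inarc a b x -> inarc b c x -> x = b.
  by move=> H1 H2; rewrite /inarc => H3 H4; apply/eqP; cyc.
have opp a b c d : ccw a b c -> ccw c d a -> inarc a b x -> inarc c d x -> False.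
  by move=> H1 H2; rewrite /inarc => H3 H4; cyc.
split; [exact: meet c1 c3 | exact: meet c2 c4 | exact: meet c3 c1 |].
by split; [exact: meet c4 c2 | exact: opp c1 c3 | exact: opp c2 c4].
Qed.

Lemma quarter_turn_arc x :
  [/\ inarc z0 z1 x -> quarter_turn x = rot1 x,
      inarc z1 zi x -> quarter_turn x = rot2 x,
      inarc zi zm x -> quarter_turn x = rot3 x &
      inarc zm z0 x -> quarter_turn x = rot4 x].
Proof.
have [[E1 E2 E3 E4] [E5 E6 E7 E8]] := rot_val; have [c1 c2 c3 c4] := ccw_z.
have [m1 m2 m3 [m4 o1 o2]] := inarc_meet x.
rewrite /quarter_turn; split => H.
- by rewrite H.
- case: ifP => [H1|_]; last by rewrite H.
  by rewrite m1 // E2 E3.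
- case: ifP => [H1|_]; first by case: o1.
  case: ifP => [H2|_]; last by rewrite H.
  by rewrite m2 // E4 E5.
- case: ifP => [H1|_].
    by rewrite m4 // E1 E8.
  case: ifP => [H2|_]; first by case: o2.
  case: ifP => [H3|//].
  by rewrite m3 // E6 E7.
Qed.

Lemma inarc_cover x :
  [|| inarc z0 z1 x, inarc z1 zi x, inarc zi zm x | inarc zm z0 x].
Proof. by have [c1 c2 c3 c4] := ccw_z; rewrite /inarc; cyc. Qed.

Lemma mobz_inarc M a b x : \det M = 1 ->
  inarc (mobz M a) (mobz M b) (mobz M x) = inarc a b x.
Proof.
by move=> D; rewrite /inarc mobz_ccw // !(inj_eq (can_inj (mobzK D))).
Qed.

Lemma inarc_rot x :
  [/\ inarc z1 zi (rot1 x) = inarc z0 z1 x, inarc zi zm (rot2 x) = inarc z1 zi x,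
      inarc zm z0 (rot3 x) = inarc zi zm x & inarc z0 z1 (rot4 x) = inarc zm z0 x].
Proof.
have [[E1 E2 E3 E4] [E5 E6 E7 E8]] := rot_val; have [D1 D2 D3 D4] := det_rot.
split.
- by rewrite -[in LHS]E1 -[X in inarc _ X]E2 mobz_inarc.
- by rewrite -[X in inarc X]E3 -[X in inarc _ X]E4 mobz_inarc.
- by rewrite -[X in inarc X]E5 -[X in inarc _ X]E6 mobz_inarc.
- by rewrite -[X in inarc X]E7 -[X in inarc _ X]E8 mobz_inarc.
Qed.

Lemma quarter_turn_bij : bijective quarter_turn.
Proof.
have [D1 D2 D3 D4] := det_rot.
have K : cancel quarter_turn (quarter_turn \o quarter_turn \o quarter_turn).
  move=> x /=; case/or4P: (inarc_cover x) => H.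
  - have [E _ _ _] := quarter_turn_arc x; rewrite E //; move: H.
    have [<- _ _ _] := inarc_rot x => H.
    have [_ E' _ _] := quarter_turn_arc (rot1 x); rewrite E' //; move: H.
    have [_ <- _ _] := inarc_rot (rot1 x) => H.
    have [_ _ E'' _] := quarter_turn_arc (rot2 (rot1 x)); rewrite E'' //; move: H.
    have [_ _ <- _] := inarc_rot (rot2 (rot1 x)) => H.
    have [_ _ _ E3] := quarter_turn_arc (rot3 (rot2 (rot1 x))).
    by rewrite E3 // rotK.
  - have [_ E _ _] := quarter_turn_arc x; rewrite E //; move: H.
    have [_ <- _ _] := inarc_rot x => H.
    have [_ _ E' _] := quarter_turn_arc (rot2 x); rewrite E' //; move: H.
    have [_ _ <- _] := inarc_rot (rot2 x) => H.
    have [_ _ _ E''] := quarter_turn_arc (rot3 (rot2 x)); rewrite E'' //; move: H.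
    have [_ _ _ <-] := inarc_rot (rot3 (rot2 x)) => H.
    have [E3 _ _ _] := quarter_turn_arc (rot4 (rot3 (rot2 x))); rewrite E3 //.
    by rewrite -{1}[x](mobzVK D1) rotK; exact: (mobzVK D1).
  - have [_ _ E _] := quarter_turn_arc x; rewrite E //; move: H.
    have [_ _ <- _] := inarc_rot x => H.
    have [_ _ _ E'] := quarter_turn_arc (rot3 x); rewrite E' //; move: H.
    have [_ _ _ <-] := inarc_rot (rot3 x) => H.
    have [E'' _ _ _] := quarter_turn_arc (rot4 (rot3 x)); rewrite E'' //; move: H.
    have [e4 _ _ _] := inarc_rot (rot4 (rot3 x)); rewrite -e4 => H {e4}.
    have [_ E3 _ _] := quarter_turn_arc (rot1 (rot4 (rot3 x))); rewrite E3 //.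
    rewrite -{1}[x](mobzVK D2) -{1}[mobz _ x](mobzVK D1) rotK.
    by rewrite [rot1 _](mobzVK D1); exact: (mobzVK D2).
  - have [_ _ _ E] := quarter_turn_arc x; rewrite E //; move: H.
    have [_ _ _ <-] := inarc_rot x => H.
    have [E' _ _ _] := quarter_turn_arc (rot4 x); rewrite E' //; move: H.
    have [<- _ _ _] := inarc_rot (rot4 x) => H.
    have [_ E'' _ _] := quarter_turn_arc (rot1 (rot4 x)); rewrite E'' //; move: H.
    have [_ <- _ _] := inarc_rot (rot1 (rot4 x)) => H.
    have [_ _ E3 _] := quarter_turn_arc (rot2 (rot1 (rot4 x))); rewrite E3 //.
    apply: (can_inj (mobzK D4)); exact: rotK.
by exists (quarter_turn \o quarter_turn \o quarter_turn) => // x; exact: K.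
Qed.

Lemma quarter_turn_thompson : thompson quarter_turn.
Proof.
have [D1 D2 D3 D4] := det_rot; have [c1 c2 c3 c4] := ccw_z.
split; first exact: quarter_turn_bij.
exists 4, (fun i => nth None [:: z0; z1; zi; zm] i),
  (fun i => nth None [:: z1; zi; zm; z0] i),
  (fun i => nth 0 [:: mx2z 0 1 (-1) 1; mx2z 1 0 (-1) 1; mx2z (-1) (-1) 1 0;
     mx2z 1 1 0 1] i); split.
- by case=> [[|[|[|[|//]]]] ?].
- apply/seteqP; split=> // x _; case/or4P: (inarc_cover x) => H.
  + by exists (Ordinal (isT : (0 < 4)%N)).
  + by exists (Ordinal (isT : (1 < 4)%N)).
  + by exists (Ordinal (isT : (2 < 4)%N)).
  + by exists (Ordinal (isT : (3 < 4)%N)).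
- move=> i j x ij H1 H2; have [m1 m2 m3 [m4 o1 o2]] := inarc_meet x.
  case: i j ij H1 H2 => [[|[|[|[|//]]]] ?] [[|[|[|[|//]]]] ?];
    rewrite -val_eqE //= => _ H1 H2;
    first [by rewrite (m1 H1 H2) eqxx ?orbT | by rewrite (m2 H1 H2) eqxx ?orbT
    | by rewrite (m3 H1 H2) eqxx ?orbT | by rewrite (m4 H1 H2) eqxx ?orbT
    | by rewrite (m1 H2 H1) eqxx ?orbT | by rewrite (m2 H2 H1) eqxx ?orbT
    | by rewrite (m3 H2 H1) eqxx ?orbT | by rewrite (m4 H2 H1) eqxx ?orbT
    | by case: (o1 H1 H2) | by case: (o2 H1 H2) | by case: (o1 H2 H1)
    | by case: (o2 H2 H1)].
- by case=> [[|[|[|[|//]]]] ?].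
- have Q x := quarter_turn_arc x.
  case=> [[|[|[|[|//]]]] ?] x /=; have [q1 q2 q3 q4] := Q x;
    [exact: q1 | exact: q2 | exact: q3 | exact: q4].
Qed.

Lemma inC_flip l (T : triangulation l) k a b c d x y : quad l k a b c d ->
  inC (flip l k) x y <->
  [fset x; y]%fset = [fset b; d]%fset \/
  inC l x y /\ [fset x; y]%fset <> [fset a; c]%fset.
Proof.
move=> Q; have [Ek _ _ _] := Q; split.
  move=> [i]; rewrite /flip; case: eqP => [_ E|/eqP ik E].
    by left; rewrite -E (diagE T Q).
  right; split; first by exists i.
  by rewrite -E -Ek => /(tri_inj T)/eqP; rewrite (negPf ik).
case=> [E|[[i Ei] N]]; first by exists k; rewrite E (flipE T Q).
exists i; rewrite flip_neq //; apply: contra_notN N => /eqP ik.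
by rewrite -Ei -Ek ik.
Qed.

Lemma flip_inj l k : triangulation l -> injective (flip l k).
Proof.
move=> T i j; have [a [b [c [d Q]]]] := quad_ex T k.
have nd m : l m <> [fset b; d]%fset.
  by move=> E; apply: (quad_no_diag T Q); exists m.
rewrite /flip (diagE T Q); case: eqP => [ik|_]; case: eqP => [jk|_] E.
- by rewrite ik jk.
- by case: (nd j).
- by case: (nd i).
- exact: tri_inj T _ _ E.
Qed.

Definition inquad (z : P1Q) : bool := z \in [:: z0; z1; zi; zm].

(** The properties of a side of the quadrilateral that decide adjacency after
    the quarter turn. *)
Definition quad_arc (a b : P1Q) : Prop :=
  [/\ [/\ adj a b, adj (quarter_turn a) (quarter_turn b), inquad a & inquad b],
      exists2 M, \det M = 1 & forall u, inarc a b u -> quarter_turn u = mobz M u,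
      forall z, inquad z -> ~~ ccw a z b &
      ~~ (inarc a b z1 && inarc a b zm) /\ ~~ (inarc a b z0 && inarc a b zi)].

Lemma quarter_turn_z : [/\ quarter_turn z0 = z1, quarter_turn z1 = zi,
  quarter_turn zi = zm & quarter_turn zm = z0].
Proof.
have [[E1 E2 E3 E4] [E5 E6 E7 E8]] := rot_val.
have [[q1 _ _ _] [_ q2 _ _]] := (quarter_turn_arc z0, quarter_turn_arc z1).
have [[_ _ q3 _] [_ _ _ q4]] := (quarter_turn_arc zi, quarter_turn_arc zm).
by rewrite q1 ?q2 ?q3 ?q4.
Qed.

Lemma quad_arcs : [/\ quad_arc z0 z1, quad_arc z1 zi, quad_arc zi zm & quad_arc zm z0].
Proof.
have [D1 D2 D3 D4] := det_rot; have [t1 t2 t3 t4] := quarter_turn_z.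
have Q u := quarter_turn_arc u.
have az : [/\ adj z0 z1, adj z1 zi, adj zi zm & adj zm z0] by vm_compute.
have [a1 a2 a3 a4] := az.
split; split; rewrite ?t1 ?t2 ?t3 ?t4; try (by split); try (by case/or4P=> /eqP->);
  try (by move=> z; rewrite /inquad !inE => /or4P[]/eqP->).
- by exists (mx2z 0 1 (-1) 1) => // u; case: (Q u).
- by exists (mx2z 1 0 (-1) 1) => // u; case: (Q u).
- by exists (mx2z (-1) (-1) 1 0) => // u; case: (Q u).
- by exists (mx2z 1 1 0 1) => // u; case: (Q u).
Qed.

Lemma quad_arc_ex x : exists a b, quad_arc a b /\ inarc a b x.
Proof.
have [a1 a2 a3 a4] := quad_arcs.
case/or4P: (inarc_cover x) => H; [exists z0, z1|exists z1, zi|exists zi, zm|exists zm, z0];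
  by split.
Qed.

(** The turn is modular on each of the four arcs cut off by the
    quadrilateral, so it preserves adjacency inside an arc. The sides are
    edges before and after the turn, and an edge between the interiors of two
    arcs would cross one of them. *)
Lemma quarter_turn_adj x y : adj (quarter_turn x) (quarter_turn y) <->
  [fset x; y]%fset = [fset z1; zm]%fset \/
  adj x y /\ [fset x; y]%fset <> [fset z0; zi]%fset.
Proof.
have gc := cyclic_bij_ccw (thompson_cyclic quarter_turn_thompson).
have same a b u v : quad_arc a b -> inarc a b u -> inarc a b v ->
    adj (quarter_turn u) (quarter_turn v) <->
    [fset u; v]%fset = [fset z1; zm]%fset \/
    adj u v /\ [fset u; v]%fset <> [fset z0; zi]%fset.
  move=> [_ [M D HM] _ [n1 n2]] ua va; rewrite !HM // mobz_adj //.
  have N1 : [fset u; v]%fset <> [fset z1; zm]%fset.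
    by move/fset2_eq => -[] [e1 e2]; subst; move: n1; rewrite ua va.
  have N2 : [fset u; v]%fset <> [fset z0; zi]%fset.
    by move/fset2_eq => -[] [e1 e2]; subst; move: n2; rewrite ua va.
  by split=> [H|[//|[]]]; [right|].
have diff a b u v : quad_arc a b -> ccw a u b -> ~~ inarc a b v ->
    adj (quarter_turn u) (quarter_turn v) <->
    [fset u; v]%fset = [fset z1; zm]%fset \/
    adj u v /\ [fset u; v]%fset <> [fset z0; zi]%fset.
  move=> [[ab tab _ _] _ nz _] aub; rewrite /inarc => nv; have nab := adj_neq ab.
  have bva : ccw b v a by cyc.
  split=> [H|[/fset2_eq[][e1 _]|[H _]]].
  - by case: (adj_nocross tab H); rewrite gc.
  - by have := nz u; rewrite e1 => /(_ isT); rewrite -e1 aub.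
  - by have := nz u; rewrite e1 => /(_ isT); rewrite -e1 aub.
  - by case: (adj_nocross ab H).
have [a [b [A xa]]] := quad_arc_ex x; have [a' [b' [A' ya]]] := quad_arc_ex y.
case: (boolP (inarc a b y)) => [ya'|nya]; first exact: same A xa ya'.
case: (boolP (inarc a' b' x)) => [xa'|nxa]; first exact: same A' xa' ya.
case: (boolP (ccw a x b)) => [axb|nx]; first exact: diff A axb nya.
case: (boolP (ccw a' y b')) => [ayb|ny].
  by rewrite adjC (adjC x) fset2C; exact: diff A' ayb nxa.
have xz : inquad x.
  by case: A => -[_ _ za zb] _ _ _; case/or3P: xa => [/eqP->|/eqP->|]; rewrite ?(negPf nx).
have yz : inquad y.
  by case: A' => -[_ _ za zb] _ _ _; case/or3P: ya => [/eqP->|/eqP->|]; rewrite ?(negPf ny).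
have [t1 t2 t3 t4] := quarter_turn_z.
have az : [/\ adj z0 z1, adj z1 zi, adj zi zm & adj zm z0] by vm_compute.
have [a1 a2 a3 a4] := az.
have [n1 n2] : adj z0 zi /\ ~~ adj z1 zm by vm_compute.
have nn z : ~~ adj z z by apply/negP => /adj_neq; rewrite eqxx.
have [B1 B2 B3 B4] := quad_arcs.
move: xz yz; rewrite /inquad !inE => /or4P[]/eqP-> /or4P[]/eqP->;
  first [by apply: (same _ _ _ _ B1) | by apply: (same _ _ _ _ B2) | by apply: (same _ _ _ _ B3)
   | by apply: (same _ _ _ _ B4) | rewrite ?t1 ?t2 ?t3 ?t4].
- split=> [|[/fset2_eq[][]//|[_ []//]]]; first by rewrite (negPf n2).
- by split=> // _; left.
- split=> [|[/fset2_eq[][]//|[_ []//]]]; first by rewrite adjC (negPf n2).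
  by rewrite fset2C.
- by split=> [_|_]; [left; rewrite fset2C | rewrite adjC].
Qed.

End QuarterTurn.

Lemma relabel_ex l h h' : cancel h h' -> cancel h' h -> injective l ->
  (forall i, exists a b, l i = [fset a; b]%fset) ->
  (forall x y, inC l x y <-> adj (h x) (h y)) ->
  exists f : edge -> edge, bijective f /\ forall i, l i = img h' (val (f i)).
Proof.
move=> hh' h'h li lc lh.
have /choice[f fE] : forall i, exists E : edge, l i = img h' (val E).
  move=> i; have [a [b Ei]] := lc i.
  have [|E EE] := @edge_ex (h a) (h b); first by apply/lh; exists i.
  by exists E; rewrite EE img2 !hh'.
have /choice[f' f'E] : forall E : edge, exists i, l i = img h' (val E).
  move=> E; have [a [b [EE ab]]] := edgeP E.
  have [|i Ei] := (lh (h' a) (h' b)).2; first by rewrite !h'h.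
  by exists i; rewrite Ei EE img2.
exists f; split=> //; exists f'.
- by move=> i; apply: li; rewrite f'E fE.
- by move=> E; apply/val_inj/(can_inj (imgK h'h)); rewrite -fE f'E.
Qed.

(** The modular group moves any edge to the one from zero to infinity, where
    the quarter turn applies. *)
Lemma flip_farey (E : edge) : exists g (f : edge -> edge),
  [/\ almost_modular g, bijective f & forall i, flip val E i = img g (val (f i))].
Proof.
have T := triangulation_farey; have [a [c [EE ac]]] := edgeP E.
have [|M [D Ma Mc]] := @mobz_edge (Some 0) None a c _ ac; first by vm_compute.
pose m := mobz M; pose m' := mobz (\adj M).
have mm' : cancel m m' by exact: mobzK.
have m'm : cancel m' m by exact: mobzVK.
have [q qt tq] := quarter_turn_bij.
have [c1 c2 c3 c4] := ccw_z.
have Q : quad val E (m (Some 0)) (m (Some 1)) (m None) (m (Some (-1))).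
  split; rewrite /m ?mobz_ccw // ?Ma ?Mc //.
  by rewrite -Ma -Mc; split; apply/inC_val; rewrite mobz_adj.
have am : almost_modular (quarter_turn \o m').
  apply: almost_modular_comp; last by apply: almost_modular_mobz; rewrite det_adj.
  exact/thompson_almost_modular/quarter_turn_thompson.
have hh' : cancel (quarter_turn \o m') (m \o q) by exact: can_comp.
have h'h : cancel (m \o q) (quarter_turn \o m') by exact: can_comp.
have sets x y u v : [fset m' x; m' y]%fset = [fset u; v]%fset <->
    [fset x; y]%fset = [fset m u; m v]%fset.
  split=> /fset2_eq[] [e1 e2].
  - by rewrite -e1 -e2 !m'm.
  - by rewrite -e1 -e2 !m'm fset2C.
  - by rewrite e1 e2 !mm'.
  - by rewrite e1 e2 !mm' fset2C.
have [|x y|f [fb fE]] := relabel_ex hh' h'h (@flip_inj _ E T).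
- move=> i; rewrite /flip; case: ifP => _; last first.
    by have [u [v [Ei _]]] := edgeP i; exists u, v.
  by exists (m (Some 1)), (m (Some (-1))); rewrite (diagE T Q).
- rewrite (inC_flip T _ _ Q) inC_val /= quarter_turn_adj !sets.
  by rewrite /m' mobz_adj ?det_adj.
by exists (m \o q), f; split=> //; exact: almost_modular_inv am hh' h'h.
Qed.

(** The labelled triangulations reachable from the Farey triangulation are
    relabelled images of it under piecewise modular maps. *)
Definition good (l : edge -> {fset P1Q}) : Prop := exists g (f : edge -> edge),
  [/\ almost_modular g, bijective f & forall i, l i = img g (val (f i))].

Lemma almost_modular_cyclic g : almost_modular g -> cyclic_bij g.
Proof. by case=> h []. Qed.

Lemma good_triangulation l : good l -> triangulation l.
Proof.
move=> [g [f [ag fb /funext ->]]].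
exact: triangulation_img (almost_modular_cyclic ag) fb triangulation_farey.
Qed.

Lemma good_val : good val.
Proof.
exists id, id; split=> [||i]; [exact: almost_modular_id | by exists id |].
by rewrite img_id.
Qed.

Lemma good_flip l k : good l -> good (flip l k).
Proof.
move=> [g [f [ag fb /funext ->]]].
rewrite (flip_img _ (almost_modular_cyclic ag) fb triangulation_farey).
have [g' [f' [ag' fb' E]]] := flip_farey (f k).
exists (g \o g'), (f' \o f); split=> [||i]; first exact: almost_modular_comp.
  exact: bij_comp.
by rewrite E img_comp.
Qed.

Lemma unrelab_bij (I : Type) (s : relabeling I) : bijective (unrelab s).
Proof. by exists (relab s); [exact: unrelabK | exact: relabK]. Qed.

Lemma good_relabel l f : bijective f -> good l -> good (fun i => l (f i)).
Proof.
move=> fb [g [f' [ag fb' E]]]; exists g, (f' \o f); split; [exact: ag | exact: bij_comp |].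
by move=> i; rewrite E.
Qed.

Definition tstep l (x : letter edge) : edge -> {fset P1Q} :=
  match x with Mut k => flip l k | Iso f => fun i => l (unrelab f i) end.

Definition track l (w : word edge) : edge -> {fset P1Q} :=
  foldr (fun x l' => tstep l' x) l w.

Lemma track_cat l u v : track l (u ++ v) = track (track l v) u.
Proof. by rewrite /track foldr_cat. Qed.

Definition realizes l (s : seed edge) : Prop :=
  good l /\ forall i j, s i j = exch_of l i j.

Lemma realizes_farey : realizes val farey_seed.
Proof. by split; [exact: good_val | exact: farey_exchE]. Qed.

Lemma exch_of_relabel l f i j : bijective f ->
  exch_of (fun i => l (f i)) i j = exch_of l (f i) (f j).
Proof.
move=> fb; rewrite -(exch_of_img l i j cyclic_bij_id fb).
by congr (exch_of _ i j); apply/funext => k; rewrite img_id.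
Qed.

Lemma realizes_step l s x : realizes l s -> realizes (tstep l x) (step s x).
Proof.
move=> [gl E]; case: x => [k|f] /=; split.
- exact: good_flip.
- move=> i j; apply: exch_flip => //; apply: good_triangulation => //.
  exact: good_flip.
- exact: good_relabel (unrelab_bij f) gl.
- by move=> i j /=; rewrite E (exch_of_relabel _ _ _ (unrelab_bij f)).
Qed.

Lemma realizes_run l s w : realizes l s -> realizes (track l w) (run s w).
Proof. by move=> H; elim: w => //= x w; exact: realizes_step. Qed.

Lemma good_track l w : good l -> good (track l w).
Proof.
move=> gl; elim: w => //= -[k|f] w IH /=; first exact: good_flip.
exact: good_relabel (unrelab_bij f) IH.
Qed.

Lemma track_img g l w : cyclic_bij g -> good l ->
  track (fun i => img g (l i)) w = fun i => img g (track l w i).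
Proof.
move=> gb gl; elim: w => //= x w ->; case: x => [k|f] //=.
have T := good_triangulation (good_track w gl).
by apply: (@flip_img g (track l w) id k gb) => //; exists id.
Qed.

(** * Words modulo the square and pentagon relations *)

Notation swp i j := (relab_swap i j).

Section Special.
Variable I : choiceType.
Implicit Types (s : seed I) (u v w : word I) (i j k : I) (f g : relabeling I).

Lemma special_catr s u v v' : special_eq s v v' -> special_eq s (u ++ v) (u ++ v').
Proof. by apply: special_cat; exact: special_refl. Qed.

Lemma special_catl s u u' v : special_eq (run s v) u u' ->
  special_eq s (u ++ v) (u' ++ v).
Proof. by move=> H; apply: special_cat => //; exact: special_refl. Qed.

Lemma special_mid s u v v' w : special_eq (run s w) v v' ->
  special_eq s (u ++ v ++ w) (u ++ v' ++ w).
Proof. by move=> H; apply/special_catr/special_catl. Qed.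

Lemma relab_swapK i j : relab_comp (swp i j) (swp i j) = relab_id I.
Proof. by apply: relab_ext => x /=; rewrite swap_funK. Qed.

Lemma relab_swapC i j : swp i j = swp j i.
Proof.
have E x : swap_fun i j x = swap_fun j i x.
  by rewrite /swap_fun; case: (eqVneq x i) => [->|]; case: (eqVneq _ j) => // ->.
by apply: relab_ext.
Qed.

Lemma swap_l i j : swap_fun i j i = j. Proof. by rewrite /swap_fun eqxx. Qed.
Lemma swap_r i j : swap_fun i j j = i.
Proof. by rewrite /swap_fun eqxx; case: eqP. Qed.

Lemma special_swap2 s i j : special_eq s [:: Iso (swp i j); Iso (swp i j)] [::].
Proof.
apply: special_trans (special_iso_comp _ _ _) _.
by rewrite relab_swapK; exact: special_iso_id.
Qed.

Lemma special_swap_mut s i j :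
  special_eq s [:: Iso (swp i j); Mut i] [:: Mut j; Iso (swp i j)].
Proof. by have := special_iso_mut s (swp i j) i; rewrite /= swap_l. Qed.

(** Two factors [sigma mu_i] of the rank two relations make up one alternating
    pair of mutations. *)
Lemma special_pair s i j : special_eq s
  [:: Iso (swp i j); Mut i; Iso (swp i j); Mut i] [:: Mut j; Mut i].
Proof.
apply: special_trans (special_catl (u' := [:: Mut j; Iso (swp i j)])
  (v := [:: Iso (swp i j); Mut i]) (special_swap_mut _ i j)) _.
exact: (special_mid [:: Mut j] (v' := [::]) (w := [:: Mut i]) (special_swap2 _ i j)).
Qed.

Lemma special_cancel s u k v v' : special_eq s (u ++ Mut k :: Mut k :: v) v' ->
  special_eq s (u ++ v) v'.
Proof.
move=> H; apply: special_trans H; apply: special_sym.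
exact: (special_mid u (v' := [::]) (special_mut _ k)).
Qed.

(** This is the rank two relation with [p = 0], where [h + 2 = 4]. *)
Lemma special_commute s i j : i != j -> s i j = 0 ->
  special_eq s [:: Mut i; Mut j] [:: Mut j; Mut i].
Proof.
move=> ij sij; have H : special_eq s [:: Mut j; Mut i; Mut j; Mut i] [::].
  have := @special_rank2 _ s i j 0 ij isT.
  rewrite oppr0 mul0r => /(_ sij sij) /=; apply: special_trans.
  apply: special_sym.
  apply: special_trans (special_catl (v := [:: Iso (swp i j); Mut i; Iso (swp i j); Mut i]) (special_pair _ i j)) _.
  exact: (special_catr [:: Mut j; Mut i] (special_pair _ i j)).
apply: special_sym.
have {}H := special_catr [:: Mut i; Mut j] H.
apply: (@special_cancel _ [::] i); apply: (@special_cancel _ [:: Mut i] j).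
exact: H.
Qed.

(** This is the rank two relation with [p = 1], where [h + 2 = 5]: it has
    five factors [sigma mu], and all but the last relabelling cancel in
    pairs. *)
Lemma special_pentagonN s i j : i != j -> s i j = -1 ->
  special_eq s [:: Mut j; Mut i; Mut j] [:: Iso (swp i j); Mut j; Mut i] /\
  special_eq s [:: Mut i; Mut j; Mut i] [:: Iso (swp i j); Mut i; Mut j].
Proof.
move=> ij sij; pose S : letter I := Iso (swp i j).
have H : special_eq s [:: Mut j; Mut i; Mut j; Mut i; S; Mut i] [::].
  have := @special_rank2 _ s i j 1 ij isT; rewrite (exch_skew s j i) sij opprK mulr1.
  move=> /(_ erefl erefl) /=; apply: special_trans; apply: special_sym.
  apply: special_trans
    (special_catl (v := [:: S; Mut i; S; Mut i; S; Mut i]) (special_pair _ i j)) _.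
  exact: (special_mid [:: Mut j; Mut i] (w := [:: S; Mut i]) (special_pair _ i j)).
have K1 : special_eq s [:: S; Mut i] [:: Mut i; Mut j; Mut i; Mut j].
  apply: (@special_cancel _ [::] i); apply: (@special_cancel _ [:: Mut i] j).
  apply: (@special_cancel _ [:: Mut i; Mut j] i).
  apply: (@special_cancel _ [:: Mut i; Mut j; Mut i] j).
  exact: (special_catr [:: Mut i; Mut j; Mut i; Mut j] H).
have Sj t : special_eq t [:: S; Mut j] [:: Mut i; S].
  by have := special_iso_mut t (swp i j) j; rewrite /= swap_r.
have K2 : special_eq s [:: Mut j; Mut i; Mut j] [:: S; Mut j; Mut i].
  apply: (@special_cancel _ [::] i); apply: special_sym.
  apply: special_trans (special_catl (v := [:: Mut i]) (Sj _)) _.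
  exact: (special_catr [:: Mut i] K1).
split=> //; have K3 : special_eq s [:: Mut i; Mut j] [:: S; Mut i; Mut j; Mut i].
  apply: (@special_cancel _ [::] j); apply: special_sym.
  apply: special_trans (special_catl (v := [:: Mut j; Mut i]) (special_swap_mut _ i j)) _.
  exact/special_sym/(special_catr [:: Mut j] K2).
apply: special_sym; apply: special_trans (special_catr [:: S] K3) _.
exact: (special_mid [::] (v' := [::]) (special_swap2 _ i j)).
Qed.

Lemma special_pentagon s i j : i != j -> s i j = 1 \/ s i j = -1 ->
  special_eq s [:: Mut i; Mut j; Mut i] [:: Iso (swp i j); Mut i; Mut j].
Proof.
move=> ij [] sij; last by case: (special_pentagonN ij sij).
rewrite relab_swapC; have [||] // := @special_pentagonN s j i.
  by rewrite eq_sym.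
by rewrite exch_skew sij.
Qed.
End Special.

(** ** The relations between flips *)

Definition apart l (i j : edge) : Prop := ~ succ l i j /\ ~ succ l j i.

Lemma apart_sym l i j : apart l i j -> apart l j i.
Proof. by case. Qed.

Lemma apart_exch l i j : apart l i j -> exch_of l i j = 0.
Proof. by case=> n1 n2; rewrite /exch_of; do 2 case: asboolP => //. Qed.

Lemma succ_exch l i j : succ l i j -> exch_of l i j = 1.
Proof.
move=> H; rewrite /exch_of; case: asboolP => // _; case: asboolP => // H'.
by case: (succ_asym H H').
Qed.

Lemma succ_exchN l i j : succ l i j -> exch_of l j i = -1.
Proof.
move=> H; rewrite /exch_of; case: asboolP => [H'|_]; last by case: asboolP.
by case: (succ_asym H H').
Qed.

Lemma quad_flip_apart l (T : triangulation l) i j a b c d : i != j -> apart l i j ->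
  quad l i a b c d -> quad (flip l j) i a b c d.
Proof.
move=> ij [n1 n2] Q; have [p [q [r [s QS]]]] := quad_sides_ex Q.
have sl := quad_succl T _ QS; have sr := quad_succr T _ QS.
have [_ Ep Eq Er Es] := QS; have [Ei abc cda _] := Q.
have fl m : m != j -> flip l j m = l m by exact: flip_neq.
split=> //; first by rewrite fl.
split; [exists p|exists q|exists r|exists s]; rewrite fl //;
  apply/eqP => E; subst;
  by [case: n1; apply/sl; left | case: n2; apply/sr; left
     | case: n1; apply/sl; right | case: n2; apply/sr; right].
Qed.

(** If no triangle contains both edges, flipping one of them leaves the
    quadrilateral of the other one intact. *)
Lemma flip_comm l i j : good l -> i != j -> apart l i j ->
  flip (flip l j) i = flip (flip l i) j.
Proof.
move=> gl ij ap; have T := good_triangulation gl.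
have Ti := good_triangulation (good_flip i gl).
have Tj := good_triangulation (good_flip j gl).
have ji : j != i by rewrite eq_sym.
have [a [b [c [d Q]]]] := quad_ex T i; have [a' [b' [c' [d' Q']]]] := quad_ex T j.
have Qi := quad_flip_apart T ij ap Q.
have Qj := quad_flip_apart T ji (apart_sym ap) Q'.
apply/funext => x; have [->|xi] := eqVneq x i.
  by rewrite (flipE Tj Qi) flip_neq // (flipE T Q).
have [->|xj] := eqVneq x j; first by rewrite flip_neq // (flipE T Q') (flipE Ti Qj).
by rewrite !flip_neq.
Qed.

Lemma flipK l k : good l -> flip (flip l k) k = l.
Proof.
move=> gl; have T := good_triangulation gl; have T' := good_triangulation (good_flip k gl).
have [a [b [c [d Q]]]] := quad_ex T k; have [p [q [r [s QS]]]] := quad_sides_ex Q.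
have [Q' _ _ _ _] := quad_sides_flip T QS; have [Ek _ _ _] := Q.
apply/funext => x; have [->|xk] := eqVneq x k; last by rewrite !flip_neq.
by rewrite (flipE T' Q') Ek fset2C.
Qed.

Lemma inC_flip_neq l k m a b : m != k -> l m = [fset a; b]%fset -> inC (flip l k) a b.
Proof. by move=> mk Em; exists m; rewrite flip_neq. Qed.

(** The five triangulations of the pentagon formed by the three triangles
    adjacent to two diagonals [i = (p1, p3)] and [j = (p1, p4)]. *)
Lemma pentagon_quads l i j : good l -> succ l j i -> exists p1 p2 p3 p4 p5,
  [/\ quad l i p1 p2 p3 p4, quad l j p1 p3 p4 p5,
      quad (flip l i) j p1 p2 p4 p5, quad (flip l j) i p1 p2 p3 p5 &
      quad (flip (flip l i) j) i p2 p3 p4 p5 /\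
      quad (flip (flip l j) i) j p3 p4 p5 p2].
Proof.
move=> gl H; have ji := succ_neq H; have ij : i != j by rewrite eq_sym.
have T := good_triangulation gl.
have Ti := good_triangulation (good_flip i gl).
have Tj := good_triangulation (good_flip j gl).
case: H => p4 [p1 [p3 [c413 Ej Ei [m34 E34]]]].
have [p2 [c2 [m12 E12] [m23 E23]]] : exists p2, [/\ ccw p1 p2 p3, inC l p1 p2 & inC l p2 p3].
  have [|p2 [H1 H2 H3]] := @tri_apex _ T p3 p1; first by exists i; rewrite fset2C.
  by exists p2; split=> //; cyc.
have [p5 [c5 [m45 E45] [m51 E51]]] : exists p5, [/\ ccw p4 p5 p1, inC l p4 p5 & inC l p5 p1].
  have [|p5 [H1 H2 H3]] := @tri_apex _ T p1 p4; first by exists j; rewrite fset2C.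
  by exists p5; split=> //; cyc.
have D (m n : edge) : l m <> l n -> m != n by move=> N; apply/eqP => E; rewrite E in N.
have N : [/\ m12 != i, m23 != i, m34 != i, m45 != i & m51 != i] /\
         [/\ m12 != j, m23 != j, m34 != j, m45 != j & m51 != j].
  by do !split; apply: D; rewrite ?E12 ?E23 ?E34 ?E45 ?E51 ?Ei ?Ej => /fset2_eq[] [e1 e2];
    subst; cyc.
have [[n1 n2 n3 n4 n5] [n1' n2' n3' n4' n5']] := N.
have ex m a b : l m = [fset a; b]%fset -> inC l a b by exists m.
have exi m a b : m != i -> l m = [fset a; b]%fset -> inC (flip l i) a b.
  exact: inC_flip_neq.
have exj m a b : m != j -> l m = [fset a; b]%fset -> inC (flip l j) a b.
  exact: inC_flip_neq.
have Q1 : quad l i p1 p2 p3 p4.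
  split=> //; first by cyc.
  by split; [exact: ex E12 | exact: ex E23 | exact: ex E34 |]; exists j.
have Q2 : quad l j p1 p3 p4 p5.
  split; rewrite ?Ej 1?fset2C //; first by cyc.
  by split; [exists i | exact: ex E34 | exact: ex E45 | exact: ex E51].
have fi := flipE T Q1; have fj := flipE T Q2.
have Q3 : quad (flip l i) j p1 p2 p4 p5.
  split; [by rewrite flip_neq // Ej fset2C | cyc | cyc |].
  split; [exact: exi E12 | by exists i | exact: exi E45 | exact: exi E51].
have Q4 : quad (flip l j) i p1 p2 p3 p5.
  split; [by rewrite flip_neq | cyc | cyc |].
  split; [exact: exj E12 | exact: exj E23 | by exists j | exact: exj E51].
have fij := flipE Ti Q3; have fji := flipE Tj Q4.
exists p1, p2, p3, p4, p5; split=> //; split; split; try cyc.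
- by rewrite flip_neq // fi.
- by split; [exists m23; rewrite !flip_neq | exists m34; rewrite !flip_neq
    | exists m45; rewrite !flip_neq | exists j; rewrite fij fset2C].
- by rewrite flip_neq // fj.
- by split; [exists m34; rewrite !flip_neq | exists m45; rewrite !flip_neq
    | exists i; rewrite fji fset2C | exists m23; rewrite !flip_neq].
Qed.

Lemma flip_relabel l f k : good l -> bijective f ->
  flip (fun i => l (f i)) k = fun i => flip l (f k) (f i).
Proof.
move=> gl fb; have := flip_img k cyclic_bij_id fb (good_triangulation gl).
by under eq_fun do rewrite img_id; under [RHS]eq_fun do rewrite img_id.
Qed.

Lemma swap_bij (i j : edge) : bijective (swap_fun i j).
Proof. by exists (swap_fun i j); exact: swap_funK. Qed.

(** Both ways around the pentagon end with the two diagonals from the same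
    vertex, so only the labels can differ. *)
Lemma pentagon_swap l i j : good l -> succ l j i ->
  flip (flip (flip l i) j) i = (fun x => flip (flip l j) i (swap_fun i j x)) /\
  flip (flip (flip l j) i) j = (fun x => flip (flip l i) j (swap_fun i j x)).
Proof.
move=> gl H; have ji := succ_neq H; have ij : i != j by rewrite eq_sym.
have [p1 [p2 [p3 [p4 [p5 [Q1 Q2 Q3 Q4 [Q5 Q6]]]]]]] := pentagon_quads gl H.
have T := good_triangulation gl.
have gi := good_flip i gl; have gj := good_flip j gl.
have Ti := good_triangulation gi; have Tj := good_triangulation gj.
have Tij := good_triangulation (good_flip j gi).
have Tji := good_triangulation (good_flip i gj).
have fi := flipE T Q1; have fj := flipE T Q2; have fij := flipE Ti Q3.
have fji := flipE Tj Q4; have fiji := flipE Tij Q5; have fjij := flipE Tji Q6.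
split; apply/funext => x; rewrite /swap_fun; have [->|xi] := eqVneq x i.
- by rewrite fiji flip_neq // fj.
- have [->|xj] := eqVneq x j; last by rewrite !flip_neq.
  by rewrite flip_neq // fij fji.
- by rewrite flip_neq // fji fij fset2C.
- have [->|xj] := eqVneq x j; last by rewrite !flip_neq.
  by rewrite fjij [RHS]flip_neq // fi fset2C.
Qed.

(** ** Climbing to the fan at infinity *)

(** A flip up turns the edge [k] into an edge ending at infinity. *)
Definition up l (k : edge) : Prop := exists a b c, quad l k a b c None.

Definition terminal (J : seq edge) (l : edge -> {fset P1Q}) : Prop := forall k, k \in J -> None \in l k.

(** The list [ks] names the flips from last to first, in the order of a word. *)
Inductive climbs (J : seq edge) : (edge -> {fset P1Q}) -> seq edge -> Prop :=
| climbs_nil l : terminal J l -> climbs J l [::]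
| climbs_rcons l k ks : k \in J -> up l k -> climbs J (flip l k) ks ->
    climbs J l (rcons ks k).

Definition muts (ks : seq edge) : word edge := map (@Mut edge) ks.

Lemma muts_rcons ks k : muts (rcons ks k) = muts ks ++ [:: Mut k].
Proof. by rewrite /muts map_rcons cats1. Qed.

Definition height (J : seq edge) (l : edge -> {fset P1Q}) : nat := count (fun k => None \notin l k) J.

(** No edge whose label is outside [J] strictly separates infinity from a
    vertex of an edge labelled in [J]; thus the edges labelled in [J] can climb
    to infinity by flips inside [J]. *)
Definition convex (J : seq edge) (l : edge -> {fset P1Q}) : Prop := forall f, f \notin J ->
  forall a b, l f = [fset a; b]%fset -> ccw a b None ->
  forall e, e \in J -> forall x, x \in l e -> ~~ ccw a x b.

Lemma up_notin (l : edge -> {fset P1Q}) k : up l k -> None \notin l k.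
Proof.
move=> [a [b [c [-> H1 H2 _]]]]; have [n1 n2 _] := ccw_distinct H2.
by rewrite !inE negb_or n2 eq_sym n1.
Qed.

Lemma up_flip l (T : triangulation l) k : up l k -> None \in flip l k k.
Proof. by move=> [a [b [c Q]]]; rewrite (flipE T Q) !inE eqxx orbT. Qed.

Lemma flip_down l k (T : triangulation l) :
  None \in l k -> up (flip l k) k.
Proof.
move=> Nk; have [a [b [c [d Q]]]] := quad_ex T k.
have [p [q [r [s QS]]]] := quad_sides_ex Q; have [Q' _ _ _ _] := quad_sides_flip T QS.
have [Ek _ _ _] := Q; move: Nk; rewrite Ek !inE => /orP[]/eqP E; subst.
  by exists b, c, d.
by exists d, a, b; exact: quad_rot.
Qed.

Lemma up_height J l k : triangulation l -> k \in J -> up l k ->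
  (height J (flip l k) < height J l)%N.
Proof.
move=> T kJ ul; apply: count_lt kJ (up_notin ul) _; last by rewrite negbK up_flip.
move=> x /=; have [->|xk] := eqVneq x k; first by rewrite up_flip.
by rewrite flip_neq.
Qed.

Lemma up_inC l k x : up l k -> x \in l k -> inC l x None.
Proof.
move=> [a [b [c [-> _ _ [_ _ cd da]]]]]; rewrite !inE => /orP[]/eqP-> //.
exact: inC_sym.
Qed.

Lemma up_apart l i j : triangulation l -> up l i -> up l j -> apart l i j.
Proof.
move=> T; suff main a b : up l a -> up l b -> ~ succ l a b.
  by move=> ui uj; split; exact: main.
move=> ua ub [x [y [z [xyz Ea Eb zx]]]].
have xN : inC l x None by apply: (up_inC ua); rewrite Ea !inE eqxx.
have yN : inC l y None by apply: (up_inC ua); rewrite Ea !inE eqxx orbT.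
have zN : inC l z None by apply: (up_inC ub); rewrite Eb !inE eqxx orbT.
have xy : inC l x y by exists a.
have yz : inC l y z by exists b.
have := up_notin ua; have := up_notin ub.
rewrite Ea Eb !inE !negb_or => /andP[n1 n2] /andP[n3 _].
have [|[|]] : ccw x None y \/ ccw y None z \/ ccw z None x.
  case: (boolP (ccw x None y)) => h1; [by left | right].
  by apply/orP; cyc.
- by move=> h; apply: (tri_nocross T xy (inC_sym zN)) => //; cyc.
- by move=> h; apply: (tri_nocross T yz (inC_sym xN)) => //; cyc.
- by move=> h; apply: (tri_nocross T zx (inC_sym yN)) => //; cyc.
Qed.

Lemma up_flip_apart l i j : triangulation l -> i != j -> apart l i j -> up l i ->
  up (flip l j) i.
Proof. by move=> T ij ap [a [b [c Q]]]; exists a, b, c; exact: quad_flip_apart. Qed.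

(** Cross triangles from [e] towards infinity until one of them has infinity
    as its vertex; by convexity, the edges crossed are in [J]. *)
Lemma up_ex J l e : triangulation l -> convex J l -> e \in J -> None \notin l e ->
  exists2 k, k \in J & up l k.
Proof.
move=> T cv eJ Ne.
have [a [b [Ee abN]]] : exists a b, l e = [fset a; b]%fset /\ ccw a b None.
  have [a [b [ab Ee]]] := tri_chord T e; move: Ne; rewrite Ee !inE negb_or.
  move=> /andP[n1 n2]; case: (boolP (ccw a b None)) => H; first by exists a, b.
  by exists b, a; rewrite fset2C; split=> //; cyc.
pose P a b (k : edge) : bool := `[< forall x, x \in l k -> inarc b a x >].
have [n] := ubnP (count (P a b) J).
elim: n e a b eJ Ee abN {Ne} => // n IH e a b eJ Ee abN le.
have ab : inC l a b by exists e.
have [c [abc [f Ef] [g Eg]]] := tri_apex T ab.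
have [cN|cN] := eqVneq c None.
  exists e => //; have [y [bay y1 y2]] := tri_apex T (inC_sym ab).
  exists a, y, b; split; [exact: Ee | cyc | cyc |].
  by split=> //; rewrite -?cN; [exists f | exists g].
have Pe : P a b e.
  apply/asboolP => x; rewrite Ee !inE /inarc => /orP[]->; by rewrite ?orbT.
have [bNc|cNa] : ccw b None c \/ ccw c None a by apply/orP; cyc.
- have fJ : f \in J.
    apply: contraT => nf; have := cv f nf c b; rewrite fset2C => /(_ Ef).
    have -> : ccw c b None by cyc.
    move=> /(_ isT e eJ a); rewrite Ee !inE eqxx => /(_ isT) /negP; case.
    by cyc.
  apply: (IH f c b) => //; first by rewrite fset2C.
    by cyc.
  apply: leq_trans (_ : (count (P a b) J <= n)%N) => //.
  apply: count_lt eJ Pe _.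
    move=> k /asboolP H; apply/asboolP => x /H; rewrite /inarc => h; cyc.
  apply/asboolP => /(_ a); rewrite Ee !inE eqxx => /(_ isT); rewrite /inarc => h.
  by cyc.
- have gJ : g \in J.
    apply: contraT => ng; have := cv g ng a c; rewrite fset2C => /(_ Eg).
    have -> : ccw a c None by cyc.
    move=> /(_ isT e eJ b); rewrite Ee !inE eqxx orbT => /(_ isT) /negP; case.
    by cyc.
  apply: (IH g a c) => //; first by rewrite fset2C.
    by cyc.
  apply: leq_trans (_ : (count (P a b) J <= n)%N) => //.
  apply: count_lt eJ Pe _.
    move=> k /asboolP H; apply/asboolP => x /H; rewrite /inarc => h; cyc.
  apply/asboolP => /(_ b); rewrite Ee !inE eqxx orbT => /(_ isT); rewrite /inarc => h.
  by cyc.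
Qed.

Lemma convex_flip J l k : triangulation l -> convex J l -> k \in J ->
  convex J (flip l k).
Proof.
move=> T cv kJ f nf a b; have fk : f != k by apply: contraNneq nf => ->.
rewrite flip_neq // => Ef abN e eJ x.
have [->|ek] := eqVneq e k; last by rewrite flip_neq //; exact: (cv f nf a b Ef abN e eJ x).
have [p [y [q [y' Q]]]] := quad_ex T k; have [Ek _ _ [py yq qy' y'p]] := Q.
have nk := cv f nf a b Ef abN k kJ.
have np : ~~ ccw a p b by apply: nk; rewrite Ek !inE eqxx.
have nq : ~~ ccw a q b by apply: nk; rewrite Ek !inE eqxx orbT.
have ab : inC l a b by exists f.
rewrite (flipE T Q) => xd; apply/negP => axb.
have [xp xq] : inC l x p /\ inC l x q.
  by move: xd; rewrite !inE => /orP[]/eqP->; split=> //; exact: inC_sym.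
have end_ u : inC l x u -> ~~ ccw a u b -> (u == a) || (u == b).
  move=> xu nu; apply: contraT; rewrite negb_or => /andP[ua ub].
  by case: (tri_nocross T ab xu axb); cyc.
have pq : p != q by have [r [s [rs E]]] := tri_chord T k; move: rs;
  rewrite Ek in E; case: (fset2_eq E) => -[-> ->] //; rewrite eq_sym.
suff : f = k by move/eqP; rewrite (negPf fk).
apply: (tri_inj T); rewrite Ef Ek; move: (end_ p xp np) (end_ q xq nq) pq.
by move=> /orP[]/eqP-> /orP[]/eqP->; rewrite ?eqxx // fset2C.
Qed.

(** Each flip up decreases the number of edges in [J] that do not end at
    infinity. *)
Lemma climbs_ex J l : good l -> convex J l -> exists ks, climbs J l ks.
Proof.
have [n] := ubnP (height J l); elim: n l => // n IH l le gl cv.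
have T := good_triangulation gl.
case: (pselect (terminal J l)) => [t|nt]; first by exists [::]; exact: climbs_nil.
have [e eJ Ne] : exists2 e, e \in J & None \notin l e.
  apply: contrapT => H; apply: nt => k kJ; apply: contraT => nk.
  by case: H; exists k.
have [k kJ uk] := up_ex T cv eJ Ne.
have [||ks H] := IH _ _ (good_flip k gl).
- exact: leq_trans (up_height T kJ uk) le.
- exact: convex_flip.
by exists (rcons ks k); exact: climbs_rcons.
Qed.

(** ** The square and pentagon relations hold for flips *)

Lemma exch_succ l i j : exch_of l i j = 1 -> succ l i j.
Proof. by rewrite /exch_of; case: asboolP => // _; case: asboolP. Qed.

Lemma exch_apart l i j : exch_of l i j = 0 -> apart l i j.
Proof.
move=> E; split=> H; first by rewrite (succ_exch H) in E.
by rewrite (succ_exchN H) in E.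
Qed.

Lemma track_pair l i j w : good l ->
  track l [:: Iso (swp i j), Mut i, Iso (swp i j), Mut i & w] =
  track l [:: Mut j, Mut i & w].
Proof.
move=> gl /=; have gw := good_track w gl.
have := flip_relabel i (good_flip i gw) (swap_bij i j).
rewrite /= => ->; rewrite swap_l; apply/funext => x /=.
by rewrite swap_funK.
Qed.

(** Exchange matrices of triangulations have entries [0], [1] and [-1], so
    the only rank two relations that occur are the square and the pentagon. *)
Lemma special_track s u v : special_eq s u v ->
  forall l, realizes l s -> track l u = track l v.
Proof.
elim=> {s u v} [//|s u v _ IH l rl|s u v w _ IH1 _ IH2 l rl||s l rl|s f g l rl|s f k l rl|s k l rl|].
- by rewrite IH.
- by rewrite IH1 ?IH2.
- move=> s u u' v v' _ IHu _ IHv l rl; rewrite !track_cat -(IHv l rl).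
  exact: IHu (realizes_run v rl).
- by [].
- by [].
- by rewrite /= (flip_relabel _ rl.1 (unrelab_bij f)) relabK.
- by rewrite /= flipK //; case: rl.
move=> s i j p ij _ E1 E2 l rl; have gl := rl.1.
have [p0|[p1 sji]] : p = 0%N \/ p = 1%N /\ s j i = 1.
  have := exch_skew s j i; rewrite E2; case: p E1 E2 => [|p] E1 E2 E3; [by left|right].
  have : s j i = 1 by nia.
  by move=> sji; split=> //; move: E3; rewrite sji; lia.
- have ap : apart l i j by apply: exch_apart; rewrite -rl.2 E2 p0.
  rewrite p0 (_ : (coxeter 0 + 2)%N = 4%N) // [flatten _]/=.
  rewrite (track_pair _ _ _ gl) -[[:: Mut j, Mut i & _]]cat1s -[Mut i :: _]cat1s !track_cat.
  rewrite (track_pair _ _ [::] gl) /=.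
  by rewrite -(flip_comm gl ij ap) (flipK _ (good_flip _ gl)) flipK // flipK.
- have H : succ l j i by apply: exch_succ; rewrite -rl.2.
  rewrite p1 (_ : (coxeter 1 + 2)%N = 5%N) // [flatten _]/=.
  rewrite (track_pair _ _ _ gl) -[[:: Mut j, Mut i & _]]cat1s -[Mut i :: _]cat1s !track_cat.
  rewrite (track_pair _ _ _ gl) /=.
  have gi := good_flip i gl; have gij := good_flip j gi; have giji := good_flip i gij.
  have fs l' k : good l' -> flip (fun x => l' (swap_fun i j x)) k =
      fun x => flip l' (swap_fun i j k) (swap_fun i j x).
    by move=> gl'; exact: flip_relabel gl' (swap_bij i j).
  rewrite (fs _ i gi) swap_l (fs _ j gij) swap_r.
  have [-> _] := pentagon_swap gl H; apply/funext => x.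
  have gji := good_flip i (good_flip j gl).
  under eq_fun do rewrite swap_funK.
  by rewrite flipK ?flipK //; exact: good_flip.
Qed.

(** ** Words with the same effect on triangulations are equivalent *)

Lemma climbs_inv J l ks : climbs J l ks ->
  (terminal J l /\ ks = [::]) \/ exists k ks',
    [/\ ks = rcons ks' k, k \in J, up l k & climbs J (flip l k) ks'].
Proof. by case=> [l' t|l' k ks' *]; [left | right; exists k, ks']. Qed.

Lemma climbs_special_rcons s ks ks' k :
  special_eq (mutate s k) (muts ks) (muts ks') ->
  special_eq s (muts (rcons ks k)) (muts (rcons ks' k)).
Proof. by move=> H; rewrite !muts_rcons; exact: special_catl. Qed.

(** Two different flips up commute, so climbing is confluent. *)
Lemma climbs_unique J l s ks ks' : realizes l s -> convex J l ->
  climbs J l ks -> climbs J l ks' -> special_eq s (muts ks) (muts ks').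
Proof.
have [n] := ubnP (height J l); elim: n l s ks ks' => // n IH l s ks ks' le rl cv c c'.
have gl := rl.1; have T := good_triangulation gl.
have [[t ->]|[k [ks1 [-> kJ uk c1]]]] := climbs_inv c.
  have [[_ ->]|[k [ks1 [_ kJ uk _]]]] := climbs_inv c'; first exact: special_refl.
  by have := up_notin uk; rewrite t.
have [[t _]|[k' [ks2 [-> kJ' uk' c2]]]] := climbs_inv c'.
  by have := up_notin uk; rewrite t.
have lt m : m \in J -> up l m -> (height J (flip l m) < n)%N.
  by move=> mJ um; exact: leq_trans (up_height T mJ um) le.
have [E|kk'] := eqVneq k k'.
  subst k'; apply: climbs_special_rcons.
  exact: IH (lt k kJ uk) (realizes_step (Mut k) rl) (convex_flip T cv kJ) c1 c2.
have ap := up_apart T uk uk'; have k'k : k' != k by rewrite eq_sym.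
have cvk := convex_flip T cv kJ; have cvk' := convex_flip T cv kJ'.
have Tk := good_triangulation (good_flip k gl).
have uk1 := up_flip_apart T kk' ap uk; have uk1' := up_flip_apart T k'k (apart_sym ap) uk'.
have [ks3 c3] := climbs_ex (good_flip k' (good_flip k gl)) (convex_flip Tk cvk kJ').
have c31 := climbs_rcons kJ' uk1' c3; rewrite -(flip_comm gl kk' ap) in c3.
have c32 := climbs_rcons kJ uk1 c3.
have H1 := IH _ _ _ _ (lt k kJ uk) (realizes_step (Mut k) rl) cvk c1 c31.
have H2 := IH _ _ _ _ (lt k' kJ' uk') (realizes_step (Mut k') rl) cvk' c2 c32.
apply: special_trans (climbs_special_rcons H1) _; apply: special_sym.
apply: special_trans (climbs_special_rcons H2) _.
rewrite !muts_rcons -!catA; apply: special_catr.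
by apply: special_commute => //; rewrite rl.2 apart_exch.
Qed.

Lemma up_relabel l (f : relabeling edge) k : good l -> up l k ->
  up (fun i => l (unrelab f i)) (f k).
Proof.
move=> gl [a [b [c Q]]]; exists a, b, c.
have := @quad_img id l (unrelab f) (f k) a b c None cyclic_bij_id (unrelab_bij f).
rewrite relabK => /(_ Q).
by under eq_fun do rewrite img_id.
Qed.

Lemma climbs_relabel J l (f : relabeling edge) ks : good l ->
  (forall i, (unrelab f i \in J) = (i \in J)) ->
  climbs J l ks -> climbs J (fun i => l (unrelab f i)) (map f ks).
Proof.
move=> + fJ c; elim: c => {l ks} [l t|l k ks kJ uk c IH] gl.
  by apply: climbs_nil => k kJ; apply: t; rewrite fJ.
rewrite map_rcons; apply: climbs_rcons; first by rewrite -fJ relabK.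
  exact: up_relabel.
rewrite (flip_relabel _ gl (unrelab_bij f)) relabK.
exact: IH (good_flip k gl).
Qed.

Lemma special_iso_muts s (f : relabeling edge) ks :
  special_eq s (Iso f :: muts ks) (muts (map f ks) ++ [:: Iso f]).
Proof.
elim: ks => [|k ks IH]; first exact: special_refl.
apply: special_trans (special_catl (v := muts ks) (special_iso_mut _ f k)) _.
exact: (special_catr [:: Mut (f k)] IH).
Qed.

(** If an edge not ending at infinity shares a triangle with an edge that
    flips up, the two ways around their pentagon climb. *)
Lemma pentagon_up l e f : good l -> up l f -> None \notin l e ->
  succ l e f \/ succ l f e ->
  [/\ up (flip l e) f, up (flip (flip l e) f) e, up (flip l f) e &
      flip (flip (flip l e) f) e =
      (fun x => flip (flip l f) e (unrelab (swp e f) x))].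
Proof.
move=> gl [a [b [c Q]]] Ne; have T := good_triangulation gl.
case=> H; have [p1 [p2 [p3 [p4 [p5 [Q1 Q2 Q3 Q4 [Q5 Q6]]]]]]] := pentagon_quads gl H.
- have [El _ _ _] := Q2; have E2 : p2 = None.
    have [[_ _ _ e4]|[_ e4 _ _]] := quad_uniq T Q1 Q; last by [].
    by move: Ne; rewrite El e4 !inE eqxx orbT.
  subst p2; split; first by exists p3, p5, p1; exact: quad_rot.
  + by exists p3, p4, p5.
  + by exists p4, p5, p1; exact: quad_rot.
  + by have [_ ->] := pentagon_swap gl H; rewrite relab_swapC.
- have [El _ _ _] := Q1; have E5 : p5 = None.
    have [[_ _ _ e4]|[_ e2 _ e4]] := quad_uniq T Q2 Q; first by [].
    by move: Ne; rewrite El e2 !inE eqxx orbT.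
  subst p5; split; first by exists p1, p2, p4.
  + by exists p2, p3, p4.
  + by exists p1, p2, p3.
  + by have [-> _] := pentagon_swap gl H.
Qed.

Lemma special_id_cons s (u : word edge) : special_eq s u (Iso (relab_id edge) :: u).
Proof.
exact/special_sym/(special_catl (u := [:: Iso (relab_id edge)]) (u' := [::]))/special_iso_id.
Qed.

(** Climbing before or after a flip makes no difference, up to a relabelling.
    A flip up or down is part of a climb; any other flip forms a square or a
    pentagon with some flip up. *)
Lemma climbs_move J l s e ks ks' : realizes l s -> convex J l -> e \in J ->
  climbs J l ks -> climbs J (flip l e) ks' ->
  exists f : relabeling edge,
    special_eq s (muts ks' ++ [:: Mut e]) (Iso f :: muts ks).
Proof.
have [n] := ubnP (height J l).
elim: n l s e ks ks' => // n IH l s e ks ks' le rl cv eJ c c'.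
have gl := rl.1; have T := good_triangulation gl; have ge := good_flip e gl.
have Te := good_triangulation ge; have cve := convex_flip T cv eJ.
have re := realizes_step (Mut e) rl.
case: (pselect (up l e)) => [ue|nue].
  exists (relab_id edge); apply: special_trans (special_id_cons _ _).
  rewrite -muts_rcons; apply: climbs_unique rl cv _ c; exact: climbs_rcons.
case: (boolP (None \in l e)) => [Ne|Ne].
  exists (relab_id edge); apply: special_trans (special_id_cons _ _).
  have ue := flip_down T Ne.
  have c2 : climbs J (flip l e) (rcons ks e).
    by apply: climbs_rcons => //; rewrite flipK.
  have := climbs_unique re cve c' c2.
  move/(special_catl (v := [:: Mut e]) (s := s)) => H.
  apply: special_trans H _; rewrite muts_rcons -catA.
  rewrite -[X in special_eq _ _ X]cats0; apply: special_catr; exact: special_mut.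
have [f fJ uf] := up_ex T cv eJ Ne.
have fe : f != e by apply/eqP => E; apply: nue; rewrite -E.
have ef : e != f by rewrite eq_sym.
have gf := good_flip f gl; have Tf := good_triangulation gf.
have cvf := convex_flip T cv fJ; have rf := realizes_step (Mut f) rl.
have lef : (height J (flip l f) < n)%N by exact: leq_trans (up_height T fJ uf) le.
case: (pselect (apart l e f)) => [ap|nap].
  have uf' := up_flip_apart T fe (apart_sym ap) uf.
  have [y cy] := climbs_ex gf cvf.
  have [y' cy'] := climbs_ex (good_flip f ge) (convex_flip Te cve fJ).
  have cy2 := cy'; rewrite (flip_comm gl fe (apart_sym ap)) in cy2.
  have [g Hg] := IH _ _ _ _ _ lef rf cvf eJ cy cy2.
  have K1 := climbs_unique rl cv c (climbs_rcons fJ uf cy).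
  have K2 := climbs_unique re cve c' (climbs_rcons fJ uf' cy').
  exists g; apply: special_trans (special_catl (v := [:: Mut e]) (s := s) K2) _.
  apply: special_trans (special_catr [:: Iso g] (special_sym K1)).
  rewrite !muts_rcons -catA.
  apply: special_trans (special_catr (muts y') (special_commute fe _)) _.
    by rewrite rl.2 apart_exch //; exact: apart_sym.
  have := special_catl (v := [:: Mut f]) (s := s) Hg.
  by rewrite -catA.
have H : succ l e f \/ succ l f e.
  by apply: contrapT => N; apply: nap; split=> ?; apply: N; [left | right].
have [u1 u2 u3 E] := pentagon_up gl uf Ne H.
have [y cy] := climbs_ex (good_flip e gf) (convex_flip Tf cvf eJ).
pose S := swp e f.
have SJ i : (unrelab S i \in J) = (i \in J).
  rewrite /= /swap_fun; case: (eqVneq i e) => [->|_]; first by rewrite eJ fJ.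
  by case: (eqVneq i f) => [->|//]; rewrite eJ fJ.
have := climbs_relabel (good_flip e gf) SJ cy; rewrite -E => cy'.
have K1 := climbs_unique rl cv c (climbs_rcons fJ uf (climbs_rcons eJ u3 cy)).
have K2 := climbs_unique re cve c' (climbs_rcons fJ u1 (climbs_rcons eJ u2 cy')).
exists S; apply: special_trans (special_catl (v := [:: Mut e]) (s := s) K2) _.
apply: special_trans (special_catr [:: Iso S] (special_sym K1)).
rewrite !muts_rcons -!catA /=.
have sef : s e f = 1 \/ s e f = -1.
  rewrite rl.2; case: H => H; [left | right]; first exact: succ_exch.
  exact: succ_exchN.
apply: special_trans (special_catr (muts (map S y)) (special_pentagon ef sef)) _.
have := special_catl (v := [:: Mut e; Mut f]) (s := s) (special_sym (special_iso_muts _ S y)).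
by rewrite -catA.
Qed.

Lemma convex_track J l ks : good l -> convex J l -> {subset ks <= J} ->
  convex J (track l (muts ks)).
Proof.
move=> gl cv; elim: ks => //= k ks IH sub.
apply: convex_flip; [exact/good_triangulation/good_track | | by apply: sub; rewrite inE eqxx].
by apply: IH => m mks; apply: sub; rewrite inE mks orbT.
Qed.

(** Iterates [climbs_move] over the letters of a word. *)
Lemma climbs_word J l s us ks ks' : realizes l s -> convex J l ->
  {subset us <= J} -> climbs J l ks -> climbs J (track l (muts us)) ks' ->
  exists f : relabeling edge,
    special_eq s (muts ks' ++ muts us) (Iso f :: muts ks).
Proof.
move=> rl cv; elim: us ks' => [|k us IH] ks' sub c c'.
  exists (relab_id edge); apply: special_trans (special_id_cons _ _).
  by rewrite cats0; exact: climbs_unique rl cv c' c.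
have kJ : k \in J by apply: sub; rewrite inE eqxx.
have {}sub : {subset us <= J} by move=> m mu; apply: sub; rewrite inE mu orbT.
have ru := realizes_run (muts us) rl; have cvu := convex_track rl.1 cv sub.
have [y cy] := climbs_ex ru.1 cvu; have [f Hf] := IH _ sub c cy.
have [g Hg] := climbs_move ru cvu kJ cy c'.
exists (relab_comp g f); rewrite -[muts (k :: us)]/([:: Mut k] ++ muts us) catA.
apply: special_trans (special_catl Hg) _.
apply: special_trans (special_catr [:: Iso g] Hf) _.
exact: (special_catl (v := muts ks) (special_iso_comp _ g f)).
Qed.

(** Relabellings can be moved to the left of mutations and then composed. *)
Lemma special_normal (w : word edge) s : exists (f : relabeling edge) ks,
  special_eq s w (Iso f :: muts ks).
Proof.
elim: w => [|x w [f [ks H]]].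
  by exists (relab_id edge), [::]; exact: special_id_cons.
have {}H := special_catr [:: x] H; case: x H => [k|g] H.
  exists f, (unrelab f k :: ks); apply: special_trans H _; apply: special_sym.
  have := special_iso_mut (run s (muts ks)) f (unrelab f k); rewrite unrelabK.
  exact: (special_catl (v := muts ks)).
exists (relab_comp g f), ks; apply: special_trans H _.
exact: (special_catl (v := muts ks) (special_iso_comp _ g f)).
Qed.

(** The edges separating infinity from the ends of given edges are finitely
    many, and adding all of them to [J] closes it up, because edges do not
    cross. *)
Lemma convex_ex (ks : seq edge) (A : set edge) : finite_set A ->
  exists J : seq edge, [/\ {subset ks <= J}, (forall E, A E -> E \in J) &
    convex J val].
Proof.
move=> fA.
pose K : set edge := A `|` [set` ks].
have fK : finite_set K by rewrite finite_setU; split=> //; exact: finite_seq.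
pose V := [set x | exists2 E, K E & x \in val E].
pose B := K `|` \bigcup_(x in V) [set E | separates E x None].
have fB : finite_set B.
  rewrite finite_setU; split=> //; apply: bigcup_finite; first exact: finite_ends.
  by move=> x _; exact: finite_separates.
have /finite_fsetP[X XE] := fB; exists X.
have inX E : E \in (X : seq edge) <-> B E by rewrite XE.
split=> [k kks|E AE|f nf a b Ef abN e /inX eB x xe].
- by apply/inX; left; right.
- by apply/inX; left; left.
apply/negP => axb; move/negP: nf; apply; apply/inX.
have ab : adj a b by apply/inC_val; exists f.
have sf y : V y -> ccw a y b -> B f.
  move=> Vy ayb; right; exists y => //=.
  by exists a, b; split; [exact: Ef | exact: ayb | cyc].
case: eB => [Ke|[y Vy [c [d [Ee cyd dNc]]]]]; first by apply: sf axb; exists e.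
apply: (sf y Vy); have cd : adj c d by apply/inC_val; exists e.
have dc : adj d c by rewrite adjC.
apply: contraT => nayb; exfalso; move: xe; rewrite Ee !inE => /orP[]/eqP E; subst x.
- have nd : ~~ ccw b d a by apply/negP => bda; exact: (adj_nocross ab cd axb bda).
  have := adj_neq cd; have := adj_neq ab => h1 h2; cyc.
- have nc : ~~ ccw b c a by apply/negP => bca; exact: (adj_nocross ab dc axb bca).
  have := adj_neq cd; have := adj_neq ab => h1 h2; cyc.
Qed.

(** Write [w] as mutations followed by one relabelling. The final
    triangulation differs from the initial one by a relabelling, so both
    climb to infinity by the same word up to relabelling. Hence [climbs_word]
    compares [w] with the trivial word, and the relabelling that is left over
    is determined by its effect on the final labels. *)
Lemma track_special w : track val w = val -> special_eq farey_seed w [::].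
Proof.
move=> tw; have rv := realizes_farey.
have [f [ks Hw]] := special_normal w farey_seed.
have tfk : track val (Iso f :: muts ks) = val.
  by rewrite -(special_track Hw rv).
have [J [sub _ cv]] := convex_ex ks (finite_set0 _).
have [u cu] := climbs_ex rv.1 cv; pose l1 := track val (muts ks).
have gl1 : good l1 := good_track (muts ks) rv.1; have T1 := good_triangulation gl1.
have l1f i : l1 (unrelab f i) = val i by rewrite -[in RHS]tfk.
have l1J i : i \notin J -> l1 i = val i.
  move=> iJ; rewrite /l1; elim: (ks) sub => //= k us IH sub'.
  have ik : i != k by apply: contraNneq iJ => ->; apply: sub'; rewrite inE eqxx.
  by rewrite flip_neq // IH // => m mu; apply: sub'; rewrite inE mu orbT.
have fJ i : i \notin J -> unrelab f i = i.
  by move=> iJ; apply: (tri_inj T1); rewrite l1f l1J.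
pose g := relab_inv f.
have gJ i : (unrelab g i \in J) = (i \in J).
  rewrite /=; apply/idP/idP => H; apply: contraT => nJ.
    by move: H; rewrite -{1}(fJ i nJ) unrelabK (negPf nJ).
  by have := fJ _ nJ; rewrite relabK => E; rewrite -E H in nJ.
have cu' := climbs_relabel rv.1 gJ cu.
have E1 : (fun i => val (unrelab g i)) = l1.
  by apply/funext => i; rewrite /= -l1f relabK.
rewrite E1 in cu'; have [p Hp] := climbs_word rv cv sub cu cu'.
have {}Hp : special_eq farey_seed ((Iso g :: muts u) ++ w) (Iso p :: muts u).
  apply: special_trans Hp.
  apply: special_trans (special_catl (special_iso_muts _ g u)) _; rewrite -catA.
  apply: special_catr; apply: special_trans (special_catr [:: Iso g] Hw) _.
  apply: special_trans (special_catl (v := muts ks) (special_iso_comp _ g f)) _.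
  by rewrite relab_compV; exact/special_sym/special_id_cons.
have E2 := special_track Hp rv; rewrite track_cat tw /= in E2.
have Tu := good_triangulation (good_track (muts u) rv.1).
have up_ x : unrelab g x = unrelab p x.
  by apply: (tri_inj Tu); exact: (f_equal (fun l => l x) E2).
have gp : g = p.
  apply: relab_ext => // x; rewrite -[RHS](unrelabK g) up_ relabK //.
rewrite -gp in Hp.
set v := Iso g :: muts u in Hp.
have := special_catr (winv v) Hp; rewrite catA => H.
apply: special_trans (special_trans H (special_winv _ _)).
exact/special_sym/(special_catl (u' := [::]))/special_winv.
Qed.

(** ** Every piecewise modular map comes from a word *)

Lemma track_linv l x : good l -> tstep (tstep l x) (linv x) = l.
Proof.
case: x => [k|f] gl /=; first exact: flipK.
by apply/funext => i; rewrite relabK.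
Qed.

Lemma track_winv l w : good l -> track (track l w) (winv w) = l.
Proof.
elim: w l => //= x w IH l gl.
rewrite /winv /= rev_cons -cats1 track_cat /= track_linv ?IH //.
exact: good_track.
Qed.

Lemma climbs_terminal J l ks : climbs J l ks ->
  terminal J (track l (muts ks)) /\
  forall i, i \notin J -> track l (muts ks) i = l i.
Proof.
elim=> {l ks} [l t|l k ks kJ _ _ [IH1 IH2]]; first by split.
rewrite muts_rcons track_cat; split=> // i iJ; rewrite IH2 //= flip_neq //.
by apply: contraNneq iJ => ->.
Qed.

(** Triangulations that agree outside the fan at infinity are equal: an edge of
    one that is missing in the other would cross one of its edges, but edges
    with a common end do not cross. *)
Lemma fan_sub y z : triangulation y -> triangulation z ->
  (forall i, (exists j, y i = z j) \/ None \in y i) ->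
  (forall j, (exists i, z j = y i) \/ None \in z j) ->
  forall i, exists j, y i = z j.
Proof.
move=> Ty Tz hy hz i; case: (hy i) => // Ni.
have [a [b [ab Ei]]] := tri_chord Ty i.
have yab : inC y a b by exists i.
apply: contrapT => nz; have [|c [d [[j Ej] H1 H2]]] := tri_maximal Tz ab.
  by move=> [j Ej]; apply: nz; exists j; rewrite Ei Ej.
case: (hz j) => [[i' Ei']|Nj].
  have ycd : inC y c d by exists i'; rewrite -Ei'.
  exact: (tri_nocross Ty ycd yab H1 H2).
move: Ni Nj; rewrite Ei Ej !inE => /orP[]/eqP E1 /orP[]/eqP E2; subst; cyc.
Qed.

(** The Farey triangulation and its image under [g] differ by finitely many
    chords. Climbing to infinity from both of them leads by [fan_sub] to the
    same chords with different labels, so that going up from the first,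
    relabelling and going down to the second takes [val] to its image. Since
    [g] preserves the cyclic order, the exchange matrix returns to itself. *)
Lemma word_of_map g : almost_modular g ->
  exists w, track val w = (fun i => img g (val i)) /\ run farey_seed w = farey_seed.
Proof.
move=> ag; have gb := almost_modular_cyclic ag.
case: (ag) => h [gh hg _ fg fh]; have gl := good_val.
pose lg (i : edge) := img g (val i).
have glg : good lg by exists g, id; split=> //; exists id.
have T := triangulation_farey; have Tg := good_triangulation glg.
have [J [_ AJ cv]] := convex_ex [::] fh.
pose N : set edge := [set i | ~ exists2 E, E \notin J & lg i = val E].
have fN : finite_set N.
  pose c (E : edge) : edge := xget E [set i | lg i = val E].
  apply: (@sub_finite_set _ _ (dev g `|` c @` [set` J])); last first.
    by rewrite finite_setU; split=> //; apply: finite_image; exact: finite_seq.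
  move=> i Ni; case: (pselect (dev g i)) => [|/contrapT[E EE]]; [by left | right].
  exists E => /=.
    by apply: contrapT => /negP nE; apply: Ni; exists E.
  rewrite /c; case: xgetP => [j _ /= Ej|/(_ i)//].
  by apply: (tri_inj Tg); rewrite Ej -EE.
have /finite_fsetP[X XE] := fN; pose Jg : seq edge := X.
have inJg i : i \in Jg <-> N i by rewrite XE.
have ninJg i : i \notin Jg -> exists2 E, E \notin J & lg i = val E.
  by move=> /negP H; apply: contrapT => NN; apply: H; apply/inJg.
have cvg : convex Jg lg.
  move=> f /ninJg[E EJ fE] a b Ef abN e /inJg eN x xe.
  have EE : val E = [fset a; b]%fset by rewrite -fE.
  have cE := cv E EJ a b EE abN.
  case: (pselect (dev g e)) => [De|/contrapT[E' eE']]; last first.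
    apply: (cE E'); last by rewrite -eE'.
    by apply: contraT => nE'; case: eN; exists E'.
  have [c [d [cd ed]]] := tri_chord Tg e.
  have ncd : ~~ adj c d.
    by apply/negP => /edge_ex[K KE]; apply: De; exists K; rewrite KE.
  have [p [q [pq pcq qdp]]] := adj_maximal cd ncd.
  have [K KE] := edge_ex pq.
  have lcd : inC lg c d by exists e.
  have KJ : K \in J.
    apply: AJ => -[F FE]; apply: (@tri_nocross _ Tg p q c d) => //.
    by exists F; rewrite -KE -(imgK hg (val K)) FE.
  have np : ~~ ccw a p b by apply: (cE K) => //; rewrite KE !inE eqxx.
  have nq : ~~ ccw a q b by apply: (cE K) => //; rewrite KE !inE eqxx orbT.
  have lab : inC lg a b by exists f.
  have npq := adj_neq pq.
  apply/negP => axb; move: xe; rewrite ed !inE => /orP[]/eqP E1; subst x.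
    have nd : ~~ ccw b d a.
      by apply/negP => bda; exact: (tri_nocross Tg lab lcd axb bda).
    by cyc.
  have nc : ~~ ccw b c a.
    by apply/negP => bca; exact: (tri_nocross Tg lab (inC_sym lcd) axb bca).
  by cyc.
have [u cu] := climbs_ex gl cv; have [u' cu'] := climbs_ex glg cvg.
have [ty oy] := climbs_terminal cu; have [tz oz] := climbs_terminal cu'.
set y := track val _ in ty oy; set z := track lg _ in tz oz.
have gy : good y := good_track _ gl; have gz : good z := good_track _ glg.
have Ty := good_triangulation gy; have Tz := good_triangulation gz.
have hy i : (exists j, y i = z j) \/ None \in y i.
  case: (boolP (i \in J)) => [/ty|iJ]; [by right | left].
  have [m mE] : exists m, lg m = val i.
    have [|m mE] := contrapT (_ : ~ dev h i); first by move/AJ; apply/negP.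
    by exists m; rewrite /lg -mE imgK.
  exists m; rewrite oy // oz ?mE //.
  by apply/negP => /inJg; apply; exists i.
have hz j : (exists i, z j = y i) \/ None \in z j.
  case: (boolP (j \in Jg)) => [/tz|jJ]; [by right | left].
  by have [E EJ jE] := ninJg j jJ; exists E; rewrite oy // oz // jE.
have /choice[r rE] := fan_sub Ty Tz hy hz.
have /choice[r' r'E] := fan_sub Tz Ty hz hy.
have rr' : cancel r r' by move=> i; apply: (tri_inj Ty); rewrite -r'E -rE.
have r'r : cancel r' r by move=> i; apply: (tri_inj Tz); rewrite -rE -r'E.
pose w := winv (muts u') ++ (Iso (Relabeling rr' r'r) :: muts u).
have tw : track val w = lg.
  rewrite track_cat -[RHS](track_winv (muts u') glg); congr track.
  by apply/funext => j /=; rewrite -/y -/z -r'E.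
exists w; split=> //; have [_ rw] := realizes_run w realizes_farey.
apply: seed_ext => i j; rewrite rw tw -[RHS]/(farey_exch i j).
have idb : bijective (@id edge) by exists id.
by rewrite /lg (exch_of_img val i j gb idb) -farey_exchE.
Qed.

(** * Loops and piecewise modular maps *)

(** Three edges that follow each other cyclically bound a triangle: the other
    possibility is a common vertex, where they would have to turn around. *)
Lemma succ_cycle l i j k : succ l i j -> succ l j k -> succ l k i ->
  exists a b c, [/\ ccw a b c, l i = [fset a; b]%fset, l j = [fset b; c]%fset
    & l k = [fset c; a]%fset].
Proof.
move=> [a [b [c [abc Ei Ej _]]]] [a2 [b2 [c2 [abc2 Ej2 Ek2 _]]]].
move=> [a3 [b3 [c3 [abc3 Ek3 Ei3 _]]]].
rewrite Ej in Ej2; rewrite Ek2 in Ek3; rewrite Ei in Ei3.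
case: (fset2_eq Ej2) => -[e1 e2]; subst a2 b2.
- exists a, b, c; split=> //; rewrite Ek2; congr [fset _; _]%fset.
  case: (fset2_eq Ek3) => -[e1 e2]; subst a3 b3.
    by case: (fset2_eq Ei3) => -[e3 e4]; subst => //; exfalso; cyc.
  by case: (fset2_eq Ei3) => -[e3 e4]; subst => //; exfalso; cyc.
- exfalso; case: (fset2_eq Ek3) => -[e1 e2]; subst a3 b3;
    by case: (fset2_eq Ei3) => -[e3 e4]; subst; cyc.
Qed.

Lemma apex_eq a b c c' : adj a b -> ccw a b c -> adj b c -> adj c a ->
  ccw a b c' -> adj b c' -> adj c' a -> c = c'.
Proof.
by move=> ab ? ? ? ? ? ?; rewrite (@apex_uniq a b c) // (@apex_uniq a b c').
Qed.

Lemma val_succ (E F : edge) a b c : ccw a b c -> val E = [fset a; b]%fset ->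
  val F = [fset b; c]%fset -> adj c a -> succ val E F.
Proof. by move=> abc EE FE ca; exists a, b, c; split=> //; apply/inC_val. Qed.

Lemma side_cases a b c (E : edge) :
  (forall u, u \in val E -> u \in [fset a; b; c]%fset) ->
  [\/ val E = [fset a; b]%fset, val E = [fset b; c]%fset
    | val E = [fset c; a]%fset].
Proof.
have [u [v [EE uv]]] := edgeP E; have nuv := adj_neq uv => sub.
have := sub u; have := sub v; rewrite EE !mem_fset3 !inE !eqxx orbT.
move: nuv => /[swap] /(_ isT)/or3P[]/eqP-> /[swap] /(_ isT)/or3P[]/eqP->;
  rewrite ?eqxx // => _; by [constructor 1 | constructor 2 | constructor 3
  | constructor 1; exact: fset2C | constructor 2; exact: fset2C
  | constructor 3; exact: fset2C].
Qed.

(** Automorphisms of the exchange matrix of the Farey seed are modular: they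
    map triangles to triangles preserving orientation, so they are determined
    by the image of one triangle. *)
Lemma farey_aut (f : edge -> edge) : bijective f ->
  (forall i j, exch_of val (f i) (f j) = exch_of val i j) ->
  exists M, \det M = 1 /\ forall E, val (f E) = img (mobz M) (val E).
Proof.
move=> fb fe; have fi := bij_inj fb.
have fs i j : succ val i j -> succ val (f i) (f j).
  by move=> H; apply: exch_succ; rewrite fe succ_exch.
have cyc3 E1 E2 E3 a b c : ccw a b c -> val E1 = [fset a; b]%fset ->
    val E2 = [fset b; c]%fset -> val E3 = [fset c; a]%fset -> exists x y z,
    [/\ ccw x y z, val (f E1) = [fset x; y]%fset, val (f E2) = [fset y; z]%fset &
        val (f E3) = [fset z; x]%fset].
  move=> abc e1 e2 e3.
  have [ab bc ca] : [/\ adj a b, adj b c & adj c a].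
    by split; apply/inC_val; [exists E1 | exists E2 | exists E3].
  apply: succ_cycle; apply: fs; [apply: (val_succ abc) => // | |].
    by apply: (@val_succ _ _ b c a) => //; cyc.
  by apply: (@val_succ _ _ c a b) => //; cyc.
have [c1 _ _ _] := ccw_z.
have [a01 a1i ai0] : [/\ adj (Some 0) (Some 1), adj (Some 1) None & adj None (Some 0)].
  by vm_compute.
have [E1 e1] := edge_ex a01; have [E2 e2] := edge_ex a1i; have [E3 e3] := edge_ex ai0.
have [x [y [z [xyz f1 f2 f3]]]] := cyc3 _ _ _ _ _ _ c1 e1 e2 e3.
have [xy yz zx] : [/\ adj x y, adj y z & adj z x].
  by split; apply/inC_val; [exists (f E1) | exists (f E2) | exists (f E3)].
have [M [D M0 M1]] := mobz_edge a01 xy; exists M; split=> //.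
have Mz : mobz M None = z.
  by apply: (apex_eq xy) => //; rewrite -?M0 -?M1 ?mobz_ccw ?mobz_adj.
suff main t : farey_triangle t -> forall E : edge,
    (forall u, u \in val E -> u \in t) -> val (f E) = img (mobz M) (val E).
  move=> E; have [a [b [EE ab]]] := edgeP E; have [_ bc ca] := apex_spec ab.
  apply: main (farey_triangleI ab bc ca) _ _ => u.
  by rewrite EE mem_fset3 !inE => /orP[]->; rewrite ?orbT.
elim=> {t} [E sub|a b c ft IH E sub].
  case: (side_cases sub) => EE; rewrite EE img2.
  - by rewrite (val_inj (etrans EE (esym e1))) f1 M0 M1.
  - by rewrite (val_inj (etrans EE (esym e2))) f2 M1 Mz.
  - by rewrite (val_inj (etrans EE (esym e3))) f3 Mz M0.
have [ab bc ca] := (farey_triangleE a b c).1 ft.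
have [bd da o] := reflection_spec ab bc ca; set d := reflection a b c in bd da o sub; clearbody d.
have main a' b' : ccw a' b' d -> ccw b' a' c -> adj a' b' -> adj b' c -> adj c a' ->
    adj b' d -> adj d a' ->
    (forall F : edge, (forall u, u \in val F -> u \in [fset a'; b'; c]%fset) ->
       val (f F) = img (mobz M) (val F)) ->
    (forall u, u \in val E -> u \in [fset a'; b'; d]%fset) ->
    val (f E) = img (mobz M) (val E).
  move=> {a b ft ab bc ca bd da o IH sub} abd bac ab bc ca bd da IH sub.
  have [F1 g1] := edge_ex ab; have [F2 g2] := edge_ex bd; have [F3 g3] := edge_ex da.
  have [F4 g4] := edge_ex (etrans (adjC a' c) ca).
  have [u [v [w [uvw h1 h2 h3]]]] := cyc3 _ _ _ _ _ _ abd g1 g2 g3.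
  have uv : adj u v by apply/inC_val; exists (f F1).
  have vw : adj v w by apply/inC_val; exists (f F2).
  have wu : adj w u by apply/inC_val; exists (f F3).
  have H1 : val (f F1) = [fset mobz M a'; mobz M b']%fset.
    rewrite IH ?g1 ?img2 // => t; rewrite mem_fset3 !inE => /orP[]->; by rewrite ?orbT.
  have H4 : val (f F4) = [fset mobz M a'; mobz M c]%fset.
    rewrite IH ?g4 ?img2 // => t; rewrite mem_fset3 !inE => /orP[]->; by rewrite ?orbT.
  rewrite h1 in H1; case: (fset2_eq H1) => -[eu ev]; last first.
    have we : w = mobz M c.
      by apply: (apex_eq uv) => //; rewrite ?eu ?ev ?mobz_ccw ?mobz_adj // adjC.
    have : f F2 = f F4 by apply: val_inj; rewrite h2 H4 ev we.
    move=> /fi F24; have := congr1 (fun F : edge => val F) F24; rewrite g2 g4.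
    move: (adj_neq ab) (adj_neq bc) => n1 n2 /fset2_eq[] [e4 _].
      by rewrite -e4 eqxx in n1.
    by rewrite e4 eqxx in n2.
  have we : w = mobz M d.
    by apply: (apex_eq uv) => //; rewrite ?eu ?ev ?mobz_ccw ?mobz_adj.
  case: (side_cases sub) => EE; rewrite EE img2.
  - by rewrite (val_inj (etrans EE (esym g1))) h1 eu ev.
  - by rewrite (val_inj (etrans EE (esym g2))) h2 ev we.
  - by rewrite (val_inj (etrans EE (esym g3))) h3 we eu.
have nabc := (adj_neq ab, adj_neq bc, adj_neq ca).
case: (boolP (ccw a b c)) o => abc /= o.
  apply: (main b a) => //; try by rewrite adjC.
  - move/negbT: o => o.
    by move: nabc (adj_neq bd) (adj_neq da) => [[n1 n2] n3] n4 n5; cyc.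
  - by move=> F sF; apply: IH => u /sF; rewrite fset3_swap.
  - by move=> u /sub; rewrite fset3_swap.
apply: (main a b) => //.
by move: nabc => [[n1 n2] n3]; cyc.
Qed.

Lemma neighbour x : exists y, adj x y.
Proof.
have [[u v] /= uv] := coprimezP _ _ (coprime_nd x).
have H : - v * den x - num x * u = 1 \/ - v * den x - num x * u = -1 by right; lia.
have [e e1 [En Ed]] := ptz_adj H; exists (ptz (- v) u); apply: adjPn.
by rewrite /dt En Ed; case: e1 => ->; [left | right]; lia.
Qed.

Lemma fix_edges k : (forall E : edge, img k (val E) = val E) -> k =1 id.
Proof.
move=> H x; have [y xy] := neighbour x; have [cw yz zx] := apex_spec xy.
have [E EE] := edge_ex xy; have [F FE] := edge_ex zx.
have := H E; have := H F; rewrite EE FE !img2 => HF HE.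
have : k x \in [fset x; y]%fset by rewrite -HE !inE eqxx.
have : k x \in [fset apex x y; x]%fset by rewrite -HF !inE eqxx orbT.
rewrite !inE => /orP[]/eqP // kx /orP[]/eqP // ky; have := adj_neq yz.
by rewrite -kx -ky eqxx.
Qed.

(** The piecewise modular map that carries the final triangulation of a loop
    back to the Farey triangulation. *)
Definition returns (w : word edge) (h : P1Q -> P1Q) : Prop :=
  almost_modular h /\ forall E, img h (track val w E) = val E.

(** The final triangulation is the image of the relabelled Farey
    triangulation under an almost modular map. As the exchange matrix has
    returned to itself, the relabelling is one of its automorphisms, hence
    modular by [farey_aut]. *)
Lemma returns_ex w : run farey_seed w = farey_seed -> exists h, returns w h.
Proof.
move=> rw; have [[g [f [ag fb lE]]] sE] := realizes_run w realizes_farey.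
have [i j|M [D ME]] := farey_aut fb.
  have gb := almost_modular_cyclic ag.
  rewrite -(exch_of_img val i j gb fb) -(funext lE) -sE rw.
  exact: farey_exchE.
have agM : almost_modular (g \o mobz M).
  exact: almost_modular_comp ag (almost_modular_mobz D).
have [h [gh hg _ _ _]] := agM; exists h; split.
  exact: almost_modular_inv agM gh hg.
by move=> E; rewrite lE ME -img_comp imgK.
Qed.

Lemma returns_uniq w h h' : returns w h -> returns w h' -> h = h'.
Proof.
move=> [[g [hg gh _ _ _]] H] [[g' [hg' gh' _ _ _]] H'].
have K : h' \o g =1 id.
  apply: fix_edges => E; rewrite img_comp.
  by have -> : img g (val E) = track val w E by rewrite -(H E) (imgK hg).
by apply/funext => x; rewrite -[LHS](K (h x)) /= hg.
Qed.

(** By [track_img], the effect of [u] is transported by the bijection that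
    records the effect of [v]. *)
Lemma returns_cat u v h h' : returns u h -> returns v h' -> returns (u ++ v) (h \o h').
Proof.
move=> [ah H] [ah' H']; split; first exact: almost_modular_comp.
move=> E; have [g [hg gh hb _ _]] := ah'.
have gb : cyclic_bij g by exact: cyclic_bij_inv hb hg gh.
have Ev : track val v = fun E => img g (val E).
  by apply/funext => F; rewrite -(H' F) imgK.
by rewrite track_cat Ev (track_img _ gb good_val) img_comp (imgK gh) H.
Qed.

(** * Cluster coordinates *)

Section Monomials.
Variables (I : choiceType) (R : realFieldType).
Implicit Types (s : seed I) (A : I -> R) (D : seq I) (i j k : I).

(** The monomial map [p] from A-coordinates to X-coordinates; exchange
    matrices here have finite rows, so the products are finite. *)
Definition Xmap s A (i : I) : R := \big[*%R/1]_(j \in [set: I]) A j ^ s i j.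

Definition covers_row D s i : Prop := forall j, s i j != 0 -> j \in D.

Lemma XmapE s A i D : uniq D -> covers_row D s i ->
  Xmap s A i = \prod_(j <- D) A j ^ s i j.
Proof.
move=> uD cD; rewrite /Xmap (fsbigE D) //; last first.
  by move=> j _ jD; case: (eqVneq (s i j) 0) => [->|/cD] //; rewrite (negPf jD).
by apply: eq_bigl => j; rewrite in_setT.
Qed.

Lemma fsprod_cond (P : pred I) A (e : I -> int) D : uniq D ->
  (forall j, P j -> j \in D) ->
  \big[*%R/1]_(j \in [set j | P j]) A j ^ e j = \prod_(j <- D | P j) A j ^ e j.
Proof.
move=> uD cD; rewrite -[in RHS]big_filter [RHS]fsbig_seq ?filter_uniq //.
congr (\big[_/_]_(j \in _) _); apply/seteqP; split=> j /=.
  by move=> Pj; rewrite mem_filter Pj cD.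
by rewrite mem_filter => /andP[].
Qed.

Definition posp (z : int) : int := if 0 < z then z else 0.

Lemma prod_posp D A (e : I -> int) :
  \prod_(j <- D | 0 < e j) A j ^ e j = \prod_(j <- D) A j ^ posp (e j).
Proof. by rewrite big_mkcond; apply: eq_bigr => j _; rewrite /posp; case: ifP. Qed.

Lemma prod_exprz D (P : pred I) (F : I -> R) (z : int) :
  \prod_(j <- D | P j) (F j ^ z) = (\prod_(j <- D | P j) F j) ^ z.
Proof.
apply/esym; apply: (big_morph (fun x => x ^ z)); last by rewrite exp1rz.
by move=> x y; exact: expfzMl.
Qed.

Lemma prod_gt0 D (P : pred I) A (e : I -> int) : (forall i, 0 < A i) ->
  0 < \prod_(j <- D | P j) A j ^ e j.
Proof. by move=> A0; apply: prodr_gt0 => j _; rewrite exprz_gt0. Qed.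

Lemma mutate_posp s k i j : j != k -> i != k ->
  mutate_exch s k i j =
  s i j + s i k * posp (if 0 < s i k then s k j else - s k j).
Proof.
move=> jk ik; rewrite /mutate_exch (negPf ik) (negPf jk) /=.
move: (s i k) (s k j) (s i j) => e x y; rewrite /posp.
case: (ltrgt0P e) => e0.
- rewrite pmulr_rle0 //; case: (ltrP 0 x) => x0 //=.
  by rewrite mulr0 addr0.
- rewrite nmulr_rle0 // oppr_gt0; case: (ltrP x 0) => x0 //=.
    by rewrite mulrN mulNr.
  by rewrite mulr0 addr0.
- by rewrite e0 !mul0r lexx addr0.
Qed.

(** Let [Pp] and [Pn] be the two monomials of the exchange relation. Then
    [X_k = Pp / Pn] and [A'_k = (Pp + Pn) / A_k], so that [1 + X_k] or its
    analogue with the inverse is [Pp + Pn] divided by one of the monomials,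
    which is the one that the mutation of the exponents [s i j] brings in. *)
Lemma Xmap_mutate s k A i D : uniq D -> k \in D -> covers_row D s i ->
  covers_row D s k -> (forall j, 0 < A j) ->
  stepX s (Mut k) (Xmap s A) i = Xmap (mutate s k) (stepA s (Mut k) A) i.
Proof.
move=> uD kD ci ck A0 /=.
have An j : A j != 0 by rewrite gt_eqF.
pose Pp := \prod_(j <- D) A j ^ posp (s k j).
pose Pn := \prod_(j <- D) A j ^ posp (- s k j).
have Pp0 : 0 < Pp by exact: prod_gt0.
have Pn0 : 0 < Pn by exact: prod_gt0.
have S0 : Pp + Pn != 0 by rewrite gt_eqF // addr_gt0.
have skk : s k k = 0 by exact: exch_diag.
have Xk : Xmap s A k = Pp / Pn.
  rewrite (XmapE A uD ck) -prodf_div; apply: eq_bigr => j _.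
  rewrite invr_expz -expfzDr // /posp; congr (_ ^ _).
  by move: (s k j) => x; do 2!case: ifP; lia.
have EA : \big[*%R/1]_(j \in [set j | 0 < s k j]) A j ^ s k j +
    \big[*%R/1]_(j \in [set j | s k j < 0]) A j ^ (- s k j) = Pp + Pn.
  congr (_ + _).
    rewrite (@fsprod_cond (fun j => 0 < s k j) _ _ D) ?prod_posp //.
    by move=> j sj; apply: ck; rewrite gt_eqF.
  have -> : [set j | s k j < 0] = [set j | 0 < - s k j].
    by apply/seteqP; split=> j /=; rewrite oppr_gt0.
  rewrite (@fsprod_cond (fun j => 0 < - s k j) A (fun j => - s k j) D) ?prod_posp //.
  by move=> j; rewrite oppr_gt0 => sj; apply: ck; rewrite lt_eqF.
rewrite EA.
have skD : covers_row D (mutate s k) i.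
  move=> j /=; rewrite /mutate_exch.
  case: (eqVneq i k) => [->|_] /=; first by rewrite oppr_eq0; exact: ck.
  case: (eqVneq j k) => [->//|_]; case: ifP => _ H; first exact: ci.
  case: (eqVneq (s i j) 0) => [E|]; last exact: ci.
  by apply: ck; apply: contraNneq H => ->; rewrite E mulr0 addr0.
rewrite (XmapE _ uD skD).
case: (eqVneq i k) => [->|ik].
  rewrite (XmapE A uD ck) -prodfV; apply: eq_bigr => j _ /=.
  rewrite /mutate_exch eqxx /= -invr_expz.
  by case: (eqVneq j k) => [->|//]; rewrite skk ?oppr0 !expr0z ?invr1.
have Ei : Xmap s A i = A k ^ s i k * \prod_(j <- D | j != k) A j ^ s i j.
  by rewrite (XmapE A uD ci) (bigD1_seq k).
rewrite (bigD1_seq k) //= /mutate_exch /= eqxx orbT.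
have -> : \prod_(j <- D | j != k) (if j == k then (Pp + Pn) / A k else A j) ^
      (if (i == k) || (j == k) then - s i j
       else if s i k * s k j <= 0 then s i j else s i j + `|s i k| * s k j) =
    \prod_(j <- D | j != k) A j ^ s i j *
    (if 0 < s i k then Pp else Pn) ^ s i k.
  have -> : (if 0 < s i k then Pp else Pn) =
      \prod_(j <- D | j != k) A j ^ posp (if 0 < s i k then s k j else - s k j).
    by case: ifP => _; rewrite /Pp /Pn (bigD1_seq k) //= skk ?oppr0 expr0z mul1r.
  rewrite -prod_exprz -big_split; apply: eq_bigr => j jk /=.
  have := mutate_posp s jk ik; rewrite /mutate_exch (negPf jk) (negPf ik) => ->.
  by rewrite expfzDr // exprz_exp [posp _ * _]mulrC.
rewrite Ei Xk; move: (s i k) (\prod_(j <- D | j != k) _) => e Q.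
have -> : (1 + (Pp / Pn) ^ (- sgz e)) ^ (- e) =
    ((Pp + Pn) / (if 0 < e then Pp else Pn)) ^ (- e).
  case: (ltrgt0P e) => e0; last by rewrite e0 oppr0 !expr0z.
    rewrite gtr0_sgz // exprN1 invf_div mulrDl divff //.
    by rewrite gt_eqF.
  rewrite ltr0_sgz // opprK expr1z mulrDl divff ?gt_eqF //.
  by rewrite addrC.
rewrite !expfzMl !exprz_inv opprK.
by move: (A k ^ e) (_ ^ e) (_ ^ (- e)) => x y z; lra.
Qed.

End Monomials.

(** ** Lambda lengths *)

Lemma quad_row l s k a b c d p q r t : realizes l s ->
  quad_sides l k a b c d p q r t ->
  [/\ s k p = 1, s k q = -1, s k r = 1 & s k t = -1] /\
  covers_row [:: p; q; r; t] s k.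
Proof.
move=> [/good_triangulation T E] Q.
have L := quad_succl T _ Q; have M := quad_succr T _ Q.
have [_ [pq pr pt [qr qt rt]]] := quad_sides_neq Q.
have val1 j : succ l k j -> s k j = 1.
  move=> H; rewrite E /exch_of asboolT // asboolF //.
  exact: succ_asym.
have val2 j : succ l j k -> s k j = -1.
  move=> H; rewrite E /exch_of asboolF ?asboolT //.
  by move=> H'; exact: succ_asym H' H.
split; first by split; [apply: val1|apply: val2|apply: val1|apply: val2];
  (apply/L || apply/M); by [left | right].
move=> j; rewrite E /exch_of !inE.
case: asboolP => [/L[->|->]|_]; rewrite ?eqxx ?orbT //.
by case: asboolP => [/M[->|->]|_]; rewrite ?eqxx ?orbT.
Qed.

Lemma uniq_sides l k a b c d p q r t : quad_sides l k a b c d p q r t ->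
  uniq [:: p; q; r; t].
Proof.
move=> Q; have [_ [pq pr pt [qr qt rt]]] := quad_sides_neq Q.
by rewrite /= !inE !negb_or pq pr pt qr qt rt.
Qed.

Section Action.
Variable R : realFieldType.
Implicit Types (V : P1Q -> 'cV[R]_2) (x : edge -> R) (l : edge -> {fset P1Q}).

(** The lambda length of the geodesic from [a] to [b] for the decoration by
    the vectors [V]. *)
Definition lam V (a b : P1Q) : R := `|wedge (V a) (V b)|.

Lemma lamC V a b : lam V a b = lam V b a.
Proof. by rewrite /lam wedgeC normrN. Qed.

Definition oriented V : Prop :=
  forall a b c, ccw a b c -> 0 < orient (V a) (V b) (V c).

Definition coords V l x : Prop :=
  forall i a b, l i = [fset a; b]%fset -> x i = lam V a b.

Lemma lam_gt0 V a b : oriented V -> a != b -> 0 < lam V a b.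
Proof.
move=> oV ab; rewrite normr_gt0.
have [z za zb] : exists2 z : P1Q, z != a & z != b.
  case: (boolP ((None != a) && (None != b))) => [/andP[]|]; first by exists None.
  case: (boolP ((Some 0 != a) && (Some 0 != b))) => [/andP[]|]; first by exists (Some 0).
  rewrite !negb_and !negbK => /orP[]/eqP <- /orP[]/eqP // E; exists (Some 1) => //;
    by rewrite -E.
apply/eqP => E; have /orP[H|H] : ccw a b z || ccw b a z by cyc.
  by have := oV _ _ _ H; rewrite /orient E !mul0r ltxx.
by have := oV _ _ _ H; rewrite /orient wedgeC E oppr0 !mul0r ltxx.
Qed.

Lemma lam_ptolemy V a b c d : oriented V -> ccw a b c -> ccw c d a ->
  lam V a c * lam V b d = lam V a b * lam V c d + lam V b c * lam V d a.
Proof.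
move=> oV abc cda; rewrite [lam V d a]lamC; apply: ptolemy; first exact: oV.
by apply: oV; cyc.
Qed.

Lemma Xmap_quad l s k x a b c d p q r t : realizes l s ->
  quad_sides l k a b c d p q r t -> Xmap s x k = x p * x r / (x q * x t).
Proof.
move=> rl Q; have [[e1 e2 e3 e4] cD] := quad_row rl Q.
rewrite (XmapE x (uniq_sides Q) cD) !big_cons big_nil e1 e2 e3 e4.
by rewrite !exprN1 !expr1z invfM mulr1; move: (x q)^-1 (x t)^-1 => y z; lra.
Qed.

(** The exchange relation is Ptolemy's relation for the quadrilateral that is
    flipped. *)
Lemma coords_step V l s x w : oriented V -> realizes l s -> coords V l x ->
  coords V (tstep l w) (stepA s w x).
Proof.
move=> oV rl H; case: w => [k|f]; last by move=> i a b /= /H.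
have T := good_triangulation rl.1.
have [a [b [c [d Q]]]] := quad_ex T k; have [p [q [r [t S]]]] := quad_sides_ex Q.
have [[e1 e2 e3 e4] cD] := quad_row rl S; have uD := uniq_sides S.
have [Ek abc cda _] := Q; have [_ Ep Eq Er Et] := S.
have ac : a != c by cyc.
move=> i y z /=; case: (eqVneq i k) => [->|ik]; last first.
  by rewrite flip_neq // => /H.
rewrite (flipE T Q) => E; have {E} -> : lam V y z = lam V b d.
  by case: (fset2_eq E) => -[-> ->] //; rewrite lamC.
rewrite (@fsprod_cond _ _ (fun j => 0 < s k j) _ _ [:: p; q; r; t]) //; last first.
  by move=> j sj; apply: cD; rewrite gt_eqF.
have -> : [set j | s k j < 0] = [set j | 0 < - s k j].
  by apply/seteqP; split=> j /=; rewrite oppr_gt0.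
rewrite (@fsprod_cond _ _ (fun j => 0 < - s k j) x (fun j => - s k j) [:: p; q; r; t]) //;
  last by move=> j; rewrite oppr_gt0 => sj; apply: cD; rewrite lt_eqF.
rewrite !big_cons !big_nil e1 e2 e3 e4 /= !expr1z !mulr1.
rewrite (H _ _ _ Ek) (H _ _ _ Ep) (H _ _ _ Eq) (H _ _ _ Er) (H _ _ _ Et).
by rewrite -lam_ptolemy // mulrAC divff ?mul1r // gt_eqF // lam_gt0.
Qed.

Lemma coords_act V l s x w : oriented V -> realizes l s -> coords V l x ->
  coords V (track l w) (actA s w x).
Proof.
move=> oV rl H; elim: w => //= y w IH; apply: coords_step => //.
exact: realizes_run.
Qed.

Lemma Xmap_act l s w x : realizes l s -> (forall i, 0 < x i) ->
  actX s w (Xmap s x) = Xmap (run s w) (actA s w x).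
Proof.
move=> rl x0; elim: w => // y w IH.
rewrite -[LHS]/(stepX (run s w) y (actX s w (Xmap s x))) IH.
rewrite -[RHS]/(Xmap (step (run s w) y) (stepA (run s w) y (actA s w x))).
have rw := realizes_run w rl; have T := good_triangulation rw.1.
have A0 : forall i, 0 < actA s w x i by exact: act_gt0 (@pos_stepA _ _) x0.
move: (run s w) (actA s w x) (track l w) rw T A0 => {IH rl x0}s {}x {}l rl T x0.
apply/funext => i; case: y => [k|f].
  have [a [b [c [d Q]]]] := quad_ex T i; have [p [q [r [t S]]]] := quad_sides_ex Q.
  have [a' [b' [c' [d' Q']]]] := quad_ex T k.
  have [p' [q' [r' [t' S']]]] := quad_sides_ex Q'.
  have [_ c1] := quad_row rl S; have [_ c2] := quad_row rl S'.
  pose D := undup (k :: [:: p; q; r; t] ++ [:: p'; q'; r'; t']).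
  have D1 j : (j \in D) = [|| j == k, j \in [:: p; q; r; t] | j \in [:: p'; q'; r'; t']].
    by rewrite mem_undup inE mem_cat.
  apply: (@Xmap_mutate _ _ s k x i D) => //; first exact: undup_uniq.
  - by rewrite D1 eqxx.
  - by move=> j /c1 H; rewrite D1 H orbT.
  - by move=> j /c2 H; rewrite D1 H !orbT.
by rewrite /= /Xmap [LHS](@reindex_fsbigT _ _ _ _ _ (unrelab f) _ (unrelab_bij f)).
Qed.

End Action.

(** * Developing coordinates into the plane *)

Definition det1 (p q : nat * nat) : Prop := (p.1 * q.2 = p.2 * q.1 + 1)%N.
Definition padd (p q : nat * nat) : nat * nat := (p.1 + q.1, p.2 + q.2)%N.

(** The Euclidean algorithm on unimodular pairs of vectors in the quadrant. *)
Lemma det1_ind (P : nat * nat -> nat * nat -> Prop) : P (1, 0)%N (0, 1)%N ->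
  (forall p q, det1 p q -> P p q -> P (padd p q) q) ->
  (forall p q, det1 p q -> P p q -> P p (padd p q)) ->
  forall p q, det1 p q -> P p q.
Proof.
move=> P0 Pl Pr p q; have [n] := ubnP (p.1 + p.2 + q.1 + q.2)%N.
elim: n p q => // n IH [i j] [i' j']; rewrite /det1 /= => lt D.
have [|] := boolP ((i' <= i) && (j' <= j))%N => [/andP[h1 h2]|h].
  have E : padd (i - i', j - j')%N (i', j') = (i, j) by congr pair => /=; lia.
  have D' : det1 (i - i', j - j')%N (i', j') by rewrite /det1 /=; nia.
  rewrite -E; apply: Pl => //; apply: IH => //=.
  have : (i' + j' <> 0)%N by move=> K; nia.
  by lia.
have [|] := boolP ((i <= i') && (j <= j'))%N => [/andP[h1 h2]|h'].
  have E : padd (i, j) (i' - i, j' - j)%N = (i', j') by congr pair => /=; lia.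
  have D' : det1 (i, j) (i' - i, j' - j)%N by rewrite /det1 /=; nia.
  rewrite -E; apply: Pr => //; apply: IH => //=.
  have : (i + j <> 0)%N by move=> K; nia.
  by lia.
have [e1 e2 e3 e4] : [/\ i = 1, j = 0, i' = 0 & j' = 1]%N.
  by split; move: h h' D; clear; nia.
by rewrite e1 e2 e3 e4.
Qed.

Section Stern.
Variable R : realFieldType.
Variables cs ct : nat * nat -> nat * nat -> 'cV[R]_2 -> 'cV[R]_2 -> 'cV[R]_2 -> R.

(** A node of the Stern-Brocot tree: the pair [nu], [nv] of neighbours, the
    vectors [na], [nb] placed over them, and the vector [nd] over the point
    opposite to their mediant. The vector over the mediant is a positive
    combination [nc] of [na] and [nb], with weights that may depend on all
    these data. *)
Record node := Node {
  nu : nat * nat; nv : nat * nat;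
  na : 'cV[R]_2; nb : 'cV[R]_2; nd : 'cV[R]_2 }.

Definition wl S := cs (nu S) (nv S) (na S) (nb S) (nd S).
Definition wr S := ct (nu S) (nv S) (na S) (nb S) (nd S).
Definition nc S := wl S *: na S + wr S *: nb S.
Definition goleft S := Node (nu S) (padd (nu S) (nv S)) (na S) (nc S) (nb S).
Definition goright S := Node (padd (nu S) (nv S)) (nv S) (nc S) (nb S) (na S).

(** The vector over the point [i nu + j nv], found by the Euclidean
    algorithm; [n] bounds the number of steps. *)
Fixpoint descend (n i j : nat) (S : node) : 'cV[R]_2 :=
  if n is n'.+1 then
    if j == 0%N then na S else if i == 0%N then nb S
    else if (j <= i)%N then descend n' (i - j) j (goleft S)
    else descend n' i (j - i) (goright S)
  else na S.

Definition point i j S := descend (i + j) i j S.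

Lemma descend_fuel n i j S : (i + j <= n)%N -> descend n i j S = point i j S.
Proof.
have [m] := ubnP (i + j); elim: m n i j S => // m IH [|n] i j S lt le.
  by have [-> ->] : i = 0%N /\ j = 0%N by lia.
rewrite /point; case E : (i + j)%N => [|k] /=.
  by have [_ ->] : i = 0%N /\ j = 0%N by lia.
case: eqVneq => // j0; case: eqVneq => // i0; case: leqP => ij.
  by rewrite !IH //; lia.
by rewrite !IH //; lia.
Qed.

Lemma point_l i S : point i 0 S = na S.
Proof. by rewrite /point; case: (i + 0)%N. Qed.

Lemma point_r j S : (0 < j)%N -> point 0 j S = nb S.
Proof. by case: j. Qed.

Lemma point_left i j S : (0 < i + j)%N ->
  point (i + j) j S = point i j (goleft S).
Proof.
case: (posnP j) => [->|j0] _; first by rewrite !point_l.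
rewrite {1}/point; case E : (i + j + j)%N => [|k] /=; first by lia.
rewrite !gtn_eqF ?addn_gt0 ?j0 ?orbT // leq_addl addnK descend_fuel //; lia.
Qed.

Lemma point_diag i S : (0 < i)%N -> point i i S = nc S.
Proof. by move=> i0; have := @point_left 0 i S i0; rewrite add0n => ->; rewrite point_r. Qed.

Lemma point_right i j S : (0 < i + j)%N ->
  point i (i + j) S = point i j (goright S).
Proof.
case: (posnP i) => [->|i0] ij; first by rewrite add0n in ij *; rewrite !point_r.
case: (posnP j) => [->|j0]; first by rewrite addn0 point_diag // point_l.
rewrite {1}/point; case E : (i + (i + j))%N => [|k] /=; first by lia.
rewrite !gtn_eqF ?addn_gt0 ?i0 ?orbT //.
have -> : (i + j <= i)%N = false by lia.
rewrite addKn.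
by rewrite descend_fuel //; lia.
Qed.

Hypothesis cs0 : forall u v a b d, 0 < cs u v a b d.
Hypothesis ct0 : forall u v a b d, 0 < ct u v a b d.

Lemma wl0 S : 0 < wl S. Proof. exact: cs0. Qed.
Lemma wr0 S : 0 < wr S. Proof. exact: ct0. Qed.

Lemma point_cone i j S : (0 < i + j)%N -> exists x y,
  [/\ point i j S = x *: na S + y *: nb S, 0 <= x /\ 0 <= y,
      (0 < i)%N -> 0 < x & (0 < j)%N -> 0 < y].
Proof.
have [n] := ubnP (i + j); elim: n i j S => // n IH i j S lt ij0.
have [s0 t0] := (wl0 S, wr0 S).
case: (posnP j) => [j0|j0].
  by exists 1, 0; rewrite j0 point_l scale1r scale0r addr0 ltr01 ler01 lexx.
case: (posnP i) => [i0|i0].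
  by exists 0, 1; rewrite i0 point_r // scale1r scale0r add0r ltr01 ler01 lexx.
case: (leqP j i) => ij.
  have [|| x [y [E [x0 y0] px py]]] := IH (i - j)%N j (goleft S); try lia.
  have {}E : point i j S = x *: na S + y *: nc S.
    by rewrite -E -point_left ?subnK // addn_gt0 j0 orbT.
  have y1 := py j0; exists (x + y * wl S), (y * wr S); split=> [||_|_].
  - by rewrite E /nc scalerDr !scalerA scalerDl addrA.
  - by split; [rewrite addr_ge0 // mulr_ge0 // ltW | rewrite mulr_ge0 // ltW].
  - by rewrite ltr_wpDl // mulr_gt0.
  - by rewrite mulr_gt0.
have [|| x [y [E [x0 y0] px py]]] := IH i (j - i)%N (goright S); try lia.
have {}E : point i j S = x *: nc S + y *: nb S.
  by rewrite -E -point_right ?subnKC ?(ltnW ij) // addn_gt0 i0.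
have x1 := px i0; exists (x * wl S), (x * wr S + y); split=> [||_|_].
- by rewrite E /nc scalerDr !scalerA scalerDl addrA.
- by split; [rewrite mulr_ge0 // ltW | rewrite addr_ge0 // mulr_ge0 // ltW].
- by rewrite mulr_gt0.
- by rewrite ltr_wpDr // mulr_gt0.
Qed.

Lemma wedge_comb (a b : 'cV[R]_2) x y x' y' :
  wedge (x *: a + y *: b) (x' *: a + y' *: b) = (x * y' - y * x') * wedge a b.
Proof.
rewrite !wedgeDl !wedgeDr !wedgeZl !wedgeZr !wedgevv (wedgeC b a).
by move: (wedge a b) => w; lra.
Qed.

(** The two descents follow the same path until a mediant separates the two
    points; their vectors then lie in consecutive cones. *)
Lemma point_mono i j i' j' S : 0 < wedge (na S) (nb S) ->
  (j * i' < i * j')%N -> 0 < wedge (point i j S) (point i' j' S).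
Proof.
have [n] := ubnP (i + j + i' + j'); elim: n i j i' j' S => // n IH i j i' j' S.
move=> lt ab D; have [s0 t0] := (wl0 S, wr0 S).
have i0 : (0 < i)%N by case: (posnP i) D => // ->; rewrite mul0n.
have j'0 : (0 < j')%N by case: (posnP j') D => // ->; rewrite muln0.
have wl1 : wedge (na S) (nc S) = wr S * wedge (na S) (nb S).
  by rewrite /nc wedgeDr !wedgeZr wedgevv mulr0 add0r.
have wr1 : wedge (nc S) (nb S) = wl S * wedge (na S) (nb S).
  by rewrite /nc wedgeDl !wedgeZl wedgevv mulr0 addr0.
case: (posnP j) => [->|j0].
  rewrite point_l; have [|x [y [-> _ _ y0]]] := @point_cone i' j' S; first by lia.
  by rewrite wedgeDr !wedgeZr wedgevv mulr0 add0r mulr_gt0 // y0.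
case: (posnP i') => [->|i'0].
  rewrite [point 0 _ _]point_r //.
  have [|x [y [-> _ x0 _]]] := @point_cone i j S; first by lia.
  by rewrite wedgeDl !wedgeZl wedgevv mulr0 addr0 mulr_gt0 // x0.
have goL : (j <= i)%N -> (j' <= i')%N -> 0 < wedge (point i j S) (point i' j' S).
  move=> h h'; rewrite -(subnK h) -(subnK h') !point_left; try lia.
  by apply: IH; [lia | rewrite /= wl1 mulr_gt0 | nia].
have goR : (i <= j)%N -> (i' <= j')%N -> 0 < wedge (point i j S) (point i' j' S).
  move=> h h'; rewrite -(subnKC h) -(subnKC h') !point_right; try lia.
  by apply: IH; [lia | rewrite /= wr1 mulr_gt0 | nia].
case: (leqP j i) => ji; case: (leqP j' i') => ji'; first exact: goL.
- case: (ltngtP j i) ji => // [ji|E] _; last by apply: goR; lia.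
  rewrite -(subnK (ltnW ji)) -(subnKC (ltnW ji')) point_left ?point_right; try lia.
  have [|x [y [-> [x0 y0] x1 y1]]] := @point_cone (i - j) j (goleft S); first by lia.
  have [|x' [y' [-> [x'0 y'0] x1' y1']]] := @point_cone i' (j' - i') (goright S); first by lia.
  rewrite /= !wedgeDl !wedgeDr !wedgeZl !wedgeZr wedgevv wl1 wr1.
  have [x2 x2'] : 0 < x /\ 0 < x' by split; [apply: x1; rewrite subn_gt0 | exact: x1'].
  move: (wedge _ _) (wl S) (wr S) ab s0 t0 => w s t w0 s0 t0.
  have h1 : 0 < x * (x' * (t * w)) by rewrite !mulr_gt0.
  have h2 : 0 <= x * (y' * w) by rewrite !mulr_ge0 // ltW.
  have h3 : 0 <= y * (y' * (s * w)) by rewrite !mulr_ge0 // ltW.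
  by lra.
- by exfalso; move: D; rewrite ltnNge => /negP; apply; apply: leq_mul; lia.
- by apply: goR; lia.
Qed.

Section Root.
Variables (a b d : 'cV[R]_2).
Definition root : node := Node (1, 0)%N (0, 1)%N a b d.
Definition pt (z : nat * nat) := point z.1 z.2 root.

Inductive reach : node -> Prop :=
| reach_root : reach root
| reach_left S : reach S -> reach (goleft S)
| reach_right S : reach S -> reach (goright S).

(** The definition of [point] descends from the root, while the weights are
    rules at the leaves; this lemma relates the two. *)
Lemma reach_pt S : reach S -> forall i j, (0 < i + j)%N ->
  pt (i * (nu S).1 + j * (nv S).1, i * (nu S).2 + j * (nv S).2)%N = point i j S.
Proof.
elim=> [|{}S _ IH|{}S _ IH] i j ij /=.
- by rewrite /pt /= !muln1 !muln0 addn0.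
- rewrite -point_left // -IH; last by lia.
  by congr (pt _); congr pair => /=; lia.
- rewrite -point_right // -IH; last by lia.
  by congr (pt _); congr pair => /=; lia.
Qed.

Lemma reach_uvc S : reach S -> [/\ pt (nu S) = na S, pt (nv S) = nb S &
  pt (padd (nu S) (nv S)) = nc S].
Proof.
move=> rS; have H := reach_pt rS; split.
- have := H 1%N 0%N isT; rewrite !mul1n !mul0n !addn0 point_l.
  by case: (nu S).
- by have := H 0%N 1%N isT; rewrite !mul1n !mul0n !add0n point_r //; case: (nv S).
- by have := H 1%N 1%N isT; rewrite !mul1n point_diag.
Qed.

(** For the children of a node, the opposite point is the end of its edge
    that they drop. *)
Lemma reach_opp S : reach S -> S = root \/
  exists w, nd S = pt w /\ (nu S = padd w (nv S) \/ nv S = padd w (nu S)).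
Proof.
case=> [|{}S rS|{}S rS]; first by left.
- right; exists (nv S); have [_ -> _] := reach_uvc rS; split=> //; right.
  by rewrite /= /padd; congr pair; rewrite addnC.
- by right; exists (nu S); have [-> _ _] := reach_uvc rS; split=> //; left.
Qed.

Lemma reach_pair p q : det1 p q -> exists S, [/\ reach S, nu S = p & nv S = q].
Proof.
move: p q; apply: det1_ind.
- by exists root; split=> //; exact: reach_root.
- move=> p q _ [S [rS <- <-]]; exists (goright S); split=> //; exact: reach_right.
- move=> p q _ [S [rS <- <-]]; exists (goleft S); split=> //; exact: reach_left.
Qed.

(** Every unimodular pair labels a node, whose opposite point is the
    difference of the pair unless the node is the root. *)
Lemma pt_rule p q : det1 p q -> exists e,
  pt (padd p q) = cs p q (pt p) (pt q) e *: pt p + ct p q (pt p) (pt q) e *: pt q /\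
  ([/\ p = (1, 0)%N, q = (0, 1)%N & e = d] \/
   exists w, e = pt w /\ (p = padd w q \/ q = padd w p)).
Proof.
move=> /reach_pair[S [rS <- <-]]; exists (nd S).
have [-> -> ->] := reach_uvc rS; split=> //.
by case: (reach_opp rS) => [->|]; [left | right].
Qed.

End Root.
End Stern.

Definition increasing (R : realFieldType) (V : P1Q -> 'cV[R]_2) : Prop :=
  forall x y, P1_lt y x -> 0 < wedge (V x) (V y).

Lemma increasing_oriented (R : realFieldType) (V : P1Q -> 'cV[R]_2) :
  increasing V -> oriented V.
Proof.
move=> iV x y z.
have tr (a b c : P1Q) : P1_lt a b -> P1_lt b c ->
    0 < orient (V a) (V b) (V c).
  move=> ab bc; have ac : P1_lt a c.
    by move: ab bc; case: a b c => [a|] [b|] [c|] //; exact: lt_trans.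
  rewrite /orient (wedgeC (V a)) (wedgeC (V b) (V c)) mulrNN.
  by rewrite !mulr_gt0 // iV.
by case/or3P=> /andP[h1 h2]; [|rewrite orient_rot|rewrite -orient_rot]; exact: tr.
Qed.

Lemma P1_lt_dt x y : P1_lt y x = (0 < dt x y).
Proof.
case: x y => [p|] [q|]; rewrite /dt /=.
- rewrite -{1}(divq_num_den q) -{1}(divq_num_den p).
  rewrite ltr_pdivrMr ?ltr0z ?denq_gt0 // mulrAC ltr_pdivlMr ?ltr0z ?denq_gt0 //.
  by rewrite -!intrM ltr_int subr_gt0.
- by rewrite mulr0 mul1r sub0r oppr_gt0 ltNge denq_ge0.
- by rewrite mul1r mulr0 subr0 denq_gt0.
- by rewrite mulr0 subrr ltxx.
Qed.

Lemma ptzNN p q : ptz (- p) (- q) = ptz p q.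
Proof. by rewrite /ptz oppr_eq0 !intrN invrN mulrNN. Qed.

(** The edge spanned by two vectors has their sum and their difference as
    opposite vertices. *)
Lemma quad_ptz E (p q r t : int) : p * t - q * r = 1 ->
  val E = [fset ptz p q; ptz r t]%fset ->
  quad val E (ptz r t) (ptz (p + r) (q + t)) (ptz p q) (ptz (p - r) (q - t)).
Proof.
move=> D EE.
have [|e1 e1P [n1 d1]] := @ptz_sign p q; first by apply: (@coprime_det _ _ r t); left.
have [|e2 e2P [n2 d2]] := @ptz_sign r t; first by apply: (@coprime_det _ _ p q); right; lia.
have [|e3 e3P [n3 d3]] := @ptz_sign (p + r) (q + t).
  by apply: (@coprime_det _ _ r t); left; lia.
have [|e4 e4P [n4 d4]] := @ptz_sign (p - r) (q - t).
  by apply: (@coprime_det _ _ r t); left; lia.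
have a23 : dt (ptz r t) (ptz (p + r) (q + t)) = - (e2 * e3) by rewrite /dt n2 d2 n3 d3; lia.
have a31 : dt (ptz (p + r) (q + t)) (ptz p q) = - (e3 * e1) by rewrite /dt n3 d3 n1 d1; lia.
have a14 : dt (ptz p q) (ptz (p - r) (q - t)) = - (e1 * e4) by rewrite /dt n1 d1 n4 d4; lia.
have a42 : dt (ptz (p - r) (q - t)) (ptz r t) = e4 * e2 by rewrite /dt n4 d4 n2 d2; lia.
have a12 : dt (ptz p q) (ptz r t) = e1 * e2 by rewrite /dt n1 d1 n2 d2; lia.
have a21 := dtC (ptz r t) (ptz p q); rewrite a12 in a21.
split; first by rewrite fset2C.
- rewrite ccw_dt a23 a31 a12.
  by case: e1P => ->; case: e2P => ->; case: e3P => ->.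
- rewrite ccw_dt a14 a42 a21.
  by case: e1P => ->; case: e2P => ->; case: e4P => ->.
split; apply/inC_val; apply: adjPn; rewrite ?a23 ?a31 ?a14 ?a42.
- by case: e2P => ->; case: e3P => ->; lia.
- by case: e3P => ->; case: e1P => ->; lia.
- by case: e1P => ->; case: e4P => ->; lia.
- by case: e4P => ->; case: e2P => ->; lia.
Qed.

(** The two copies of the quadrant: [(i, j)] stands for the vector [(i, j)]
    in the first one and for its rotation [(- j, i)] in the second one. *)
Definition pt1 (z : nat * nat) : P1Q := ptz z.1%:Z z.2%:Z.
Definition pt2 (z : nat * nat) : P1Q := ptz (- z.2%:Z) z.1%:Z.

Lemma pt1_nd z : coprimez z.1%:Z z.2%:Z -> num (pt1 z) = z.1 /\ den (pt1 z) = z.2.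
Proof.
move=> /ptz_sign[e [->|->]] [n d]; first by rewrite /pt1 n d !mul1r.
have := den_ge0 (pt1 z); rewrite d => d0; have z2 : z.2 = 0%N by lia.
by move: n; rewrite {1}/pt1 /ptz z2 eqxx /=; lia.
Qed.

Lemma den_gt0 x : x != None -> 0 < den x.
Proof. by case: x => // q _; exact: denq_gt0. Qed.

(** The first copy of the quadrant covers the nonnegative points, the second
    one the nonpositive points; the edge from zero to infinity, their common
    root, is attributed to the second copy, which knows both of its
    triangles. *)
Lemma adj_cover x y : adj x y -> exists p q, det1 p q /\
  ([/\ (p, q) <> ((1, 0), (0, 1))%N & [fset x; y]%fset = [fset pt1 p; pt1 q]%fset] \/
   [fset x; y]%fset = [fset pt2 p; pt2 q]%fset).
Proof.
move=> xy; wlog D : x y xy / dt x y = 1 => [IH|].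
  case: (adjP xy) => D; first exact: IH.
  have [||p [q H]] := IH y x; [by rewrite adjC | by rewrite dtC D | ].
  by exists p, q; rewrite fset2C.
have nd z : z = ptz (num z) (den z) by rewrite ptz_nd.
have dx := den_ge0 x; have dy := den_ge0 y; have D' := D; rewrite /dt in D'.
have d1 (a b c d : int) : 0 <= a -> 0 <= b -> 0 <= c -> 0 <= d -> a * d - c * b = 1 ->
    det1 (`|a|%N, `|b|%N) (`|c|%N, `|d|%N) by rewrite /det1 /=; nia.
case: (eqVneq x None) => [Ex|nx].
  have dy1 : den y = 1 by move: D'; rewrite Ex /=; lia.
  case: (ltrP 0 (num y)) => ny.
    exists (`|num x|%N, `|den x|%N), (`|num y|%N, `|den y|%N); split.
      by apply: d1; rewrite ?Ex //= ?dy1 //; lia.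
    left; split; first by rewrite Ex dy1 /= => -[]; lia.
    by rewrite /pt1 /= !gez0_abs ?ptz_nd // ltW // Ex.
  exists (`|den y|%N, `|num y|%N), (0%N, 1%N); split.
    by rewrite /det1 /= dy1; lia.
  right; rewrite /pt2 /= (gez0_abs dy) (lez0_abs ny) opprK ptz_nd.
  by rewrite Ex /ptz eqxx fset2C.
have dx0 := den_gt0 nx.
case: (ltrP 0 (num x)) => nx0; last first.
  (* x <= 0, so that y is a negative number *)
  have dy0 : 0 < den y.
    by apply: den_gt0; apply: contraTneq isT => Ey; move: D'; rewrite Ey /=; lia.
  have ny0 : num y <= 0 by nia.
  exists (`|den x|%N, `|num x|%N), (`|den y|%N, `|num y|%N); split.
    by rewrite /det1 /=; nia.
  by right; rewrite /pt2 /= (gez0_abs dy) (gez0_abs dx) (lez0_abs nx0) (lez0_abs ny0) !opprK !ptz_nd.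
have ny0 : 0 <= num y.
  by case: (eqVneq y None) => [->//|/den_gt0 dy0]; nia.
exists (`|num x|%N, `|den x|%N), (`|num y|%N, `|den y|%N); split.
  by apply: d1 => //; rewrite ltW.
left; split; first by case; lia.
by rewrite /pt1 /= !gez0_abs ?ptz_nd // ltW.
Qed.

Lemma det1_coprime p q : det1 p q -> coprimez p.1%:Z p.2%:Z /\ coprimez q.1%:Z q.2%:Z.
Proof.
rewrite /det1 => D; split; [apply: (@coprime_det _ _ q.1 q.2); left|
  apply: (@coprime_det _ _ p.1 p.2); right]; lia.
Qed.

Lemma adj_ptz (p q r t : int) : p * t - q * r = 1 -> adj (ptz p q) (ptz r t).
Proof.
move=> D.
have [|e1 e1P [n1 d1]] := @ptz_sign p q; first by apply: (@coprime_det _ _ r t); left.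
have [|e2 e2P [n2 d2]] := @ptz_sign r t; first by apply: (@coprime_det _ _ p q); right; lia.
apply: adjPn; have -> : dt (ptz p q) (ptz r t) = e1 * e2 by rewrite /dt n1 d1 n2 d2; lia.
by case: e1P => ->; case: e2P => ->; lia.
Qed.

Lemma mediant_ptz (p q r t : int) : p * t - q * r = 1 ->
  [/\ adj (ptz p q) (ptz r t), ccw (ptz r t) (ptz (p + r) (q + t)) (ptz p q),
      adj (ptz r t) (ptz (p + r) (q + t)) & adj (ptz (p + r) (q + t)) (ptz p q)].
Proof.
move=> D; have pq := adj_ptz D; have [E EE] := edge_ex pq.
by have [_ ? _ [/inC_val ? /inC_val ? _ _]] := quad_ptz D EE.
Qed.

Lemma quad_pt1 E p q w : det1 p q -> p = padd w q \/ q = padd w p ->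
  val E = [fset pt1 p; pt1 q]%fset ->
  quad val E (pt1 q) (pt1 (padd p q)) (pt1 p) (pt1 w).
Proof.
rewrite /det1 => D Hw EE; have := @quad_ptz E p.1 p.2 q.1 q.2; rewrite -!PoszD => H.
have -> : pt1 w = ptz (p.1%:Z - q.1%:Z) (p.2%:Z - q.2%:Z).
  case: Hw => ->; rewrite /pt1 /=; first by congr ptz; lia.
  by rewrite -ptzNN; congr ptz; lia.
by apply: H => //; lia.
Qed.

Lemma quad_pt2 E p q w : det1 p q -> p = padd w q \/ q = padd w p ->
  val E = [fset pt2 p; pt2 q]%fset ->
  quad val E (pt2 q) (pt2 (padd p q)) (pt2 p) (pt2 w).
Proof.
rewrite /det1 => D Hw EE; have H := @quad_ptz E (- p.2%:Z) p.1 (- q.2%:Z) q.1.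
have -> : pt2 w = ptz (- p.2%:Z - - q.2%:Z) (p.1%:Z - q.1%:Z).
  case: Hw => ->; rewrite /pt2 /=; first by congr ptz; lia.
  by rewrite -ptzNN; congr ptz; lia.
rewrite {2}/pt2 /= !PoszD opprD; apply: H => //; lia.
Qed.

Lemma quad_root E : val E = [fset pt2 (1, 0); pt2 (0, 1)]%N%fset ->
  quad val E (pt2 (0, 1)%N) (pt2 (1, 1)%N) (pt2 (1, 0)%N) (pt1 (1, 1)%N).
Proof. by move=> EE; have := @quad_ptz E 0 1 (-1) 0 erefl EE. Qed.

Section Develop.
Variable R : realFieldType.
Variables S T : P1Q -> P1Q -> 'cV[R]_2 -> 'cV[R]_2 -> 'cV[R]_2 -> R.
Variable k : R.
Hypothesis S0 : forall x y a b e, 0 < S x y a b e.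
Hypothesis T0 : forall x y a b e, 0 < T x y a b e.
Hypothesis k0 : 0 < k.

Let oo : 'cV[R]_2 := hvec None.
Let zz : 'cV[R]_2 := k *: hvec (Some 0).

Definition vec1 := pt (fun p q => S (pt1 p) (pt1 q)) (fun p q => T (pt1 p) (pt1 q)) oo zz 0.
(** The root of the second copy has [1] as its opposite point, so that the
    weights there see both triangles at the edge from zero to infinity. *)
Definition vec2 := pt (fun p q => S (pt2 p) (pt2 q)) (fun p q => T (pt2 p) (pt2 q))
  zz (- oo) (vec1 (1, 1)%N).

Definition develop (x : P1Q) : 'cV[R]_2 :=
  if 0 <= num x then vec1 (`|num x|%N, `|den x|%N)
  else vec2 (`|den x|%N, `|num x|%N).

Lemma wedge_root : wedge oo zz = k.
Proof. by rewrite /oo /zz wedgeZr /wedge !mxE /= mulr1 mulr0 subr0 mulr1. Qed.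

Lemma wedge_root2 : wedge zz (- oo) = k.
Proof. by rewrite wedgeNr wedgeC opprK wedge_root. Qed.

Lemma vec1E z : coprimez z.1%:Z z.2%:Z -> vec1 z = develop (pt1 z).
Proof. by move=> /pt1_nd[n d]; rewrite /develop n d /=; case: z {n d}. Qed.

Lemma vec2E z : coprimez z.1%:Z z.2%:Z ->
  exists2 e : R, `|e| = 1 & vec2 z = e *: develop (pt2 z).
Proof.
case: z => [i j]; case: (posnP i) => [->|i0] c.
  have -> : j = 1%N by move: c; rewrite coprimez_sym /coprimez gcdz0 /= => /eqP[].
  exists (-1); first by rewrite normrN1.
  by rewrite /develop /vec2 /pt /pt2 /ptz /= scaleN1r.
have [e eP [n d]] : exists2 e : int, e = 1 \/ e = -1 &
    num (pt2 (i, j)) = e * - j%:Z /\ den (pt2 (i, j)) = e * i%:Z.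
  by apply: ptz_sign; rewrite coprimez_sym coprimezN.
have e1 : e = 1 by case: eP => // E; have := den_ge0 (pt2 (i, j)); rewrite d E; lia.
rewrite e1 !mul1r in n d; exists 1; rewrite ?normr1 // scale1r /develop n d.
case: (posnP j) => [j0|j0]; last first.
  by rewrite (_ : 0 <= - j%:Z = false) ?abszN //; lia.
have -> : i = 1%N by move: c; rewrite j0 /coprimez gcdz0 /= => /eqP[].
by rewrite j0 /=.
Qed.

(** In one copy of the quadrant this is [point_mono]; between the two copies
    it holds because their cones do not overlap. *)
Lemma develop_increasing : increasing develop.
Proof.
have m1 z z' : (z.2 * z'.1 < z.1 * z'.2)%N -> 0 < wedge (vec1 z) (vec1 z').
  by apply: point_mono => //; rewrite wedge_root.
have m2 z z' : (z.2 * z'.1 < z.1 * z'.2)%N -> 0 < wedge (vec2 z) (vec2 z').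
  by apply: point_mono => //; rewrite wedge_root2.
move=> x y; rewrite P1_lt_dt /dt /develop => D.
have dx := den_ge0 x; have dy := den_ge0 y.
have c1 z : (0 < z.1 + z.2)%N -> exists a b, [/\ vec1 z = a *: oo + b *: zz,
    0 <= a /\ 0 <= b, (0 < z.1)%N -> 0 < a & (0 < z.2)%N -> 0 < b].
  exact: point_cone.
have c2 z : (0 < z.1 + z.2)%N -> exists a b, [/\ vec2 z = a *: zz + b *: (- oo),
    0 <= a /\ 0 <= b, (0 < z.1)%N -> 0 < a & (0 < z.2)%N -> 0 < b].
  exact: point_cone.
case: (lerP 0 (num x)) => nx; case: (lerP 0 (num y)) => ny.
- by apply: m1 => /=; nia.
- have nd := num_den_neq0 x.
  have [|a [b [-> [a0 b0] a1 b1]]] := c1 (`|num x|%N, `|den x|%N); first by rewrite /=; lia.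
  have dy0 : 0 < den y by case: y dy ny {D} => [q|] //= _ _; exact: denq_gt0.
  have [|a' [b' [-> _ a1' b1']]] := c2 (`|den y|%N, `|num y|%N); first by rewrite /=; lia.
  have [a2 b2] : 0 < a' /\ 0 < b' by split; [apply: a1' | apply: b1'] => /=; lia.
  have ab : 0 < a \/ 0 < b.
    by case/orP: nd => H; [left; apply: a1 | right; apply: b1] => /=; lia.
  rewrite [X in wedge _ X]addrC scalerN -scaleNr wedge_comb wedge_root mulr_gt0 //.
  have h1 : 0 <= a * a' by rewrite mulr_ge0 // ltW.
  have h2 : 0 <= b * b' by rewrite mulr_ge0 // ltW.
  by case: ab => H; [have := mulr_gt0 H a2 | have := mulr_gt0 H b2]; lra.
- by exfalso; nia.
- by apply: m2 => /=; nia.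
Qed.

Lemma wedge_scale1 (u v : 'cV[R]_2) e e' : `|e| = 1 -> `|e'| = 1 ->
  `|wedge (e *: u) (e' *: v)| = `|wedge u v|.
Proof. by move=> h h'; rewrite wedgeZl wedgeZr !normrM h h' !mul1r. Qed.

Lemma lam1 z z' : coprimez z.1%:Z z.2%:Z -> coprimez z'.1%:Z z'.2%:Z ->
  lam develop (pt1 z) (pt1 z') = `|wedge (vec1 z) (vec1 z')|.
Proof. by move=> c c'; rewrite /lam !vec1E. Qed.

Lemma lam2 z z' : coprimez z.1%:Z z.2%:Z -> coprimez z'.1%:Z z'.2%:Z ->
  lam develop (pt2 z) (pt2 z') = `|wedge (vec2 z) (vec2 z')|.
Proof.
move=> /vec2E[e e1 ->] /vec2E[e' e1' ->].
by rewrite wedge_scale1.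
Qed.

Lemma lam21 z z' : coprimez z.1%:Z z.2%:Z -> coprimez z'.1%:Z z'.2%:Z ->
  lam develop (pt2 z) (pt1 z') = `|wedge (vec2 z) (vec1 z')|.
Proof.
move=> /vec2E[e e1 ->] c; rewrite vec1E // -[X in wedge _ X]scale1r.
by rewrite wedge_scale1 ?normr1.
Qed.

(** The recursion seen on an edge: [a], [b], [e] are, up to sign, the vectors
    at its ends and at one of the opposite vertices. *)
Lemma develop_rule (E : edge) : exists x y m w a b e,
  let c := S x y a b e *: a + T x y a b e *: b in
  [/\ quad val E y m x w, lam develop y m = `|wedge b c|,
      lam develop m x = `|wedge c a|, lam develop x w = `|wedge a e| &
      lam develop w y = `|wedge e b|] /\ lam develop x y = `|wedge a b|.
Proof.
have [x [y [EE xy]]] := edgeP E.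
have [p [q [D Epq]]] := adj_cover xy.
have [cp cq] := det1_coprime D.
have cm : coprimez (padd p q).1%:Z (padd p q).2%:Z.
  by apply: (@coprime_det _ _ q.1 q.2); move: D; rewrite /det1 /=; left; lia.
have cw w : p = padd w q \/ q = padd w p -> coprimez w.1%:Z w.2%:Z.
  move=> H; case: H D => ->; rewrite /det1 /= => D.
    by apply: (@coprime_det _ _ q.1 q.2); left; lia.
  by apply: (@coprime_det _ _ p.1 p.2); right; lia.
case: Epq => [[npq E1]|E2].
  have [e [Em He]] := pt_rule (fun p q => S (pt1 p) (pt1 q)) (fun p q => T (pt1 p) (pt1 q))
    oo zz 0 D.
  case: He => [[Ep Eq _]|[w [Ew Hw]]]; first by rewrite Ep Eq in npq.
  exists (pt1 p), (pt1 q), (pt1 (padd p q)), (pt1 w), (vec1 p), (vec1 q), (vec1 w).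
  rewrite -[pt _ _ _ _ _ w]/(vec1 w) in Ew; rewrite -!/(vec1 _) Ew in Em.
  rewrite /= -Em; split; last by rewrite lam1.
  have cw' := cw w Hw; split; rewrite ?lam1 //.
  by apply: quad_pt1 => //; rewrite EE.
have [e [Em He]] := pt_rule (fun p q => S (pt2 p) (pt2 q)) (fun p q => T (pt2 p) (pt2 q))
  zz (- oo) (vec1 (1, 1)%N) D.
case: He => [[Ep Eq Ee]|[w [Ew Hw]]].
  exists (pt2 p), (pt2 q), (pt2 (padd p q)), (pt1 (1, 1)%N), (vec2 p), (vec2 q), (vec1 (1, 1)%N).
  rewrite -!/(vec2 _) Ee in Em.
  rewrite /= -Em; split; last by rewrite lam2.
  split; rewrite ?lam2 ?lam21 //; last by rewrite lamC lam21 // wedgeC normrN.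
  by rewrite Ep Eq; apply: quad_root; rewrite EE E2 Ep Eq.
exists (pt2 p), (pt2 q), (pt2 (padd p q)), (pt2 w), (vec2 p), (vec2 q), (vec2 w).
rewrite -[pt _ _ _ _ _ w]/(vec2 w) in Ew; rewrite -!/(vec2 _) Ew in Em.
rewrite /= -Em; split; last by rewrite lam2.
have cw' := cw w Hw; split; rewrite ?lam2 //.
by apply: quad_pt2 => //; rewrite EE.
Qed.

(** Weights that satisfy the equations of a length function produce vectors
    with these lengths. *)
Lemma develop_lengths (L : P1Q -> P1Q -> R) : (forall x y, L x y = L y x) ->
  (forall x y, 0 < L x y) -> L None (Some 0) = k ->
  (forall x y m a b e, adj x y -> ccw y m x -> adj y m -> adj m x ->
     S x y a b e * L x y = L m y /\ T x y a b e * L x y = L x m) ->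
  forall x y, adj x y -> lam develop x y = L x y.
Proof.
move=> LC Lp L0 LS x y xy.
have main (c : nat * nat -> P1Q) (vec : nat * nat -> 'cV[R]_2) :
    (forall p q, det1 p q -> [/\ adj (c p) (c q), ccw (c q) (c (padd p q)) (c p),
       adj (c q) (c (padd p q)) & adj (c (padd p q)) (c p)]) ->
    (forall p q, det1 p q -> exists e,
       vec (padd p q) = S (c p) (c q) (vec p) (vec q) e *: vec p +
         T (c p) (c q) (vec p) (vec q) e *: vec q) ->
    wedge (vec (1, 0)%N) (vec (0, 1)%N) = L (c (1, 0)%N) (c (0, 1)%N) ->
    forall p q, det1 p q -> wedge (vec p) (vec q) = L (c p) (c q).
  move=> H1 H2 H0; apply: det1_ind => // p q D IH;
    have [a1 a2 a3 a4] := H1 _ _ D; have [e ->] := H2 _ _ D;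
    have [s1 s2] := LS _ _ _ (vec p) (vec q) e a1 a2 a3 a4.
    by rewrite wedgeDl !wedgeZl wedgevv mulr0 addr0 IH s1.
  by rewrite wedgeDr !wedgeZr wedgevv mulr0 add0r IH s2.
have w1 : forall p q, det1 p q -> wedge (vec1 p) (vec1 q) = L (pt1 p) (pt1 q).
  apply: main => [p q D|p q D|].
  - rewrite /pt1 /padd /= !PoszD; apply: mediant_ptz; move: D; rewrite /det1; lia.
  - by have [e [Em _]] := pt_rule (fun p q => S (pt1 p) (pt1 q))
      (fun p q => T (pt1 p) (pt1 q)) oo zz 0 D; exists e.
  - by rewrite -[LHS]/(wedge oo zz) wedge_root -L0 /pt1 /ptz /= mul0r.
have w2 : forall p q, det1 p q -> wedge (vec2 p) (vec2 q) = L (pt2 p) (pt2 q).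
  apply: main => [p q D|p q D|].
  - rewrite /pt2 /padd /= !PoszD opprD; apply: mediant_ptz; move: D; rewrite /det1; lia.
  - by have [e [Em _]] := pt_rule (fun p q => S (pt2 p) (pt2 q))
      (fun p q => T (pt2 p) (pt2 q)) zz (- oo) (vec1 (1, 1)%N) D; exists e.
  - by rewrite -[LHS]/(wedge zz (- oo)) wedge_root2 -L0 LC /pt2 /ptz /= oppr0 mul0r.
have [p [q [D Epq]]] := adj_cover xy; have [cp cq] := det1_coprime D.
have sym a b : [fset x; y]%fset = [fset a; b]%fset -> lam develop a b = L a b ->
    lam develop x y = L x y.
  by move=> /fset2_eq[] [-> ->] //; rewrite lamC LC.
case: Epq => [[_ E]|E]; apply: sym E _.
  by rewrite lam1 // w1 // gtr0_norm.
by rewrite lam2 // w2 // gtr0_norm.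
Qed.

End Develop.

Section Realization.
Variable R : realFieldType.
Implicit Types (V : P1Q -> 'cV[R]_2) (A X : edge -> R).

Lemma edge_fun A : (forall E, 0 < A E) -> exists L : P1Q -> P1Q -> R,
  [/\ forall x y, L x y = L y x, forall x y, 0 < L x y &
      forall E x y, val E = [fset x; y]%fset -> A E = L x y].
Proof.
move=> A0; pose D x y := [set r | exists2 E, val E = [fset x; y]%fset & r = A E].
exists (fun x y => xget 1 (D x y)); split=> [x y|x y|E x y EE].
- by rewrite /D fset2C.
- by case: xgetP => [r _ [E _ ->]|_].
- case: xgetP => [r _ [F EF ->]|/(_ (A E))[]]; last by exists E.
  by congr A; apply: val_inj; rewrite EE EF.
Qed.

(** Prescribing the lengths of the two new sides of a triangle determines the
    weights. *)
Lemma lengths_realized A : (forall E, 0 < A E) ->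
  exists2 V, increasing V & coords V val A.
Proof.
move=> /edge_fun[L [LC L0 AL]].
pose S x y (_ _ _ : 'cV[R]_2) := L (apex x y) y / L x y.
pose T x y (_ _ _ : 'cV[R]_2) := L x (apex x y) / L x y.
have S0 x y a b e : 0 < S x y a b e by rewrite divr_gt0.
have T0 x y a b e : 0 < T x y a b e by rewrite divr_gt0.
exists (develop S T (L None (Some 0))); first exact: develop_increasing.
move=> E x y EE; rewrite (AL _ _ _ EE); apply/esym.
apply: (develop_lengths (L0 None (Some 0)) LC L0 erefl); last first.
  by apply/inC_val; exists E.
move=> x' y' m a b e xy ymx ym mx.
have -> : m = apex x' y' by apply: apex_uniq => //; cyc.
by rewrite /S /T !divfK // gt_eqF.
Qed.

(** The cross-ratio of a quadrilateral as a quotient of lambda lengths, which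
    is invariant under rescaling of the vectors. *)
Definition shear V (a b c d : P1Q) : R :=
  lam V a b * lam V c d / (lam V b c * lam V d a).

Lemma shear_rot V a b c d : shear V c d a b = shear V a b c d.
Proof. by rewrite /shear [lam V c d * _]mulrC [lam V d a * _]mulrC. Qed.

Definition shears V X : Prop :=
  forall E a b c d, quad val E a b c d -> X E = shear V a b c d.

(** The shear at an edge determines the ratio of the two weights, given the
    vectors at the edge and at one opposite vertex; the other weight is set
    to [1]. *)
Lemma shears_realized X : (forall E, 0 < X E) ->
  exists2 V, increasing V & shears V X.
Proof.
move=> X0; have [L [LC L0 XL]] := edge_fun X0.
pose r x y a b e : R := L x y * `|wedge e b| / `|wedge a e|.
pose S x y a b e := if 0 < r x y a b e then r x y a b e else 1.
pose T (x y : P1Q) (a b e : 'cV[R]_2) : R := 1.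
have S0 x y a b e : 0 < S x y a b e by rewrite /S; case: ifP.
have T0 x y a b e : 0 < T x y a b e by [].
have iV := develop_increasing S0 T0 ltr01.
pose V := develop S T 1; have oV := increasing_oriented iV.
exists V => // E a' b' c' d' Q'.
have [x [y [m [w [a [b [e [[Q h1 h2 h3 h4] h5]]]]]]]] := develop_rule S T ltr01 E.
have -> : shear V a' b' c' d' = shear V y m x w.
  by case: (quad_uniq triangulation_farey Q' Q) => -[-> -> -> ->] //; rewrite shear_rot.
have [EE ymx xwy _] := Q.
have n1 : `|wedge a e| != 0 by rewrite -h3 gt_eqF // lam_gt0 //; cyc.
have n2 : `|wedge e b| != 0 by rewrite -h4 gt_eqF // lam_gt0 //; cyc.
have n3 : `|wedge a b| != 0 by rewrite -h5 gt_eqF // lam_gt0 //; cyc.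
have Sr : S x y a b e = r x y a b e.
  by rewrite /S ifT // /r divr_gt0 ?mulr_gt0 // lt_neqAle normr_ge0 andbT eq_sym.
rewrite /shear /V h1 h2 h3 h4 wedgeDr wedgeDl !wedgeZl !wedgeZr !wedgevv.
rewrite !mulr0 addr0 add0r /T mul1r (wedgeC b a) mulrN !normrN normrM.
rewrite (gtr0_norm (S0 _ _ _ _ _)) Sr /r (XL E x y); last by rewrite EE fset2C.
move: `|wedge a e| `|wedge e b| `|wedge a b| n1 n2 n3 => p q s p0 q0 s0.
have -> : L x y * q / p * s * p / (s * q) = L x y * (q / q) * (p / p) * (s / s).
  by rewrite invfM; move: q^-1 p^-1 s^-1 => *; lra.
by rewrite !divff // !mulr1.
Qed.

Lemma coords_ex V : exists A, coords V val A.
Proof.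
have /choice[A HA] : forall E : edge, exists r, forall a b,
    val E = [fset a; b]%fset -> r = lam V a b.
  move=> E; have [a [b [EE _]]] := edgeP E; exists (lam V a b) => a' b'.
  by rewrite EE => /fset2_eq[] [-> ->] //; rewrite lamC.
by exists A.
Qed.

Lemma coords_gt0 V A : oriented V -> coords V val A -> forall E, 0 < A E.
Proof.
move=> oV cA E; have [a [b [EE ab]]] := edgeP E.
by rewrite (cA _ _ _ EE) lam_gt0 // adj_neq.
Qed.

Lemma shears_Xmap V A X : coords V val A -> shears V X -> X = Xmap farey_seed A.
Proof.
move=> cA sX; apply/funext => E.
have [a [b [c [d Q]]]] := quad_ex triangulation_farey E.
have [p [q [r [t S]]]] := quad_sides_ex Q; have [_ e1 e2 e3 e4] := S.
rewrite (sX _ _ _ _ _ Q) (Xmap_quad A realizes_farey S) /shear.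
by rewrite (cA _ _ _ e1) (cA _ _ _ e2) (cA _ _ _ e3) (cA _ _ _ e4).
Qed.

Lemma Xmap_onto X : (forall E, 0 < X E) ->
  exists2 A, (forall E, 0 < A E) & X = Xmap farey_seed A.
Proof.
move=> /shears_realized[V iV sV]; have [A cA] := coords_ex V.
exists A; last exact: shears_Xmap cA sV.
exact: coords_gt0 (increasing_oriented iV) cA.
Qed.

(** Positive coordinates are lambda lengths of some oriented family of
    vectors, and by [coords_act] the word turns them into the lengths of the
    same family for the final labels. *)
Lemma track_actA w (x : edge -> R) : track val w = val -> (forall E, 0 < x E) ->
  actA farey_seed w x = x.
Proof.
move=> tw x0; have [V iV cV] := lengths_realized x0.
have := @coords_act _ _ _ _ _ w (increasing_oriented iV) realizes_farey cV; rewrite tw => c.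
apply/funext => E; have [a [b [EE _]]] := edgeP E.
by rewrite (c _ _ _ EE) (cV _ _ _ EE).
Qed.

(** Follows from the case of A-coordinates because the monomial map is onto
    and compatible with mutations. *)
Lemma track_actX w (x : edge -> R) : track val w = val -> run farey_seed w = farey_seed ->
  (forall E, 0 < x E) -> actX farey_seed w x = x.
Proof.
move=> tw rw /Xmap_onto[A A0 ->].
by rewrite (Xmap_act _ realizes_farey) // rw track_actA.
Qed.
End Realization.

(** * The modular groups *)

(** The integral vectors, for which all edges have length [1] and all other
    chords are longer. *)
Definition stdvec (R : realFieldType) (x : P1Q) : 'cV[R]_2 :=
  \col_i (if i == 0 then num x else den x)%:~R.

Lemma wedge_stdvec (R : realFieldType) x y :
  wedge (stdvec R x) (stdvec R y) = (dt x y)%:~R.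
Proof. by rewrite /wedge !mxE /= -!intrM -intrB [den x * _]mulrC. Qed.

Lemma stdvec_oriented (R : realFieldType) : oriented (@stdvec R).
Proof.
by move=> x y z; rewrite ccw_dt /orient !wedge_stdvec -!intrM ltr0z.
Qed.

(** The coordinates equal to [1] everywhere show that every final label is an
    edge; giving the coordinate of one edge the value [2] shows which edge it
    is. *)
Lemma actA_track (R : realFieldType) w :
  (forall x : edge -> R, (forall E, 0 < x E) -> actA farey_seed w x = x) ->
  track val w = val.
Proof.
move=> H; apply/funext => i.
have [a [b [ab E]]] := tri_chord (good_triangulation (good_track w good_val)) i.
have c1 : coords (@stdvec R) val (fun=> 1).
  move=> j x y Ej; have : adj x y by apply/inC_val; exists j.
  by rewrite /lam wedge_stdvec -intr_norm /adj => /eqP->.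
have := @coords_act _ _ _ _ _ w (@stdvec_oriented R) realizes_farey c1.
rewrite H // => /(_ i a b E); rewrite /lam wedge_stdvec -intr_norm => /eqP.
rewrite eq_sym -[1]/(1%:~R) eqr_int => /edge_ex[j Ej]; rewrite E -Ej.
case: (eqVneq j i) => [->//|ji].
pose x F : R := if F == i then 2 else 1.
have x0 F : 0 < x F by rewrite /x; case: ifP => _; rewrite ?ltr0n.
have [V iV cV] := lengths_realized x0.
have := @coords_act _ _ _ _ _ w (increasing_oriented iV) realizes_farey cV.
rewrite H // => /(_ i a b E); rewrite -(cV _ _ _ Ej) /x eqxx (negPf ji) => K.
by move: (ltr1n R 2); rewrite K ltxx.
Qed.

Section Loops.
Implicit Types u v : loop farey_seed.

Lemma track_loop u v :
  track val (winv (val v) ++ val u) = val <-> track val (val u) = track val (val v).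
Proof.
rewrite track_cat; split=> [H|->]; last by rewrite track_winv //; exact: good_val.
rewrite -(track_winv (winv (val v)) (good_track (val u) good_val)) H.
by rewrite winvK.
Qed.

Lemma special_relE u v :
  special_rel u v <-> track val (val u) = track val (val v).
Proof.
split=> [/asboolP H|/track_loop/track_special H].
  exact: special_track H _ realizes_farey.
apply/asboolP; move: (val u) (val v) H => {u v}u v H.
apply: (@special_trans _ _ _ ((v ++ winv v) ++ u)).
  rewrite -[X in special_eq _ X]cat0s; apply: special_cat; last exact: special_refl.
  by apply: special_sym; have := special_winv (run farey_seed u) (winv v); rewrite winvK.
rewrite -catA -[X in special_eq _ _ X]cats0; apply: special_cat => //; exact: special_refl.
Qed.

Lemma gamma_relE (R : realFieldType) u v :
  gamma_rel R u v <-> track val (val u) = track val (val v).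
Proof.
have rv : run farey_seed (winv (val v) ++ val u) = farey_seed.
  by rewrite run_cat loopP -{1}(loopP v) run_winv.
have [PX PA] := (@pos_stepX edge R, @pos_stepA edge R).
have [NX NA] := (@inv_stepX edge R, @inv_stepA edge R).
rewrite -track_loop; split=> [/gamma_relP H|H].
  apply: (@actA_track R) => x x0; rewrite /actA act_cat loopP.
  have [y Ey] := posvalE x0; rewrite Ey; have := (H y).2; rewrite /actA => ->.
  by apply: (act_loopK PA NA (loopP v)) => E; exact: posval_gt0.
apply/gamma_relP => x; have x0 := @posval_gt0 _ _ x.
split.
  have := track_actX H rv x0; rewrite /actX act_cat loopP => /(congr1 (act (@stepX _ R) farey_seed (val v))).
  by rewrite act_loopVK ?loopP // => *; exact: act_gt0.
have := track_actA H x0; rewrite /actA act_cat loopP => /(congr1 (act (@stepA _ R) farey_seed (val v))).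
by rewrite act_loopVK ?loopP // => *; exact: act_gt0.
Qed.

End Loops.

Section Isomorphisms.
Variable R : realFieldType.
Local Notation G := (modular_group R farey_seed).
Local Notation G' := (special_modular_group farey_seed).

Lemma gamma_pi (u v : loop farey_seed) :
  \pi_G u = \pi_G v <-> track val (val u) = track val (val v).
Proof.
rewrite -(gamma_relE R); split=> [/eqmodP|H]; first by [].
exact/eqmodP.
Qed.

Lemma special_pi (u v : loop farey_seed) :
  \pi_G' u = \pi_G' v <-> track val (val u) = track val (val v).
Proof.
rewrite -special_relE; split=> [/eqmodP|H]; first by [].
exact/eqmodP.
Qed.

(** A class of loops goes to the map that carries the final triangulation
    back; [word_of_map] is applied to the inverse of a given map. *)
Lemma modular_group_thompson : exists phi : G -> (P1Q -> P1Q),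
  [/\ {morph phi : g h / (g * h)%g >-> g \o h}, injective phi & range phi = thompson].
Proof.
have /choice[phi phiP] : forall g : G, exists h, returns (val (repr g)) h.
  by move=> g; apply: returns_ex; exact: loopP.
have phi_pi u h : returns (val u) h -> phi (\pi_G u) = h.
  move=> [ah H]; apply: (returns_uniq (phiP (\pi_G u))); split=> // E.
  have -> // : track val (val (repr (\pi_G u))) = track val (val u).
  by apply/gamma_pi; rewrite reprK.
exists phi; split.
- by move=> g h; apply: phi_pi; exact: returns_cat (phiP g) (phiP h).
- move=> g h E; rewrite -[g]reprK -[h]reprK; apply/gamma_pi/funext => F.
  have [[k [hk _ _ _ _]] H] := phiP h; have [_ H'] := phiP g; rewrite E in H'.
  by apply: (can_inj (imgK hk)); rewrite H H'.
apply/seteqP; split=> [_ [g _ <-]|f tf].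
  by have [? _] := phiP g; exact: almost_modular_thompson.
have af := thompson_almost_modular tf; have [f' [ff' f'f _ _ _]] := af.
have [w [tw rw]] := word_of_map (almost_modular_inv af ff' f'f).
have lw : `[< run farey_seed w = farey_seed >] by exact/asboolP.
exists (\pi_G (Sub w lw : loop farey_seed)) => //; apply: phi_pi; split=> // E.
by rewrite tw (imgK f'f).
Qed.

Lemma modular_group_special : exists psi : G -> G',
  bijective psi /\ {morph psi : g h / (g * h)%g}.
Proof.
exists (fun g => \pi_G' (repr g)); split.
  exists (fun g => \pi_G (repr g)) => g; rewrite -[RHS]reprK.
    by apply/gamma_pi/special_pi; rewrite reprK.
  by apply/special_pi/gamma_pi; rewrite reprK.
move=> g h; apply: (@etrans _ _ (\pi_G' (loop_mul (repr g) (repr h)))).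
  by apply/special_pi/gamma_pi; rewrite reprK.
by apply/esym; exact: (qmul_pi (@special_mul _ farey_seed)).
Qed.
End Isomorphisms.

(** * Gluing charts *)

Section Charts.
Variables (I : choiceType) (R : realFieldType).
Variable st : seed I -> letter I -> (I -> R) -> I -> R.
Variable s0 : seed I.
Hypotheses (Pst : pos_step st) (Nst : inv_step st).
Local Notation Q := (positive_points st s0).

Lemma posval_inj : injective (@posval I R).
Proof.
move=> x y E; apply/funext => i; apply: val_inj.
exact: (congr1 (fun f => f i) E).
Qed.

(** The coordinates in the initial chart, obtained by undoing the word;
    gluing preserves them. *)
Definition initial (p : chart_point I R) : I -> R :=
  act st (run s0 p.1) (winv p.1) (posval p.2).

Lemma initial_glue p q : Defs.glue st s0 p q -> initial p = initial q.
Proof.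
move=> /asboolP; elim=> // [{}p {}q [w l x y E]|x y z _ -> _ -> //].
rewrite /initial /= /winv /= rev_cons -cats1 act_cat /= step_linv E Nst //.
by move=> i; exact: posval_gt0.
Qed.

(** Every letter of a word can be undone, so each point is glued to one of
    the initial chart. *)
Lemma chart_ex (p : Q) : exists x, p = \pi_Q ([::], x).
Proof.
rewrite -[p]reprK; move: (repr p) => [w x]; elim: w x => [|l w IH] x.
  by exists x.
have x0 i : 0 < st (step (run s0 w) l) (linv l) (posval x) i.
  by apply: Pst => j; exact: posval_gt0.
have [y Ey] := posvalE x0; have [z Ez] := IH y; exists z; rewrite -Ez.
apply/eqmodP; apply/asboolP; apply: rst_sym; apply: rst_step; apply: GlueStep.
have := @Nst (step (run s0 w) l) (linv l) (posval x) (@posval_gt0 _ _ x).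
by rewrite step_linv linvK Ey => ->.
Qed.

Lemma chart_inj x y : \pi_Q ([::], x) = \pi_Q ([::], y) -> x = y.
Proof. by move=> /eqmodP/initial_glue; exact: posval_inj. Qed.

Lemma chart_bijection (T : choiceType) (e : equiv_rel T)
    (C : T -> (I -> {posnum R}) -> Prop) :
  (forall b, exists x, C b x) -> (forall x, exists b, C b x) ->
  (forall b b' x x', C b x -> C b' x' -> (e b b' <-> x = x')) ->
  exists f : {eq_quot e} -> Q, bijective f /\
    forall b, exists2 x, C b x & f (\pi_({eq_quot e}) b) = \pi_Q ([::], x).
Proof.
move=> /choice[X CX] /choice[B CB] H.
have /choice[c cP] := chart_ex.
have cK x : c (\pi_Q ([::], x)) = x by apply: chart_inj; rewrite -cP.
have XE b b' : e b b' -> X b = X b' by move=> /(H _ _ _ _ (CX b) (CX b')).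
exists (fun q => \pi_Q ([::], X (repr q))); split.
  exists (fun p => \pi_({eq_quot e}) (B (c p))) => [q|p].
    rewrite cK -[RHS]reprK; apply/eqmodP.
    exact/(H _ _ _ _ (CB _) (CX _)).
  rewrite [RHS]cP; congr (\pi_Q ([::], _)).
  apply: (H _ _ _ _ (CX _) (CB _)).1; apply/eqmodP; exact: reprK.
move=> b; exists (X b) => //; congr (\pi_Q ([::], _)).
by apply: XE; apply/eqmodP; exact: reprK.
Qed.
End Charts.

Section Frames.
Variable F : realFieldType.
Implicit Types (u v w z : 'cV[F]_2) (M : 'M[F]_2).

Definition frame u v : 'M[F]_2 := \matrix_(i, j) (if j == 0 then u i 0 else v i 0).

Lemma det_frame u v : \det (frame u v) = wedge u v.
Proof. by rewrite det_mx2 /wedge !mxE /= [v 0 0 * _]mulrC. Qed.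

Lemma frame_mul u v z : frame u v *m z = z 0 0 *: u + z 1 0 *: v.
Proof.
apply/matrixP => i j; rewrite !mxE !big_ord_recl big_ord0 !mxE /= addr0 (ord1 j).
have -> : lift 0 0 = 1 :> 'I_2 by apply: val_inj.
by rewrite mulrC [v i 0 * _]mulrC.
Qed.

Lemma frame_oo u v : frame u v *m hvec None = u.
Proof. by rewrite frame_mul !mxE /= scale1r scale0r addr0. Qed.

Lemma frame_0 u v : frame u v *m hvec (Some 0) = v.
Proof. by rewrite frame_mul !mxE /= scale1r scale0r add0r. Qed.

Lemma frame_1 u v : frame u v *m hvec (Some 1) = u + v.
Proof. by rewrite frame_mul !mxE /= !scale1r. Qed.

Lemma wedge_cramer u v w : wedge w v *: u + wedge u w *: v = wedge u v *: w.
Proof.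
apply/matrixP => i j; rewrite !mxE (ord1 j) /wedge.
have : i = 0 \/ i = 1.
  case: (unliftP 0 i) => [k ->|->]; last by left.
  by right; rewrite (ord1 k); apply: val_inj.
by case=> ->; lra.
Qed.

Lemma wedge_inj u v w z : wedge u v != 0 -> wedge w u = wedge z u ->
  wedge w v = wedge z v -> w = z.
Proof.
move=> uv wu wv; have := wedge_cramer u v w; have := wedge_cramer u v z.
rewrite -wv (wedgeC u z) -wu -(wedgeC u w) => -> H.
by apply: (scalerI uv); rewrite -H.
Qed.

(** The columns of the matrix are the vectors of the first two points, scaled
    so that their sum lies over the third one. *)
Lemma mobius_triple (x y z : P1 F) : x != y -> y != z -> z != x ->
  exists2 M, M \in unitmx &
    [/\ mobius M None = x, mobius M (Some 0) = y & mobius M (Some 1) = z].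
Proof.
rewrite -!wedge_hvec_eq0; set u := hvec x; set v := hvec y; set w := hvec z.
move=> uv vw wu; have wv : wedge w v != 0 by rewrite wedgeC oppr_eq0.
have uw : wedge u w != 0 by rewrite wedgeC oppr_eq0.
exists (frame (wedge w v *: u) (wedge u w *: v)).
  by rewrite unitmxE det_frame unitfE wedgeZl wedgeZr !mulf_neq0.
by split; rewrite /mobius ?frame_oo ?frame_0 ?frame_1 ?wedge_cramer projZ // proj_hvec.
Qed.
End Frames.

(** Every vertex is reached by reflections of triangles, so that a property
    that propagates through reflections holds at all vertices. *)
Lemma farey_ind (P : P1Q -> Prop) : P (Some 0) -> P (Some 1) -> P None ->
  (forall a b c, adj a b -> adj b c -> adj c a -> P a -> P b -> P c ->
     P (reflection a b c)) -> forall x, P x.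
Proof.
move=> P0 P1 Poo Pr x.
have main t : farey_triangle t -> forall y, y \in t -> P y.
  elim=> [y|a b c fabc IH y]; rewrite mem_fset3 => /or3P[]/eqP-> //.
  - by apply: IH; rewrite mem_fset3 eqxx.
  - by apply: IH; rewrite mem_fset3 eqxx orbT.
  - have /farey_triangleE[ab bc ca] := fabc.
    by apply: Pr => //; apply: IH; rewrite mem_fset3 eqxx ?orbT.
have [y xy] := neighbour x; have [_ h1 h2] := apex_spec xy.
by apply: (main _ (farey_triangleI xy h1 h2)); rewrite mem_fset3 eqxx.
Qed.

(** * Decorated spaces *)

Section Decorated.
Variable R : realFieldType.
Implicit Types (a : Aplus_map R) (V : P1Q -> 'cV[R]_2).

Section Rays.
Variable F : realFieldType.
Implicit Types (u v w : 'cV[F]_2) (A : S1 F).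

(** The factor by which a vector exceeds the normalized vector over the same
    point. *)
Definition lead u : F := if u 1 0 == 0 then u 0 0 else u 1 0.

Lemma lead_hvec u : u != 0 -> u = lead u *: hvec (proj u).
Proof.
move=> u0; have [c c0 E] := hvec_proj u0; rewrite {1}E; congr (_ *: _).
rewrite E /lead !mxE; case: (proj u) => [t|] /=; rewrite !mulr1 ?mulr0 ?eqxx //.
by rewrite (negPf c0).
Qed.

Lemma leadZ t u : lead (t *: u) = t * lead u.
Proof.
rewrite /lead !mxE; case: (eqVneq t 0) => [->|t0]; first by rewrite !mul0r if_same.
by rewrite mulf_eq0 (negPf t0) /=; case: ifP.
Qed.

Lemma lead_neq0 u : u != 0 -> lead u != 0.
Proof.
move=> u0; have E := lead_hvec u0; apply: contraNneq u0 => h.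
by rewrite E h scale0r.
Qed.

Lemma ray_refl v : ray v v.
Proof. by exists 1; rewrite ?scale1r //= ltr01. Qed.

Lemma S1_eq A B : sval A = sval B -> A = B.
Proof.
by case: A B => [A pA] [B pB] /= E; subst B; congr exist; exact: Prop_irrelevance.
Qed.

Lemma rayZ t v : 0 < t -> ray (t *: v) = ray v.
Proof.
move=> t0; apply/seteqP; split=> _ [s s0 <-].
  by exists (s * t); rewrite ?scalerA //=; rewrite mulr_gt0.
by exists (s / t); rewrite ?scalerA ?divfK ?gt_eqF //=; rewrite divr_gt0.
Qed.

Lemma antipode_ray x : sval (antipode (hray x)) = ray (- hvec x) :> set 'cV[F]_2.
Proof.
apply/seteqP; split=> /= [_ [_ [t t0 <-] <-]|_ [t t0 <-]].
  by exists t => //; rewrite scalerN.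
by exists (t *: hvec x); [exists t | rewrite scalerN].
Qed.

Lemma S1_cases A : exists x, A = hray x \/ A = antipode (hray x).
Proof.
have [v v0 EA] := proj2_sig A; exists (proj v); have E := lead_hvec v0.
have := lead_neq0 v0; rewrite neq_lt => /orP[h|h]; [right|left]; apply: S1_eq.
  rewrite antipode_ray EA -(@rayZ (- lead v) (- hvec (proj v))) ?oppr_gt0 //.
  by rewrite scaleNr scalerN opprK -E.
by rewrite EA {1}E rayZ.
Qed.
End Rays.

(** Apply the condition on cyclic orders to the ray over [x], the ray over
    [y] and the antipode of the first one; as the first and the third image
    are opposite, it gives the sign of the wedge product of the first two. *)
Lemma Aplus_increasing a : increasing (fun x => val (sval a (hray x))).
Proof.
move=> x y yx.
have W0 : 0 < wedge (hvec x) (hvec y).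
  by move: yx; rewrite P1_ltE wedgeC oppr_lt0.
case: a => f [fN fC] /=; have := fC (hray x) (hray y) (antipode (hray x)).
case.
  exists (hvec x), (hvec y), (- hvec x); split; try exact: ray_refl.
    by exists (hvec x); first exact: ray_refl.
  by rewrite /ccw_vec !wedgeNr -wedgeC W0.
move=> u [v [w [[t t0 <-] [s s0 <-] [r r0 <-]]]] /=; rewrite fN.
rewrite /ccw_vec !wedgeZl !wedgeZr !wedgeNr !wedgeNl wedgevv oppr0 !mulr0 ltxx.
by rewrite !andbF !orbF pmulr_rgt0 // pmulr_rgt0 // => /andP[].
Qed.

Lemma Acoordinates_ex a : exists x, Acoordinates a x.
Proof.
have oV := increasing_oriented (Aplus_increasing a).
have [A cA] := coords_ex (fun x => val (sval a (hray x))).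
have [x Ex] := posvalE (coords_gt0 oV cA).
by exists x => E v w /cA H; rewrite -[LHS]/(posval x E) -Ex.
Qed.

Lemma Aplus_ext a a' (g : 'M[R]_2) :
  (forall x, val (sval a' (hray x)) = g *m val (sval a (hray x))) ->
  forall A, val (sval a' A) = g *m val (sval a A).
Proof.
move=> H A; have [x [->|->]] := S1_cases A; first exact: H.
by rewrite (proj2_sig a').1 (proj2_sig a).1 H mulmxN.
Qed.

(** Equal lengths mean equal wedge products along edges, by orientation. The
    matrix that adjusts the vectors at zero and infinity then adjusts all of
    them, because two wedge products determine a vector. *)
Lemma SL_coordinates a a' x x' : Acoordinates a x -> Acoordinates a' x' ->
  SL_rel a a' <-> x = x'.
Proof.
move=> cx cx'; split=> [/asboolP[g g1 H]|].
  apply: posval_inj; apply/funext => E; have [v [w [EE _]]] := edgeP E.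
  by rewrite /posval (cx _ _ _ EE) (cx' _ _ _ EE) !H wedge_mulmx g1 mul1r.
move=> xx; apply/asboolP.
have iV := Aplus_increasing a; have iV' := Aplus_increasing a'.
pose V x := val (sval a (hray x)); pose V' x := val (sval a' (hray x)).
rewrite -/V -/V' in iV iV'.
have adjE p q : adj p q -> wedge (V' p) (V' q) = wedge (V p) (V q).
  move=> pq; have [E EE] := edge_ex pq; have := cx _ _ _ EE; rewrite xx (cx' _ _ _ EE).
  rewrite -/(V p) -/(V q) -/(V' p) -/(V' q).
  have : P1_lt q p || P1_lt p q by have := adj_neq pq; rewrite !ordval_lt ordval_eq; lra.
  case/orP=> [/[dup]/iV h /iV' h'|/[dup]/iV h /iV' h']; first by rewrite !gtr0_norm.
  rewrite !(wedgeC _ (V q)) !(wedgeC _ (V' q)) !normrN !gtr0_norm // => ->.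
  by [].
have a0 : adj None (Some 0) by [].
have d0 : wedge (V None) (V (Some 0)) != 0 by rewrite gt_eqF // iV.
pose M := frame (V None) (V (Some 0)); pose M' := frame (V' None) (V' (Some 0)).
have Mu : M \in unitmx by rewrite unitmxE det_frame unitfE.
pose g := M' *m invmx M.
have g1 : \det g = 1.
  by rewrite det_mulmx det_inv !det_frame adjE // divff.
exists g => //; apply: Aplus_ext => y; rewrite -/(V y) -/(V' y).
have gM z : g *m (M *m z) = M' *m z by rewrite /g -mulmxA mulKmx.
have goo : V' None = g *m V None by rewrite -{1}(frame_oo (V None) (V (Some 0))) gM frame_oo.
have g0 : V' (Some 0) = g *m V (Some 0).
  by rewrite -{1}(frame_0 (V None) (V (Some 0))) gM frame_0.
have third p q r : adj p q -> adj q r -> adj r p -> V' p = g *m V p ->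
    V' q = g *m V q -> V' r = g *m V r.
  move=> pq qr rp Ep Eq; apply: (@wedge_inj _ (V' p) (V' q)).
  - by have := lam_gt0 (increasing_oriented iV') (adj_neq pq); rewrite normr_gt0.
  - by rewrite adjE // Ep wedge_mulmx g1 mul1r.
  - by rewrite wedgeC adjE // -wedgeC Eq wedge_mulmx g1 mul1r.
move: y; apply: farey_ind => //; first by apply: (third None (Some 0)).
move=> p q r pq qr rp Ep Eq _; have [h1 h2 _] := reflection_spec pq qr rp.
exact: third Ep Eq.
Qed.

(** The sign of [lead u] makes this extension odd. *)
Definition odd_ext V (u : 'cV[rat]_2) : 'cV[R]_2 :=
  if 0 < lead u then V (proj u) else - V (proj u).

Lemma odd_extZ V t u : u != 0 -> 0 < t -> odd_ext V (t *: u) = odd_ext V u.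
Proof.
by move=> u0 t0; rewrite /odd_ext leadZ pmulr_rgt0 // projZ // gt_eqF.
Qed.

Lemma odd_extN V u : u != 0 -> odd_ext V (- u) = - odd_ext V u.
Proof.
move=> u0; have := lead_neq0 u0; rewrite /odd_ext -scaleN1r leadZ projZ //.
rewrite mulN1r oppr_gt0 neq_lt => /orP[h|h]; rewrite h ltNge (ltW h) /= ?opprK //.
Qed.

Lemma odd_ext_wedge V u v : increasing V -> u != 0 -> v != 0 ->
  0 < wedge u v -> 0 < wedge (odd_ext V u) (odd_ext V v).
Proof.
move=> iV u0 v0; rewrite {1}(lead_hvec u0) {1}(lead_hvec v0) wedgeZl wedgeZr.
have := lead_neq0 v0; have := lead_neq0 u0.
rewrite /odd_ext; move: (lead u) (lead v) (proj u) (proj v) => s t x y s0 t0 H.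
have iW : 0 < wedge (hvec x) (hvec y) -> 0 < wedge (V x) (V y).
  by move=> h; apply: iV; rewrite P1_ltE wedgeC oppr_lt0.
have iW' : 0 > wedge (hvec x) (hvec y) -> 0 < wedge (V y) (V x).
  by move=> h; apply: iV; rewrite P1_ltE.
move: H; case: (ltrgt0P s) s0 => // hs _; case: (ltrgt0P t) t0 => // ht _.
- by rewrite !pmulr_rgt0.
- by rewrite pmulr_rgt0 // nmulr_rgt0 // wedgeNr -wedgeC.
- by rewrite nmulr_rgt0 // pmulr_rlt0 // wedgeNl -wedgeC.
- by rewrite nmulr_rgt0 // nmulr_rlt0 // wedgeNl wedgeNr opprK.
Qed.

Lemma odd_ext_neq0 V u : increasing V -> u != 0 -> odd_ext V u != 0.
Proof.
move=> iV _; have [y xy] := neighbour (proj u).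
have := lam_gt0 (increasing_oriented iV) (adj_neq xy); rewrite normr_gt0.
apply: contraNneq => E; have -> : V (proj u) = 0.
  by move: E; rewrite /odd_ext; case: ifP => // _ /eqP; rewrite oppr_eq0 => /eqP.
by rewrite /wedge !mxE !mul0r subrr.
Qed.

Lemma Acoordinates_onto (x : edge -> {posnum R}) : exists a, Acoordinates a x.
Proof.
have [V iV cV] := lengths_realized (@posval_gt0 _ _ x).
have /choice[rep repP] : forall A : S1 rat, exists v, v != 0 /\ sval A = ray v.
  by move=> A; have [v v0 EA] := proj2_sig A; exists v.
pose f A : nzvec R := Sub (odd_ext V (rep A)) (odd_ext_neq0 iV (repP A).1).
have fE A u : sval A u -> u != 0 /\ val (f A) = odd_ext V u.
  have [r0 ->] := repP A => -[t t0 <-]; split.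
    by rewrite scaler_eq0 negb_or r0 gt_eqF.
  by rewrite odd_extZ.
have fN A : val (f (antipode A)) = - val (f A).
  have [v0 EA] := repP A; have rA : sval A (rep A) by rewrite EA; exact: ray_refl.
  have [|_ ->] := fE (antipode A) (- rep A); first by exists (rep A).
  by rewrite odd_extN.
have fC A B C : ccw_ray A B C -> ccw_ray (ray_of (f A)) (ray_of (f B)) (ray_of (f C)).
  move=> [u [v [w [/fE[u0 Eu] /fE[v0 Ev] /fE[w0 Ew] H]]]].
  exists (val (f A)), (val (f B)), (val (f C)); split; try exact: ray_refl.
  rewrite Eu Ev Ew; move: H; rewrite /ccw_vec.
  have W p q (p0 : p != 0) (q0 : q != 0) (h : 0 < wedge p q) :=
    odd_ext_wedge iV p0 q0 h.
  by case/or3P=> /andP[h1 h2]; rewrite (W _ _ _ _ h1) // (W _ _ _ _ h2) // ?orbT.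
exists (exist _ f (conj fN fC)) => E v w EE /=.
have fV y : val (f (hray y)) = V y.
  have [|_ ->] := fE (hray y) (hvec y); first exact: ray_refl.
  rewrite /odd_ext proj_hvec ifT //.
  by case: y => [y|]; rewrite /lead !mxE /= ?oner_eq0 ?eqxx ltr01.
rewrite -[LHS]/(posval x E) (cV _ _ _ EE) /lam -!fV.
by [].
Qed.

End Decorated.

(** * Shear coordinates *)

Lemma quadrilateralE E v1 v2 v3 v4 :
  quadrilateral E v1 v2 v3 v4 <-> quad val E v2 v1 v4 v3.
Proof.
split=> [[EE /farey_triangleE[a12 a24 a41] /farey_triangleE[a32 _ a43] c1 c2]|].
  by split; [exact: EE | cyc | cyc |];
    split; apply/inC_val => //; rewrite adjC.
move=> [EE c1 c2 [/inC_val a21 /inC_val a14 /inC_val a43 /inC_val a32]].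
have a24 : adj v2 v4 by apply/inC_val; exists E.
by split; [exact: EE | apply: farey_triangleI; rewrite // adjC |
  apply: farey_triangleI; rewrite // adjC | cyc | cyc].
Qed.

Section Shear.
Variable R : realFieldType.
Implicit Types (V : P1Q -> 'cV[R]_2) (b : Xplus_map R).

(** The shear parameter of a quadrilateral as the root of an equation without
    absolute values, invariant under linear maps and rescaling. *)
Definition shear_eqn V (t : R) p q r s : Prop :=
  t * (wedge (V q) (V r) * wedge (V s) (V p)) +
  wedge (V p) (V q) * wedge (V r) (V s) = 0.

Lemma oriented_neq0 V x y : oriented V -> x != y -> wedge (V x) (V y) != 0.
Proof. by move=> oV /(lam_gt0 oV); rewrite normr_gt0. Qed.

(** By [orient_ptolemy], the two products in the equation have opposite signs
    for an oriented family. *)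
Lemma shear_eqnE V t p q r s : oriented V -> ccw p q r -> ccw r s p ->
  shear_eqn V t p q r s <-> t = shear V p q r s.
Proof.
move=> oV pqr rsp.
have n1 : wedge (V q) (V r) != 0 by apply: oriented_neq0 => //; cyc.
have n2 : wedge (V s) (V p) != 0 by apply: oriented_neq0 => //; cyc.
have n3 : wedge (V p) (V q) != 0 by apply: oriented_neq0 => //; cyc.
have n4 : wedge (V r) (V s) != 0 by apply: oriented_neq0 => //; cyc.
have prs : ccw p r s by cyc.
have := orient_ptolemy (oV _ _ _ pqr) (oV _ _ _ prs).
rewrite /shear_eqn /shear /lam -!normrM (wedgeC (V p) (V s)) -normfV -normrM.
move: (wedge (V q) (V r)) (wedge (V s) (V p)) (wedge (V p) (V q))
  (wedge (V r) (V s)) n1 n2 n3 n4 => a c d e a0 c0 d0 e0.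
move=> neg; have {}neg : (a * c) * (d * e) < 0 by lra.
have ac0 : a * c != 0 by rewrite mulf_neq0.
rewrite ltr0_norm; last first.
  move: neg; case: (ltrgt0P (a * c)) ac0 => // h _ n.
    by rewrite pmulr_rlt0 // in n; rewrite ltr_pdivrMr // mul0r.
  by rewrite nmulr_rlt0 // in n; rewrite ltr_ndivrMr // mul0r.
split=> [H|->]; last by rewrite mulNr divfK // addNr.
by apply: (mulIf ac0); rewrite mulNr divfK //; apply/eqP; rewrite -addr_eq0 H.
Qed.

Lemma cross_ratioE (x1 x2 x3 x4 : P1 R) (t : R) :
  wedge (hvec x2) (hvec x3) != 0 -> wedge (hvec x1) (hvec x4) != 0 ->
  t = cross_ratio x1 x2 x3 x4 <->
  t * (wedge (hvec x1) (hvec x4) * wedge (hvec x3) (hvec x2)) +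
    wedge (hvec x2) (hvec x1) * wedge (hvec x4) (hvec x3) = 0.
Proof.
rewrite /cross_ratio (wedgeC (hvec x3) (hvec x2)) (wedgeC (hvec x2) (hvec x1)).
rewrite (wedgeC (hvec x4)) mulrNN.
move: (wedge _ (hvec x3)) (wedge _ (hvec x4)) (wedge _ (hvec x2)) (wedge (hvec x3) _).
move=> a c d e a0 c0; have ac0 : a * c != 0 by rewrite mulf_neq0.
split=> [->|H]; first by rewrite mulrN [c * a]mulrC mulrN divfK // addNr.
by apply: (mulIf ac0); rewrite divfK //; lra.
Qed.

Lemma shear_eqn_scale V V' (c : P1Q -> R) t p q r s : (forall x, c x != 0) ->
  (forall x, V' x = c x *: V x) ->
  shear_eqn V t p q r s <-> shear_eqn V' t p q r s.
Proof.
move=> c0 E; rewrite /shear_eqn !E !wedgeZl !wedgeZr.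
have k0 : c p * c q * c r * c s != 0 by rewrite !mulf_neq0.
move: (c p) (c q) (c r) (c s) k0 => i j k l n0.
move: (wedge _ (V r)) (wedge _ (V p)) (wedge _ (V q)) (wedge _ (V s)) => x y z w.
have -> : t * (j * (k * x) * (l * (i * y))) + i * (j * z) * (k * (l * w)) =
  i * j * k * l * (t * (x * y) + z * w) by lra.
split=> [->|/eqP]; first by rewrite mulr0.
by rewrite mulf_eq0 (negPf n0) => /eqP.
Qed.

Lemma shear_eqn_mulmx V (g : 'M[R]_2) t p q r s :
  shear_eqn V t p q r s -> shear_eqn (fun x => g *m V x) t p q r s.
Proof.
rewrite /shear_eqn !wedge_mulmx; move: (\det g) => d.
move: (wedge _ (V r)) (wedge _ (V p)) (wedge _ (V q)) (wedge _ (V s)) => x y z w H.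
have -> : t * (d * x * (d * y)) + d * z * (d * w) = d * d * (t * (x * y) + z * w) by lra.
by rewrite H mulr0.
Qed.

Lemma shear_eqn_uniq V t t' p q r s : wedge (V q) (V r) != 0 ->
  wedge (V s) (V p) != 0 -> shear_eqn V t p q r s -> shear_eqn V t' p q r s ->
  t = t'.
Proof.
move=> n1 n2 E E'; apply: (mulIf (mulf_neq0 n1 n2)).
by move: E E'; rewrite /shear_eqn; lra.
Qed.

(** Three vertices and the shear determine the fourth one: the equation says
    that it lies on a line. *)
Lemma shear_eqn_inj (V V' : P1Q -> 'cV[R]_2) t p q r s :
  V p = V' p -> V q = V' q -> V r = V' r ->
  wedge (V p) (V q) != 0 -> wedge (V p) (V r) != 0 ->
  shear_eqn V t p q r s -> shear_eqn V' t p q r s -> wedge (V s) (V' s) = 0.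
Proof.
rewrite /shear_eqn => <- <- <- pq pr.
pose u := (t * wedge (V q) (V r)) *: V p - wedge (V p) (V q) *: V r.
have line z : t * (wedge (V q) (V r) * wedge z (V p)) +
    wedge (V p) (V q) * wedge (V r) z = wedge z u.
  by rewrite wedgeDr wedgeNr !wedgeZr (wedgeC (V r)); lra.
rewrite !line => H H'; have n : wedge (V p) u != 0.
  by rewrite wedgeDr wedgeNr !wedgeZr wedgevv mulr0 add0r oppr_eq0 mulf_neq0.
apply: (mulIf n); by rewrite mul0r wedge_plucker H H' mulr0 mul0r addr0.
Qed.

Definition shear_solution V (X : edge -> R) : Prop :=
  forall E p q r s, quad val E p q r s -> shear_eqn V (X E) p q r s.

Lemma Xplus_oriented b : oriented (fun x => hvec (sval b x)).
Proof. by move=> x y z /(proj2_sig b); rewrite ccw_orient. Qed.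

Lemma Xcoordinates_eqn b x :
  Xcoordinates b x <-> shear_solution (fun v => hvec (sval b v)) (posval x).
Proof.
have oV := @Xplus_oriented b.
have key v1 v2 v3 v4 : ccw v2 v1 v4 -> ccw v4 v3 v2 ->
    wedge (hvec (sval b v2)) (hvec (sval b v3)) != 0 /\
    wedge (hvec (sval b v1)) (hvec (sval b v4)) != 0.
  by move=> c1 c2; split; apply: (oriented_neq0 oV); cyc.
split=> H E.
  move=> p q r s Q; have [_ c1 c2 _] := Q; have [n1 n2] := key _ _ _ _ c1 c2.
  by apply/(cross_ratioE _ n1 n2); apply: (H E); apply/quadrilateralE.
move=> v1 v2 v3 v4 /quadrilateralE Q; have [_ c1 c2 _] := Q.
have [n1 n2] := key _ _ _ _ c1 c2.
by apply/(cross_ratioE _ n1 n2); exact: H.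
Qed.

Lemma Xcoordinates_ex b : exists x, Xcoordinates b x.
Proof.
have oV := @Xplus_oriented b; pose V x := hvec (sval b x).
have /choice[X HX] : forall E : edge, exists t, 0 < t /\
    forall p q r s, quad val E p q r s -> t = shear V p q r s.
  move=> E; have [p [q [r [s Q]]]] := quad_ex triangulation_farey E.
  exists (shear V p q r s); split.
    have [_ c1 c2 _] := Q.
    by rewrite /shear divr_gt0 // mulr_gt0 // lam_gt0 //; cyc.
  move=> p' q' r' s' Q'.
  by case: (quad_uniq triangulation_farey Q Q') => -[-> -> -> ->] //; rewrite shear_rot.
have [x Ex] := posvalE (fun E => (HX E).1); exists x; apply/Xcoordinates_eqn.
move=> E p q r s Q; have [_ c1 c2 _] := Q; apply/(shear_eqnE _ oV c1 c2).
by rewrite -Ex; exact: (HX E).2.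
Qed.

Lemma Xcoordinates_onto (x : edge -> {posnum R}) : exists b, Xcoordinates b x.
Proof.
have [V iV sV] := shears_realized (@posval_gt0 _ _ x).
have oV := increasing_oriented iV.
have V0 y : V y != 0.
  have [z yz] := neighbour y; apply: contraNneq (oriented_neq0 oV (adj_neq yz)) => ->.
  by rewrite /wedge !mxE !mul0r subrr.
have /choice[c cP] : forall y, exists c, c != 0 /\ hvec (proj (V y)) = c *: V y.
  move=> y; have [c c0 E] := hvec_proj (V0 y); exists c^-1; rewrite invr_eq0; split=> //.
  by rewrite {2}E scalerA mulVf // scale1r.
have bP y z w : ccw y z w -> ccw (proj (V y)) (proj (V z)) (proj (V w)).
  move=> /oV yzw; rewrite ccw_orient !(cP _).2 orient_scale mulr_gt0 //.
  by rewrite exprn_even_gt0 //= !mulf_neq0 // (cP _).1.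
exists (exist _ (fun y => proj (V y)) bP); apply/Xcoordinates_eqn => E p q r s Q /=.
apply/(shear_eqn_scale _ _ _ _ _ (fun y => (cP y).1) (fun y => (cP y).2)).
have [_ c1 c2 _] := Q; apply/(shear_eqnE _ oV c1 c2); exact: sV.
Qed.

Lemma Xplus_neq b x y : x != y -> sval b x != sval b y.
Proof. by move=> /(oriented_neq0 (@Xplus_oriented b)); rewrite wedge_hvec_eq0. Qed.

Lemma shear_solution_mobius b (g : 'M[R]_2) X : g \in unitmx ->
  shear_solution (fun v => hvec (sval b v)) X ->
  shear_solution (fun v => hvec (mobius g (sval b v))) X.
Proof.
move=> gu H E p q r s /H/(shear_eqn_mulmx g).
have /choice[c cP] : forall y, exists c, c != 0 /\
    hvec (mobius g (sval b y)) = c *: (g *m hvec (sval b y)).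
  move=> y; have [|c c0 E'] := @hvec_proj _ (g *m hvec (sval b y)).
    apply: contraNneq (hvec_neq0 (sval b y)) => E'.
    by rewrite -(mulKmx gu (hvec _)) E' mulmx0.
  exists c^-1; rewrite invr_eq0; split=> //.
  by rewrite [X in _ = _ *: X]E' scalerA mulVf // scale1r.
by move/(shear_eqn_scale _ _ _ _ _ (fun y => (cP y).1) (fun y => (cP y).2)).
Qed.

(** A projective map can be chosen to make the two maps agree at zero, one
    and infinity; by [shear_eqn_inj] the agreement propagates through
    reflections. *)
Lemma PGL_coordinates b b' x x' : Xcoordinates b x -> Xcoordinates b' x' ->
  PGL_rel b b' <-> x = x'.
Proof.
move=> /Xcoordinates_eqn cx /Xcoordinates_eqn cx'; split=> [/asboolP[g gu H]|xx].
  apply: posval_inj; apply/funext => E.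
  have [p [q [r [s Q]]]] := quad_ex triangulation_farey E; have [_ c1 c2 _] := Q.
  have oV := @Xplus_oriented b'.
  have Q1 := shear_solution_mobius gu cx Q; have Q2 := cx' _ _ _ _ _ Q.
  have EH v : mobius g (sval b v) = sval b' v by rewrite H.
  have {}Q1 : shear_eqn (fun v => hvec (sval b' v)) (posval x E) p q r s.
    by move: Q1; rewrite /shear_eqn !EH.
  by apply: shear_eqn_uniq Q1 Q2; apply: (oriented_neq0 oV); cyc.
rewrite -xx in cx'; apply/asboolP.
have n01 (c : Xplus_map R) : [/\ sval c None != sval c (Some 0), sval c (Some 0) != sval c (Some 1)
    & sval c (Some 1) != sval c None] by split; exact: Xplus_neq.
have [n1 n2 n3] := n01 b; have [M Mu [Moo M0 M1]] := mobius_triple n1 n2 n3.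
have [n1' n2' n3'] := n01 b'; have [M' Mu' [Moo' M0' M1']] := mobius_triple n1' n2' n3'.
pose g := M' *m invmx M; have gu : g \in unitmx by rewrite unitmx_mul Mu' unitmx_inv.
have gM z : mobius g (mobius M z) = mobius M' z.
  by rewrite -mobiusM // /g -mulmxA mulVmx // mulmx1.
exists g => //; apply/funext => v; apply/esym; rewrite /=.
move: v; apply: farey_ind; rewrite -?Moo -?M0 -?M1 ?gM //.
move=> u v w uv vw wu Eu Ev Ew.
have sol := shear_solution_mobius gu cx.
have step E p q r s : quad val E p q r s -> mobius g (sval b p) = sval b' p ->
    mobius g (sval b q) = sval b' q -> mobius g (sval b r) = sval b' r ->
    mobius g (sval b s) = sval b' s.
  move=> Q Ep Eq Er; have [_ c1 c2 _] := Q; apply/eqP; rewrite -wedge_hvec_eq0; apply/eqP.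
  have oV := @Xplus_oriented b'.
  apply: (shear_eqn_inj _ _ _ _ _ (sol _ _ _ _ _ Q) (cx' _ _ _ _ _ Q)); rewrite ?Ep ?Eq ?Er //;
    by apply: (oriented_neq0 oV); cyc.
have [E EE] := edge_ex uv; have [h1 h2 h3] := reflection_spec uv vw wu.
have [[n4 n5] n6] := (adj_neq uv, adj_neq vw, adj_neq wu).
have n7 := adj_neq h1; have n8 := adj_neq h2.
case: (boolP (ccw u v w)) h3 => c1 /= h3.
  apply: (step E v w u) => //; split; rewrite ?EE; [by rewrite fset2C | cyc | | ].
    by have /orP[|/idP] : ccw u v (reflection u v w) || ccw u (reflection u v w) v;
      [cyc | rewrite h3 | ].
  by split; apply/inC_val; rewrite // adjC.
apply: (step E u w v) => //; split; rewrite ?EE //; [cyc | by rewrite ccw_rot ccw_rot h3 |].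
by split; apply/inC_val; rewrite // adjC.
Qed.

End Shear.

Theorem theorem2p35 (R : realType) :
  (exists f : Xplus R -> Xspace R farey_seed,
     bijective f /\
     forall b : Xplus_map R, exists2 x : edge -> {posnum R},
       Xcoordinates b x &
       f (\pi_(Xplus R) b) = \pi_(Xspace R farey_seed) ([::], x))
  /\
  (exists f : Aplus R -> Aspace R farey_seed,
     bijective f /\
     forall a : Aplus_map R, exists2 x : edge -> {posnum R},
       Acoordinates a x &
       f (\pi_(Aplus R) a) = \pi_(Aspace R farey_seed) ([::], x))
  /\
  (exists phi : modular_group R farey_seed -> (P1Q -> P1Q),
     [/\ {morph phi : g h / (g * h)%g >-> g \o h},
         injective phi & range phi = thompson])
  /\
  (exists psi : modular_group R farey_seed -> special_modular_group farey_seed,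
     bijective psi /\ {morph psi : g h / (g * h)%g}).
Proof.
split; [|split; [|split]].
- apply: (chart_bijection farey_seed (@pos_stepX edge R) (@inv_stepX edge R)).
  + exact: Xcoordinates_ex.
  + exact: Xcoordinates_onto.
  + by move=> b b' x x' cx cx'; exact: (PGL_coordinates cx cx').
- apply: (chart_bijection farey_seed (@pos_stepA edge R) (@inv_stepA edge R)).
  + exact: Acoordinates_ex.
  + exact: Acoordinates_onto.
  + by move=> a a' x x' cx cx'; exact: (SL_coordinates cx cx').
- exact: modular_group_thompson.
- exact: modular_group_special.
Qed.
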